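(* Let $\mathbb{M}$ be the MacLane space of $(K,v)$, let $\mathbb{P}$ be the set of prime polynomials with respect to $v$, and let $\approx$ be Okutsu equivalence on $\mathbb{P}$. The mapping $$\mathbb{M}\longrightarrow\mathbb{P}/\!\approx,\qquad(\mu,\mathcal{L})\mapsto \mathrm{KP}(\mu)_{\mathcal{L}}$$ is bijective. The inverse map is determined by $F\mapsto(\mu_F,\mathcal{R}_{\mu_F}(F))$.
   Context: **Valuations.** $K$ is a field with a discrete valuation $v\colon K^*\to\mathbb{Z}$, $v(K^* )=\mathbb{Z}$, valuation ring $\mathcal{O}$. $K_v$ is the completion, $\mathcal{O}_v$ its valuation ring, and $v$ also denotes its canonical extension $v\colon\overline K_v\to\mathbb{Q}\cup\{\infty\}$ to a fixed algebraic closure. $\mathbb{V}$ is the set of discrete valuations $\mu\colon K(x)^*\to\mathbb{Q}$ with $\mu|_K=v$, $\mu(x)\ge0$; put $\mu(0)=\infty$, $\Gamma(\mu)=\mu(K(x)^* )$. $\mu_0\in\mathbb{V}$ is given by $\mu_0(\sum_s a_sx^s)=\min_s v(a_s)$. **Graded algebra, residual ideals.** For $\alpha\in\Gamma(\mu)$, $\mathcal P_\alpha=\{g\in K[x]:\mu(g)\ge\alpha\}$, $\mathcal P_\alpha^+=\{g\in K[x]:\mu(g)>\alpha\}$, $\mathcal{G}r(\mu)=\bigoplus_{\alpha}\mathcal P_\alpha/\mathcal P_\alpha^+$, $\Delta(\mu)=\mathcal P_0/\mathcal P_0^+$, $H_\mu(0)=0$ and $H_\mu(g)=g+\mathcal P^+_{\mu(g)}$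 for $g\ne0$; $h\mid_\mu g$ means that $H_\mu(h)$ divides $H_\mu(g)$ in $\mathcal{G}r(\mu)$. The residual ideal of $g$ is $\mathcal{R}_\mu(g)=\Delta(\mu)\cap H_\mu(g)\mathcal{G}r(\mu)$. **Key polynomials, chains.** A key polynomial for $\mu$ is a monic $\phi$ of positive degree such that $H_\mu(\phi)\mathcal{G}r(\mu)$ is a non-zero prime ideal and $\phi\nmid_\mu g$ for all non-zero $g$ with $\deg g<\deg\phi$. For such $\phi$ and $\lambda\in\mathbb{Q}_{>0}$, $[\mu;(\phi,\lambda)]\in\mathbb V$ is the valuation $\sum_s g_s\phi^s\mapsto\min_s\{\mu(g_s\phi^s)+s\lambda\}$ on $\phi$-expansions ($\deg g_s<\deg\phi$). $\mu$ is inductive, written $\mu\in\mathbb{V}^{\mathrm{ind}}$, if it is obtained from $\mu_0$ by finitely many augmentations $\mu_i=[\mu_{i-1};(\phi_i,\lambda_i)]$, $1\le i\le r$, $\mu_r=\mu$; the chain is an optimal MacLane chain if $\deg\phi_1<\cdots<\deg\phi_r$. Every inductive valuation has optimal MacLane chains, all of the same length $r$ and with the same $m_r(\mu):=\deg\phi_r$. A key polynomial $\phi$ is strong if $r=0$ or $\deg\phi>m_r(\mu)$. **Passage to $K_v$.** Every inductive valuation $\mu$ on $K(x)$ is the restriction of a unique inductive valuation on $K_v(x)$ (same definitions with $K_v$ in place of $K$), again denoted $\mu$, with canonically the same graded algebra. Thus $H_\mu$, $\mathcal{R}_\mu$, and the notion of (strong) key polynomial are applied to polynomials in $K_v[x]$.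 $\mathrm{KP}(\mu)$ is the set of key polynomials for $\mu$ in $K_v[x]$, and for a maximal ideal $\mathcal{L}$ of $\Delta(\mu)$, $\mathrm{KP}(\mu)_{\mathcal{L}}=\{\phi\in\mathrm{KP}(\mu):\mathcal{R}_\mu(\phi)=\mathcal{L}\}$. **Prime polynomials.** $\mathbb{P}$ is the set of monic irreducible polynomials in $\mathcal{O}_v[x]$ (prime polynomials). Let $F\in\mathbb{P}$ have root $\theta\in\overline K_v$. Let $F_1,\dots,F_r\in\mathcal{O}[x]$ be monic with $1\le\deg F_1<\cdots<\deg F_r<\deg F$; put $F_{r+1}=F$, $C_0=0$, $C_i=v(F_i(\theta))/\deg F_i$ for $1\le i\le r+1$. $[F_1,\dots,F_r]$ is an Okutsu frame of $F$ if for all $0\le i\le r$ one has $C_i<C_{i+1}$ and every monic $g\in\mathcal{O}[x]$ of positive degree with $\deg g<\deg F_{i+1}$ satisfies $v(g(\theta))/\deg g\le C_i$. Okutsu frames exist; $r$ and $C_i(F):=C_i$ depend only on $F$. Put $\delta_0(F)=\deg(F)C_r(F)$. The valuation $\mu_F$ on $K_v(x)$ is determined by $\mu_F(a)=v(a(\theta))$ if $\deg a<\deg F$; $\mu_F(F)=\delta_0(F)$; $\mu_F(g)=\min_s\mu_F(a_sF^s)$ for the $F$-expansion $g=\sum_sa_sF^s\in K_v[x]$. Its restriction to $K(x)$ is also denoted $\mu_F$; it is an inductive valuation. Two prime polynomials $F,G$ of the same degree are Okutsu equivalent, $F\approx G$, if $v(G(\theta))>\delta_0(F)$ (polynomials of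 different degree are not equivalent); this is an equivalence relation on $\mathbb P$. **MacLane space.** A maximal ideal $\mathcal{L}$ of $\Delta(\mu)$ is strong if $\mathcal{L}=\mathcal{R}_\mu(\phi)$ for some strong key polynomial $\phi$ for $\mu$. $\mathbb{M}=\{(\mu,\mathcal{L}):\mu\in\mathbb{V}^{\mathrm{ind}},\ \mathcal{L}\text{ a strong maximal ideal of }\Delta(\mu)\}$. *)

(* Defs.v *)
From HB Require Import structures.
From mathcomp Require Import all_boot all_order all_algebra.
From mathcomp Require Import finmap monalg.
From mathcomp Require Import boolp classical_sets functions constructive_ereal.
Set Implicit Arguments.
Unset Strict Implicit.
Unset Printing Implicit Defensive.
Import Order.TTheory GRing.Theory Num.Theory.
Local Open Scope fset_scope.
Local Open Scope classical_set_scope.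
Local Open Scope ereal_scope.
Local Open Scope ring_scope.

(* {malg R[rat]} with the convolution product.  The ring structure of         *)
(* monalg.v requires exponents in a monoid without non-trivial units, which   *)
(* excludes the additive group of rat, so the product is redone here.         *)
Definition ratalg (R : comNzRingType) : Type := {malg R[rat]}.
HB.instance Definition _ (R : comNzRingType) :=
  GRing.Zmodule.on (ratalg R).

Section RatAlg.
Variable R : comNzRingType.
Implicit Types f g : {malg R[rat]}.

Definition ramul f g : {malg R[rat]} :=
  \sum_(a <- msupp f) \sum_(b <- msupp g) << f@_a * g@_b *g a + b >>.

Definition raone : {malg R[rat]} := << 1 *g 0 >>.

Lemma ramulw (d1 d2 : {fset rat}) f g :
  (msupp f `<=` d1)%fset -> (msupp g `<=` d2)%fset ->
  ramul f g = \sum_(a <- d1) \sum_(b <- d2) << f@_a * g@_b *g a + b >>.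
Proof.
move=> le_d1 le_d2; rewrite /ramul (big_fset_incl _ le_d1) /=.
  apply/eq_bigr=> a _; apply/big_fset_incl => // b _ /mcoeff_outdom ->.
  by rewrite mulr0 monalgU0.
move=> a _ /mcoeff_outdom fa.
by rewrite big1 // => b _; rewrite fa mul0r monalgU0.
Qed.

Lemma ramul0g : left_zero 0 ramul.
Proof. by move=> g; rewrite /ramul msupp0 big_seq_fset0. Qed.

Lemma ramulC : commutative ramul.
Proof.
move=> f g; rewrite /ramul exchange_big /=.
by apply: eq_bigr => a _; apply: eq_bigr => b _; rewrite mulrC addrC.
Qed.

Lemma ramulUg c a g :
  ramul << c *g a >> g = \sum_(b <- msupp g) << c * g@_b *g a + b >>.
Proof.
rewrite (ramulw msuppU_le (fsubset_refl _)) big_seq_fset1.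
by apply/eq_bigr => b _; rewrite mcoeffUU.
Qed.

Lemma ramulUU c d a b :
  ramul << c *g a >> << d *g b >> = << c * d *g a + b >>.
Proof. by rewrite (ramulw msuppU_le msuppU_le) !big_seq_fset1 !mcoeffUU. Qed.

Lemma ramulEl f g : ramul f g = \sum_(a <- msupp f) ramul << f@_a *g a >> g.
Proof. by apply/eq_bigr=> a _; rewrite ramulUg. Qed.

Lemma ramulEr f g : ramul f g = \sum_(b <- msupp g) ramul f << g@_b *g b >>.
Proof. by rewrite ramulC ramulEl; apply: eq_bigr => b _; rewrite ramulC. Qed.

Lemma ramul1g : left_id raone ramul.
Proof.
move=> g; rewrite ramulUg [RHS]monalgE.
by apply/eq_bigr=> b _; rewrite mul1r add0r.
Qed.

Lemma ramulgDl : left_distributive ramul +%R.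
Proof.
move=> f1 f2 g.
rewrite [in RHS](ramulw (fsubsetUl _ (msupp f2)) (fsubset_refl _)).
rewrite [in RHS](ramulw (fsubsetUr (msupp f1) _) (fsubset_refl _)).
rewrite (ramulw (msuppD_le _ _) (fsubset_refl _)).
rewrite -big_split /=; apply/eq_bigr=> a _.
rewrite -big_split /=; apply/eq_bigr=> b _.
by rewrite mcoeffD mulrDl monalgUD.
Qed.

Lemma ramulgDr : right_distributive ramul +%R.
Proof. by move=> f g h; rewrite ramulC ramulgDl !(ramulC f). Qed.

Lemma ramulg0 : right_zero 0 ramul.
Proof. by move=> f; rewrite ramulC ramul0g. Qed.

Lemma ramulA : associative ramul.
Proof.
move=> f g h.
rewrite [RHS](big_morph (ramul^~ _) (fun _ _ => ramulgDl _ _ _) (ramul0g _)).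
rewrite ramulEl; apply/eq_bigr=> a _.
rewrite [LHS](big_morph (ramul _) (fun _ _ => ramulgDr _ _ _) (ramulg0 _)).
rewrite [RHS](big_morph (ramul^~ _) (fun _ _ => ramulgDl _ _ _) (ramul0g _)).
apply/eq_bigr=> b _.
rewrite [LHS](big_morph (ramul _) (fun _ _ => ramulgDr _ _ _) (ramulg0 _)).
by rewrite ramulEr; apply/eq_bigr=> c _; rewrite !ramulUU mulrA addrA.
Qed.

Lemma raone_neq0 : raone != 0.
Proof.
by apply/eqP/malgP=> /(_ 0) /eqP; rewrite mcoeffUU mcoeff0 oner_eq0.
Qed.

HB.instance Definition _ := GRing.Zmodule_isComNzRing.Build (ratalg R)
  ramulA ramulC ramul1g ramulgDl raone_neq0.

Lemma mcoeff_ramul f g c : ((f : ratalg R) * g : ratalg R)@_c =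
  \sum_(a <- msupp f) \sum_(b <- msupp g) (f@_a * g@_b) *+ (a + b == c).
Proof.
rewrite raddf_sum /=; apply: eq_bigr => a _.
by rewrite raddf_sum /=; apply: eq_bigr => b _; rewrite mcoeffU.
Qed.

End RatAlg.

Record valuation (L : fieldType) := Valuation {
  valfun :> L -> \bar rat;
  val0 : valfun 0 = +oo%E;
  val_fin : forall a, a != 0 -> valfun a \is a fin_num;
  valM : forall a b, valfun (a * b) = (valfun a + valfun b)%E;
  valD : forall a b, (Order.min (valfun a) (valfun b) <= valfun (a + b)%R)%E
}.

Section ValuationTheory.
Variables (L : fieldType) (v : valuation L).

Lemma val1 : v 1 = 0%E.
Proof.
have := valM v 1 1; rewrite mulr1.
move: (val_fin v (oner_neq0 L)); case: (v 1) => //= r _ [].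
by rewrite -{1}[r]addr0 => /addrI <-.
Qed.

Lemma valN a : v (- a) = v a.
Proof.
have vN1 : v (-1) = 0%E.
  have := valM v (-1) (-1); rewrite mulrNN mulr1 val1.
  have /(val_fin v) : -1 != 0 :> L by rewrite oppr_eq0 oner_neq0.
  case: (v (-1)) => //= r _ [] /eqP.
  by rewrite eq_sym -mulr2n mulrn_eq0 /= => /eqP ->.
by rewrite -mulN1r valM vN1 add0e.
Qed.

Lemma valD_ge (x : \bar rat) a b :
  (x <= v a)%E -> (x <= v b)%E -> (x <= v (a + b)%R)%E.
Proof. by move=> xa xb; apply: le_trans (valD v a b); rewrite le_min xa xb. Qed.

Lemma valD_gt (x : \bar rat) a b :
  (x < v a)%E -> (x < v b)%E -> (x < v (a + b)%R)%E.
Proof. by move=> xa xb; apply: lt_le_trans (valD v a b); rewrite lt_min xa xb. Qed.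

Lemma val_sum_ge (x : \bar rat) I (r : seq I) (F : I -> L) :
  (forall i, (x <= v (F i))%E) -> (x <= v (\sum_(i <- r) F i)%R)%E.
Proof.
move=> xF; elim/big_ind: _ => //; first by rewrite val0 leey.
by move=> a b; apply: valD_ge.
Qed.

Lemma val_sum_gt (x : rat) I (r : seq I) (F : I -> L) :
  (forall i, (x%:E < v (F i))%E) -> (x%:E < v (\sum_(i <- r) F i)%R)%E.
Proof.
move=> xF; elim/big_ind: _ => //; first by rewrite val0 ltry.
by move=> a b; apply: valD_gt.
Qed.

End ValuationTheory.

(* {poly K} sits in K(x) = {fraction {poly K}} through _%:F. *)
Notation pval mu g := (valfun mu (FracField.tofrac g)).

Section GradedAlgebra.
Variables (K : fieldType) (mu : valuation {fraction {poly K}}).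
Implicit Types f g : ratalg {poly K}.

(* Gr(mu) = (\bigoplus_a P_a t^a) / (\bigoplus_a P_a^+ t^a), a ranging over   *)
(* rat.  If a is not in the value group of mu, then P_a = P_a^+ and the       *)
(* component of degree a vanishes.                                            *)
Definition rees : {pred ratalg {poly K}} :=
  fun f => `[< forall a : rat, (a%:E <= pval mu f@_a)%E >].

Lemma reesP f : reflect (forall a : rat, (a%:E <= pval mu f@_a)%E) (f \in rees).
Proof. exact: asboolP. Qed.

Lemma rees_subring_closed : subring_closed rees.
Proof.
split.
- apply/reesP => a; rewrite mcoeffU; case: eqP => [<-|_].
    by rewrite mulr1n tofrac1 val1.
  by rewrite mulr0n tofrac0 val0 leey.
- move=> f g /reesP hf /reesP hg; apply/reesP => a.
  by rewrite mcoeffB tofracB; apply: valD_ge; rewrite ?valN.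
- move=> f g /reesP hf /reesP hg; apply/reesP => c.
  rewrite mcoeff_ramul rmorph_sum /=; apply: val_sum_ge => a.
  rewrite rmorph_sum /=; apply: val_sum_ge => b.
  case: eqP => [<-|_]; last by rewrite mulr0n tofrac0 val0 leey.
  by rewrite mulr1n tofracM valM EFinD; apply: leeD.
Qed.

HB.instance Definition _ :=
  GRing.isSubringClosed.Build (ratalg {poly K}) rees rees_subring_closed.

Record rees_type := Rees { rees_val :> ratalg {poly K}; _ : rees_val \in rees }.
HB.instance Definition _ := [isSub for rees_val].
HB.instance Definition _ := [Choice of rees_type by <:].
HB.instance Definition _ := [SubChoice_isSubComNzRing of rees_type by <:].

Definition rees_plus : {pred rees_type} :=
  fun f : rees_type => `[< forall a : rat, (a%:E < pval mu (val f)@_a)%E >].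

Lemma rees_plusP (f : rees_type) :
  reflect (forall a : rat, (a%:E < pval mu (val f)@_a)%E) (f \in rees_plus).
Proof. exact: asboolP. Qed.

Lemma rees_plus_idealr_closed : idealr_closed rees_plus.
Proof.
split.
- by apply/rees_plusP => a; rewrite rmorph0 mcoeff0 tofrac0 val0 ltry.
- apply/negP => /rees_plusP/(_ 0).
  by rewrite rmorph1 mcoeffUU tofrac1 val1 ltxx.
- move=> h f g /rees_plusP hf /rees_plusP hg; apply/rees_plusP => c.
  rewrite rmorphD rmorphM /= mcoeffD tofracD; apply: valD_gt => //.
  rewrite mcoeff_ramul rmorph_sum /=; apply: val_sum_gt => a.
  rewrite rmorph_sum /=; apply: val_sum_gt => b.
  case: eqP => [<-|_]; last by rewrite mulr0n tofrac0 val0 ltry.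
  rewrite mulr1n tofracM valM EFinD; apply: lee_ltD => //.
  by have /reesP := valP h; apply.
Qed.

HB.instance Definition _ :=
  isIdealr.Build rees_type rees_plus rees_plus_idealr_closed.

Definition gr : Type := {ideal_quot rees_plus}.
HB.instance Definition _ := GRing.ComNzRing.on gr.

(* g + P_a^+ in degree a; meaningful when a <= mu(g), see rees_monomial *)
Definition gr_class (a : rat) (g : {poly K}) : gr :=
  (\pi_gr (insubd (0 : rees_type) (<< g *g a >> : ratalg {poly K})))%qT.

End GradedAlgebra.

Lemma rees_monomial (K : fieldType) (mu : valuation {fraction {poly K}})
    (a : rat) (g : {poly K}) :
  (a%:E <= pval mu g)%E -> (<< g *g a >> : ratalg {poly K}) \in rees mu.
Proof.
move=> ag; apply/reesP => b; rewrite mcoeffU; case: eqP => [<-|_].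
  by rewrite mulr1n.
by rewrite mulr0n tofrac0 val0 leey.
Qed.

Section ResidualIdeals.
Variables (K : fieldType) (mu : valuation {fraction {poly K}}).
Implicit Types g h phi : {poly K}.

(* for g = 0 this is the class of 0, whatever fine (+oo) is *)
Definition initial_form g : gr mu := gr_class mu (fine (pval mu g)) g.

Definition mu_divides h g : Prop :=
  exists q : gr mu, initial_form g = initial_form h * q.

Definition principal g : set (gr mu) :=
  [set x | exists q : gr mu, x = initial_form g * q].

Definition Delta : set (gr mu) :=
  [set gr_class mu 0 g | g in [set g : {poly K} | (0%:E <= pval mu g)%E]].

Definition residual_ideal g : set (gr mu) := Delta `&` principal g.

Definition key_polynomial phi : Prop :=
  [/\ phi \is monic /\ (1 < size phi)%N,
      principal phi <> [set 0],
      idealr_closed [in principal phi],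
      prime_idealr_closed [in principal phi]
    & forall g, g != 0 -> (size g < size phi)%N -> ~ mu_divides phi g].

(* ideals of the subring Delta, as subsets of gr mu *)
Definition ideal_Delta (I : set (gr mu)) : Prop :=
  [/\ I `<=` Delta, I 0 &
      forall a x y, Delta a -> I x -> I y -> I (a * x + y)].

Definition maximal_ideal_Delta (I : set (gr mu)) : Prop :=
  [/\ ideal_Delta I, I <> Delta &
      forall J, ideal_Delta J -> I `<=` J -> J <> Delta -> J = I].

End ResidualIdeals.
Arguments initial_form {K} mu g.
Arguments principal {K} mu g.
Arguments Delta {K} mu.
Arguments residual_ideal {K} mu g.
Arguments maximal_ideal_Delta {K} mu I.

Section MacLaneChains.
Variables (K : fieldType) (v : valuation K).
Local Notation valx := (valuation {fraction {poly K}}).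
Implicit Types mu : valx.

Definition gauss_valuation mu : Prop := forall g : {poly K},
  pval mu g = \big[Order.min/+oo%E]_(s < size g) v g`_s.

(* a is the phi-expansion of the argument, padded with zeros *)
Definition augmentation mu (phi : {poly K}) (lambda : rat) (mu' : valx) : Prop :=
  forall (n : nat) (a : nat -> {poly K}),
    (forall s, (size (a s) < size phi)%N) ->
    pval mu' (\sum_(s < n) a s * phi ^+ s)%R =
    \big[Order.min/+oo%E]_(s < n)
      (pval mu (a s * phi ^+ s)%R + (s%:R * lambda)%:E)%E.

(* Every mu in a chain extends v, is discrete and has 0 <= mu(x): this holds   *)
(* for the Gauss valuation and is preserved by augmentation.                  *)
Inductive maclane_chain : valx -> seq {poly K} -> Prop :=
| MacLane_nil mu : gauss_valuation mu -> maclane_chain mu [::]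
| MacLane_rcons mu mu' phis phi (lambda : rat) :
    maclane_chain mu phis -> key_polynomial mu phi -> 0 < lambda ->
    augmentation mu phi lambda mu' -> maclane_chain mu' (rcons phis phi).

Definition inductive_val mu : Prop := exists phis, maclane_chain mu phis.

Definition optimal_chain mu (phis : seq {poly K}) : Prop :=
  maclane_chain mu phis /\
  sorted ltn [seq size (polyseq phi) | phi <- phis].

(* The length and the last degree of an optimal chain depend only on mu. *)
Definition strong_key_polynomial mu (phi : {poly K}) : Prop :=
  key_polynomial mu phi /\
  exists2 phis, optimal_chain mu phis &
    phis = [::] \/ (size (last 0%R phis) < size phi)%N.

Definition maclane_point : Type := {mu : valx & set (gr mu)}.

Definition maclane_space : set maclane_point :=
  [set x | [/\ inductive_val (projT1 x), maximal_ideal_Delta (projT1 x) (projT2 x) &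
     exists2 phi, strong_key_polynomial (projT1 x) phi &
       projT2 x = residual_ideal (projT1 x) phi]].

End MacLaneChains.

(* normalized: the value group is Z, inside rat *)
Definition discrete_valuation (K : fieldType) (v : valuation K) : Prop :=
  [set v a | a in [set a : K | a != 0]] = range (fun n : int => (n%:~R : rat)%:E).

Definition completion (K Kv : fieldType) (v : valuation K) (vh : valuation Kv)
    (iota : {rmorphism K -> Kv}) : Prop :=
  [/\ forall a, vh (iota a) = v a,
      forall (y : Kv) (N : rat), exists a : K, (N%:E <= vh (y - iota a)%R)%E &
      forall u : nat -> Kv,
        (forall N : rat, exists m : nat, forall p q : nat,
           (m <= p)%N -> (m <= q)%N -> (N%:E <= vh (u p - u q)%R)%E) ->
        exists l : Kv, forall N : rat, exists m : nat, forall p : nat,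
           (m <= p)%N -> (N%:E <= vh (u p - l)%R)%E].

Definition algebraic_closure (F E : fieldType) (j : {rmorphism F -> E}) : Prop :=
  GRing.closed_field_axiom E /\ forall z : E, algebraicOver j z.

Definition integers (K : fieldType) (v : valuation K) : {pred K} :=
  fun a => (0%:E <= v a)%E.

Section BaseChange.
Variables (K Kv : fieldType) (iota : {rmorphism K -> Kv}).
Local Notation "g ^io" := (map_poly iota g) (at level 2, format "g ^io").

Definition fraction_map (f : {fraction {poly K}}) : {fraction {poly Kv}} :=
  FracField.tofrac (\n_(repr f))^io / FracField.tofrac (\d_(repr f))^io.

Lemma fraction_map_tofrac (g : {poly K}) :
  fraction_map (FracField.tofrac g) = FracField.tofrac g^io.
Proof.
rewrite /fraction_map; set r := repr _.
have dr0 : \d_r != 0 by apply: denom_ratioP.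
have drx0 : FracField.tofrac (\d_r)^io != 0 by rewrite tofrac_eq0 map_poly_eq0.
have -> : \n_r = g * \d_r.
  have := FracField.equivf_l (Ratio g 1).
  rewrite !numden_Ratio ?oner_neq0 // mulr1 [RHS]mulrC => eqr.
  by rewrite /r; unlock FracField.tofrac.
by rewrite rmorphM tofracM mulfK.
Qed.

Definition restricts (muh : valuation {fraction {poly Kv}})
    (mu : valuation {fraction {poly K}}) : Prop :=
  forall f, muh (fraction_map f) = mu f.

Section Gr.
Variables (muh : valuation {fraction {poly Kv}}).
Variables (mu : valuation {fraction {poly K}}) (hmu : restricts muh mu).

Definition ratalg_map (f : ratalg {poly K}) : ratalg {poly Kv} :=
  \sum_(a <- msupp f) << (f@_a)^io *g a >>.

Lemma mcoeff_ratalg_map f a : (ratalg_map f)@_a = (f@_a)^io.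
Proof.
rewrite /ratalg_map raddf_sum /=.
rewrite [in RHS](monalgE f) raddf_sum rmorph_sum /=.
apply: eq_bigr => b _; rewrite !mcoeffU.
by case: eqP => _; rewrite ?mulr1n ?mulr0n ?rmorph0.
Qed.

Lemma ratalg_map_rees (f : rees_type mu) : ratalg_map (val f) \in rees muh.
Proof.
apply/reesP => a; rewrite mcoeff_ratalg_map -fraction_map_tofrac hmu.
by have /reesP := valP f; apply.
Qed.

(* induced by K[x] -> Kv[x]; an isomorphism when muh is inductive *)
Definition gr_map (x : gr mu) : gr muh :=
  (\pi_(gr muh) (Rees (ratalg_map_rees (repr x))))%qT.

End Gr.

Variable vh : valuation Kv.

(* KP(mu), read in Kv[x] through the unique inductive extension of mu *)
Definition KP (mu : valuation {fraction {poly K}}) : set {poly Kv} :=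
  [set phi | exists muh, [/\ inductive_val vh muh, restricts muh mu &
                             key_polynomial muh phi]].

(* The residual ideal of g in Kv[x], as a subset of Gr(mu) = Gr(muh). *)
Definition residual_ideal_ext (mu : valuation {fraction {poly K}})
    (g : {poly Kv}) : set (gr mu) :=
  [set x | exists muh (hmu : restricts muh mu),
     inductive_val vh muh /\ residual_ideal muh g (gr_map hmu x)].

Arguments residual_ideal_ext mu g : clear implicits.

Definition KP_at (x : maclane_point K) : set {poly Kv} :=
  [set phi | KP (projT1 x) phi /\
             residual_ideal_ext (projT1 x) phi = projT2 x].

End BaseChange.
Arguments residual_ideal_ext {K Kv} iota vh mu g.

Section Okutsu.
Variables (K Kv Kbar : fieldType) (v : valuation K) (vh : valuation Kv).
Variables (w : valuation Kbar).
Variables (iota : {rmorphism K -> Kv}) (j : {rmorphism Kv -> Kbar}).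
Implicit Types (F G : {poly Kv}) (Fs : seq {poly K}) (theta : Kbar).

(* irreducible elements of the ring O_v[x] *)
Definition unit_over_integers F : Prop :=
  exists2 G, G \is a polyOver (integers vh) & F * G = 1.

Definition prime_polynomial : set {poly Kv} :=
  [set F | [/\ F \is monic, F \is a polyOver (integers vh),
      ~ unit_over_integers F &
      forall G H, G \is a polyOver (integers vh) ->
        H \is a polyOver (integers vh) -> F = G * H ->
        unit_over_integers G \/ unit_over_integers H]].

Definition root_val G theta : \bar rat := w (map_poly j G).[theta].

(* v(G(theta)) / deg G *)
Definition weight G theta : \bar rat :=
  (root_val G theta * ((size G).-1%:R^-1)%:E)%E.

Definition frame_nth F Fs (i : nat) : {poly Kv} :=
  nth F [seq map_poly iota Fi | Fi <- Fs] i.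

(* C_i; frame_nth F Fs i is F_{i+1}, with F_{r+1} = F *)
Definition okutsu_C F theta Fs (i : nat) : \bar rat :=
  if i is i'.+1 then weight (frame_nth F Fs i') theta else 0%E.

Definition okutsu_frame F theta Fs : Prop :=
  [/\ forall Fi, Fi \in Fs -> Fi \is monic /\ Fi \is a polyOver (integers v),
      sorted ltn (1%N :: rcons [seq size (polyseq Fi) | Fi <- Fs] (size F)),
      forall i, (i <= size Fs)%N ->
        (okutsu_C F theta Fs i < okutsu_C F theta Fs i.+1)%E &
      forall i, (i <= size Fs)%N -> forall g : {poly K},
        g \is monic -> g \is a polyOver (integers v) -> (1 < size g)%N ->
        (size g < size (frame_nth F Fs i))%N ->
        (weight (map_poly iota g) theta <= okutsu_C F theta Fs i)%E].

(* delta_0(F); its value is independent of the root and of the frame *)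
Definition okutsu_delta0 F theta Fs : \bar rat :=
  (((size F).-1%:R)%:E * okutsu_C F theta Fs (size Fs))%E.

Definition okutsu_valuation F (muF : valuation {fraction {poly Kv}}) : Prop :=
  exists theta Fs,
    [/\ root (map_poly j F) theta, okutsu_frame F theta Fs,
        forall a : {poly Kv}, (size a < size F)%N ->
          pval muF a = root_val a theta,
        pval muF F = okutsu_delta0 F theta Fs &
        forall (n : nat) (a : nat -> {poly Kv}),
          (forall s, (size (a s) < size F)%N) ->
          pval muF (\sum_(s < n) a s * F ^+ s)%R =
          \big[Order.min/+oo%E]_(s < n) pval muF (a s * F ^+ s)%R].

Definition okutsu_equiv F G : Prop :=
  size F = size G /\
  exists theta Fs, [/\ root (map_poly j F) theta, okutsu_frame F theta Fs &
                       (okutsu_delta0 F theta Fs < root_val G theta)%E].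

Definition okutsu_class F : set {poly Kv} :=
  [set G | prime_polynomial G /\ okutsu_equiv F G].

Definition prime_quotient : set (set {poly Kv}) :=
  [set okutsu_class F | F in prime_polynomial].

(* mu is the restriction to K(x) of mu_F *)
Definition okutsu_restriction F (mu : valuation {fraction {poly K}}) : Prop :=
  exists2 muF, okutsu_valuation F muF & restricts iota muF mu.

End Okutsu.

(* Main.v *)
From HB Require Import structures.
Require Import Defs.
From mathcomp Require Import all_boot all_order all_algebra.
From mathcomp Require Import finmap monalg lra ring zify.
From mathcomp Require Import boolp classical_sets functions constructive_ereal.
Set Implicit Arguments.
Unset Strict Implicit.
Unset Printing Implicit Defensive.
Import Order.TTheory GRing.Theory Num.Theory.

(* To a strong key polynomial F of mu, with root theta, the pseudo-valuation  *)
(* g |-> mu(g mod F) on K_v[x] extends v to K_v[x]/(F); as K_v is complete    *)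
(* such an extension is unique, so mu(g mod F) = v(g(theta)).  Hence mu and   *)
(* v(-(theta)) agree below degree deg F, which makes the key polynomials of   *)
(* an optimal chain of mu an Okutsu frame of F and gives mu = mu_F.           *)
(* Conversely, given F with root theta, climb from the Gauss valuation: if mu *)
(* agrees with v(-(theta)) below degree k and not in degree k, then a monic   *)
(* phi of degree k maximizing v(phi(theta)) is a key polynomial of mu, and    *)
(* augmenting mu by it gives agreement in degree k; in degree deg F the       *)
(* polynomial F itself is the key polynomial.                                 *)
(* For key polynomials F, G of mu, equal residual ideals mean that F and G    *)
(* divide each other in Gr(mu), i.e. deg F = deg G and mu(F - G) > mu(F);     *)
(* since mu(F) = delta_0(F), this is Okutsu equivalence.                      *)

Local Open Scope quotient_scope.
Local Open Scope fset_scope.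
Local Open Scope classical_set_scope.
Local Open Scope ereal_scope.
Local Open Scope ring_scope.

(** All valuations involved are treated as pseudo-valuations on polynomials, so that an inductive
    mu, reduction modulo a key polynomial and evaluation at a root are objects of one kind.

    Recovering mu from F. Primality and minimality of a key polynomial F keep values under reduction
    modulo F ([key_mod_mul]), so mu induces a valuation [resval] of the field K_v[x]/(F). Over the
    complete field K_v, norms on a finite-dimensional space are equivalent ([psv_coef_bound]), and
    comparing powers gives a unique extension of v ([psv_residue_unique]); hence mu(g mod F) =
    v(g(theta)), [key_root_val]. Along an optimal chain, monic g satisfy mu(g) <= C_r deg g, with
    equality for strong key polynomials ([chain_slope]). The hard point is [strong_key_lead]: the
    leading digit of a strong key polynomial, expanded in the previous one, is 1. Together these
    give an Okutsu frame ([strong_key_frame]), mu(F) = delta_0(F) ([strong_key_delta0]) and mu =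
    mu_F, hence injectivity.

    Reaching every F. [chain_approximation] climbs degree by degree towards evaluation at theta. In
    each degree a best monic polynomial exists, since values are bounded and the relevant ones lie
    in a discrete group ([maximal_witness]), and it is a key polynomial by [minimal_witness_key].
    This yields [prime_strong_key], hence surjectivity.

    Fibres. Equal residual ideals mean mutual divisibility of initial forms
    ([residual_ideal_ext_mdiv]), hence congruence of the key polynomials ([key_mdiv_congr]);
    [skd_KP_at] identifies this with Okutsu equivalence. Between K and K_v one passes by density: a
    close polynomial has the same initial form ([key_lift], [approx_monic]). *)

Lemma modp_mul2 (K : fieldType) (a b d : {poly K}) :
  ((a %% d) * (b %% d)) %% d = (a * b) %% d.
Proof. by rewrite modp_mul mulrC modp_mul mulrC. Qed.

(* Nonzero polynomials may have value +oo, as for g |-> v(g(theta)).          *)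
Record pseudoval (K : fieldType) := Pseudoval {
  psv :> {poly K} -> \bar rat;
  psv0 : psv 0 = +oo%E;
  psv1 : psv 1 = 0%E;
  psvM : forall a b, psv (a * b) = (psv a + psv b)%E;
  psvD : forall a b, (Order.min (psv a) (psv b) <= psv (a + b))%E;
  psvNy : forall a, psv a != -oo%E
}.

(** * Pseudo-valuations and divisibility of initial forms *)

Section PseudoVal.
Variables (K : fieldType) (m : pseudoval K).
Implicit Types (a b g h q : {poly K}) (c x : \bar rat).

Lemma psvN a : m (- a) = m a.
Proof.
have mN1 : m (-1) = 0%E.
  have := psvM m (-1) (-1); rewrite mulrNN mulr1 psv1.
  move: (psvNy m (-1)); case: (m (-1)) => //= r _ [] /eqP.
  by rewrite eq_sym -mulr2n mulrn_eq0 /= => /eqP ->.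
by rewrite -mulN1r psvM mN1 add0e.
Qed.

Lemma psvBC a b : m (a - b) = m (b - a).
Proof. by rewrite -psvN opprB. Qed.

Lemma psvD_ge c a b : (c <= m a -> c <= m b -> c <= m (a + b)%R)%E.
Proof. by move=> ca cb; apply: le_trans (psvD m a b); rewrite le_min ca cb. Qed.

Lemma psvD_gt c a b : (c < m a -> c < m b -> c < m (a + b)%R)%E.
Proof. by move=> ca cb; apply: lt_le_trans (psvD m a b); rewrite lt_min ca cb. Qed.

Lemma psvB_ge c a b : (c <= m a -> c <= m b -> c <= m (a - b)%R)%E.
Proof. by move=> ca cb; apply: psvD_ge; rewrite ?psvN. Qed.

Lemma psvB_gt c a b : (c < m a -> c < m b -> c < m (a - b)%R)%E.
Proof. by move=> ca cb; apply: psvD_gt; rewrite ?psvN. Qed.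

Lemma psvD_eq a b : (m a < m b)%E -> m (a + b) = m a.
Proof.
move=> ab; apply/eqP; rewrite eq_le psvD_ge ?(ltW ab) // andbT.
rewrite leNgt; apply/negP => h.
by have := psvB_gt h ab; rewrite addrK ltxx.
Qed.

Lemma psvB_eq a b : (m a < m b)%E -> m (a - b) = m a.
Proof. by move=> ab; apply: psvD_eq; rewrite psvN. Qed.

Lemma psv_sub_eq a b : (m a < m (a - b)%R)%E -> m b = m a.
Proof. by move=> ab; rewrite -(psvB_eq ab) subKr. Qed.

Lemma psv_sum_ge c I (r : seq I) (P : pred I) (F : I -> {poly K}) :
  (forall i, P i -> (c <= m (F i))%E) -> (c <= m (\sum_(i <- r | P i) F i)%R)%E.
Proof.
move=> cF; elim/big_ind: _ => //; first by rewrite psv0 leey.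
by move=> a b; apply: psvD_ge.
Qed.

Lemma psvX a r n : m a = r%:E -> m (a ^+ n) = (r *+ n)%:E.
Proof.
move=> ar; elim: n => [|n IH]; first by rewrite expr0 psv1 mulr0n.
by rewrite exprS psvM ar IH mulrS.
Qed.

Lemma psv_neq0 a : m a != +oo%E -> a != 0.
Proof. by apply: contra => /eqP ->; rewrite psv0. Qed.

Definition psv_finite := forall a, a != 0 -> m a \is a fin_num.

(* h divides g in the graded algebra of m; meaningful only if m g is finite *)
Definition mdiv h g := exists q, (m g < m (g - h * q)%R)%E.

(** Primality is asked of initial forms only; [iskey_key_polynomial] extends it to all elements of
    the graded algebra. *)
Record iskey (phi : {poly K}) : Prop := Iskey {
  key_monic : phi \is monic;
  key_size : (1 < size phi)%N;
  key_prime : forall a b, a != 0 -> b != 0 -> mdiv phi (a * b) ->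
    mdiv phi a \/ mdiv phi b;
  key_min : forall g, g != 0 -> (size g < size phi)%N -> ~ mdiv phi g
}.

End PseudoVal.

(** * The residue valuation of a key polynomial *)

Section Key.
Variables (K : fieldType) (m : pseudoval K) (mf : psv_finite m).
Variables (phi : {poly K}) (kphi : iskey m phi).
Implicit Types (a b g h q : {poly K}).

Let phiM := key_monic kphi.

Lemma key_neq0 : phi != 0.
Proof. exact: monic_neq0. Qed.

(** If the sum had larger value than a, then phi would divide the initial form of a, against
    minimality. So distinct digits of a phi-expansion do not cancel. *)
Lemma key_exp_le a q : (size a < size phi)%N ->
  (m (q * phi + a)%R <= m a)%E /\ (m (q * phi + a)%R <= m (q * phi)%R)%E.
Proof.
move=> sa; suff h : (m (q * phi + a)%R <= m a)%E.
  split=> //; have := psvB_ge (lexx (m (q * phi + a))) h.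
  by rewrite addrK.
rewrite leNgt; apply/negP => lt_a.
have a0 : a != 0 by apply: contraTneq lt_a => ->; rewrite psv0 ltNge leey.
apply: (key_min kphi a0 sa); exists (- q).
by rewrite mulrN opprK mulrC addrC.
Qed.

Lemma key_mod_ge g : (m g <= m (g %% phi)%R)%E.
Proof.
rewrite [in X in (X <= _)%E](divp_eq g phi).
by have [] := key_exp_le (g %/ phi) (ltn_modpN0 g key_neq0).
Qed.

Lemma key_div_ge g : (m g <= m (g %/ phi * phi)%R)%E.
Proof.
rewrite [in X in (X <= _)%E](divp_eq g phi).
by have [] := key_exp_le (g %/ phi) (ltn_modpN0 g key_neq0).
Qed.

(** If reduction raised the value, phi would divide the initial form of [a * b], hence by primality
    that of a or b, against minimality. *)
Lemma key_mod_mul a b : (size a < size phi)%N -> (size b < size phi)%N ->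
  m ((a * b) %% phi) = m (a * b).
Proof.
move=> sa sb.
have [->|a0] := eqVneq a 0; first by rewrite mul0r mod0p.
have [->|b0] := eqVneq b 0; first by rewrite mulr0 mod0p.
apply/eqP; rewrite eq_le key_mod_ge andbT leNgt; apply/negP => lt_ab.
have [] : mdiv m phi a \/ mdiv m phi b.
- apply: (key_prime kphi) => //; exists ((a * b) %/ phi).
  by rewrite {2}(divp_eq (a * b) phi) [phi * _]mulrC addrAC subrr add0r.
- exact: (key_min kphi).
- exact: (key_min kphi).
Qed.

Definition resval_fun g := m (g %% phi).

Lemma resval_mul a b : resval_fun (a * b) = (resval_fun a + resval_fun b)%E.
Proof.
rewrite /resval_fun -psvM -(key_mod_mul (a := a %% phi) (b := b %% phi)).
- by rewrite modp_mul2.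
- by rewrite ltn_modpN0 ?key_neq0.
- by rewrite ltn_modpN0 ?key_neq0.
Qed.

Lemma modp_key1 : 1 %% phi = 1.
Proof. by rewrite modp_small // size_poly1 (key_size kphi). Qed.

Lemma resval_subproof1 : resval_fun 1 = 0%E.
Proof. by rewrite /resval_fun modp_key1 psv1. Qed.

Lemma resval_subproofD a b :
  (Order.min (resval_fun a) (resval_fun b) <= resval_fun (a + b))%E.
Proof. by rewrite /resval_fun modpD psvD. Qed.

Lemma resval_subproof0 : resval_fun 0 = +oo%E.
Proof. by rewrite /resval_fun mod0p psv0. Qed.

(** The valuation of the residue field K[x]/(phi), pulled back to K[x]; for finite m its kernel is
    (phi), by [resval_oo]. *)
Definition resval : pseudoval K := Pseudoval resval_subproof0 resval_subproof1
  resval_mul resval_subproofD (fun a => psvNy m (a %% phi)).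

Lemma resvalE g : resval g = m (g %% phi). Proof. by []. Qed.

Lemma resval_small g : (size g < size phi)%N -> resval g = m g.
Proof. by move=> sg; rewrite resvalE modp_small. Qed.

Lemma psv_oo g : (m g == +oo%E) = (g == 0).
Proof.
have [->|g0] := eqVneq g 0; first by rewrite psv0.
by have /fin_numP[_ /negPf] := mf g0.
Qed.

Lemma resval_oo g : (resval g == +oo%E) = (phi %| g).
Proof. by rewrite resvalE psv_oo. Qed.

(** For a proper factorization, [key_mod_mul] equates the value of phi modulo phi, which is
    infinite, with the finite value of phi. *)
Lemma key_irreducible : irreducible_poly phi.
Proof.
split=> [|q sq qphi]; first exact: key_size kphi.
have q0 : q != 0 by apply: contraTneq qphi => ->; rewrite dvd0p key_neq0.
rewrite -dvdp_size_eqp // eqn_leq dvdp_leq ?key_neq0 //= leqNgt; apply/negP => sq2.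
have s0 : phi %/ q != 0 by rewrite divpN0 // ltnW.
have s2 : (size (phi %/ q)%R < size phi)%N.
  rewrite size_divp //; have := size_poly_gt0 q; rewrite q0.
  by move: (key_size kphi) sq; set x := size phi; set y := size q; lia.
have := key_mod_mul sq2 s2.
rewrite mulrC divpK // modpp psv0 => /esym/eqP.
by rewrite psv_oo (negPf key_neq0).
Qed.

(** Bezout gives the inverse modulo phi, and [key_mod_mul] makes its value opposite to that of a. *)
Lemma key_inverse a : a != 0 -> (size a < size phi)%N ->
  exists b, [/\ (size b < size phi)%N, (a * b) %% phi = 1 & (m a + m b = 0)%E].
Proof.
move=> a0 sa.
have : coprimep phi a.
  rewrite coprimep_def eqn_leq -[(_ <= 1)%N]negbK -ltnNge; apply/andP; split.
    apply/negP => sg; have := dvdp_leq a0 (dvdp_gcdr phi a).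
    have [_ /(_ (gcdp phi a))] := key_irreducible.
    rewrite gtn_eqF // dvdp_gcdl => /(_ isT isT)/eqp_size ->.
    by rewrite leqNgt sa.
  by rewrite size_poly_gt0 gcdp_eq0 (negPf key_neq0).
case/Bezout_coprimepP => -[u w] /= /eqpf_eq[c c0 uw].
exists ((c^-1 *: w) %% phi).
have aw : (a * ((c^-1 *: w) %% phi)) %% phi = 1.
  rewrite modp_mul.
  have -> : a * (c^-1 *: w) = (- (c^-1 *: u)) * phi + 1.
    have wa : w * a = c *: 1 - u * phi by rewrite -uw addrC addKr.
    by rewrite mulrC -scalerAl wa scalerBr scalerA mulVf // scale1r mulNr -scalerAl addrC.
  by rewrite modp_addl_mul_small // size_poly1 (key_size kphi).
split=> //; first by rewrite ltn_modpN0 // key_neq0.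
by rewrite -psvM -key_mod_mul ?ltn_modpN0 ?key_neq0 // aw psv1.
Qed.

End Key.
Arguments resval : simpl never.

(** * Construction of augmented valuations *)

Section Augmentation.
Variables (K : fieldType) (minf : pseudoval K) (phi : {poly K}) (c : rat).
Implicit Types (a b g h q : {poly K}).
Hypothesis phi_size : (1 < size phi)%N.
Hypothesis minf_mod : forall g, minf g = minf (g %% phi).
Hypothesis minf_fin : forall a, a != 0 -> (size a < size phi)%N ->
  minf a \is a fin_num.
(** When a product of two digits overflows, the carry, weighted by the value c given to phi, must
    not fall below the product. *)
Hypothesis minf_carry : forall a b, (size a < size phi)%N ->
  (size b < size phi)%N -> (minf (a * b)%R <= minf ((a * b) %/ phi)%R + c%:E)%E.

(** The minimum of minf(a_s) + s c over the phi-digits a_s of g, obtained by repeated division; n is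
    fuel, and the size of g is enough. *)
Fixpoint augf n g : \bar rat :=
  if n is n'.+1 then Order.min (minf g) (augf n' (g %/ phi) + c%:E)%E else +oo%E.

Definition aug_fun g := augf (size g) g.

Let phi0 : phi != 0.
Proof. by rewrite -size_poly_gt0 (ltn_trans _ phi_size). Qed.

Lemma size_divp_lt g : g != 0 -> (size (g %/ phi)%R < size g)%N.
Proof.
move=> g0; rewrite size_divp //; have := size_poly_gt0 g; rewrite g0.
by move: phi_size; set x := size phi; set y := size g; lia.
Qed.

Lemma augf0 n : augf n 0 = +oo%E.
Proof. by elim: n => //= n IH; rewrite div0p IH psv0 minxx. Qed.

Lemma augf_stable n n' g : (size g <= n)%N -> (size g <= n')%N ->
  augf n g = augf n' g.
Proof.
elim: n n' g => [|n IH] n' g.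
  by rewrite leqn0 size_poly_eq0 => /eqP ->; rewrite !augf0.
have [-> _ _|g0] := eqVneq g 0; first by rewrite !augf0.
case: n' => [|n'] sn sn'; first by move: sn'; rewrite leqn0 size_poly_eq0 (negPf g0).
by rewrite /= (IH n') // -ltnS; apply: leq_trans (size_divp_lt g0) _.
Qed.

Lemma aug0 : aug_fun 0 = +oo%E.
Proof. exact: augf0. Qed.

Lemma augE g : aug_fun g = Order.min (minf g) (aug_fun (g %/ phi) + c%:E)%E.
Proof.
have [->|g0] := eqVneq g 0; first by rewrite div0p aug0 psv0 minxx.
rewrite /aug_fun; have := size_poly_gt0 g; rewrite g0.
case def_n: (size g) => [//|n] _ /=; rewrite (augf_stable (n' := n)) //.
by rewrite -ltnS -def_n size_divp_lt.
Qed.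

Lemma aug_exp q a : (size a < size phi)%N ->
  aug_fun (q * phi + a) = Order.min (minf a) (aug_fun q + c%:E)%E.
Proof.
move=> sa; rewrite augE minf_mod modp_addl_mul_small //.
by rewrite divp_addl_mul_small.
Qed.

Lemma aug_small a : (size a < size phi)%N -> aug_fun a = minf a.
Proof.
move=> sa; rewrite -[a in LHS]add0r -[0](mul0r phi) aug_exp // aug0.
by rewrite minEle leey.
Qed.

Lemma aug_le g : (aug_fun g <= minf g)%E.
Proof. by rewrite augE ge_min lexx. Qed.

Lemma aug_mulphi q : aug_fun (q * phi) = (aug_fun q + c%:E)%E.
Proof.
rewrite -[_ * phi]addr0 aug_exp ?size_poly0 ?(ltn_trans _ phi_size) //.
by rewrite psv0 minEle leye_eq; case: eqP => // ->.
Qed.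

Lemma aug_ind (P : {poly K} -> Prop) :
  P 0 -> (forall g, P (g %/ phi) -> P g) -> forall g, P g.
Proof.
move=> P0 PS g; have [n] := ubnP (size g); elim: n g => // n IH g sg.
have [->//|g0] := eqVneq g 0.
by apply: PS; apply: IH; rewrite -ltnS; apply: leq_trans sg; rewrite ltnS size_divp_lt.
Qed.

Lemma aug_fin g : g != 0 -> aug_fun g \is a fin_num.
Proof.
elim/aug_ind: g => [|g IH g0]; first by rewrite eqxx.
rewrite augE minf_mod.
have [q0|q0] := eqVneq (g %/ phi) 0.
  rewrite q0 aug0 minEle leey.
  have := minf_fin (a := g %% phi); apply; last by rewrite ltn_modpN0.
  by apply: contra_neq g0 => r0; rewrite (divp_eq g phi) q0 r0 mul0r addr0.
have := IH q0; case: (aug_fun _) => //= r _.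
have [->|r0] := eqVneq (g %% phi) 0; first by rewrite psv0 minEle /=.
have := minf_fin r0 (ltn_modpN0 g phi0); case: (minf _) => // s _.
by rewrite -EFinD -EFin_min.
Qed.

Lemma augNy g : aug_fun g != -oo%E.
Proof.
have [->|/aug_fin/fin_numP[]//] := eqVneq g 0.
by rewrite aug0.
Qed.

Lemma augD g h : (Order.min (aug_fun g) (aug_fun h) <= aug_fun (g + h)%R)%E.
Proof.
elim/aug_ind: g h => [|g IH] h.
  by rewrite add0r ge_min lexx orbT.
rewrite (augE (g + h)) divpD le_min; apply/andP; split.
  by apply: le_trans (psvD _ _ _); rewrite le_min !ge_min !aug_le orbT.
apply: le_trans (leeD2r _ (IH _)).
rewrite [in X in (_ <= X)%E]minEle; case: ifP => _.
  by rewrite (augE g) !ge_min lexx orbT.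
by rewrite (augE h) !ge_min lexx !orbT.
Qed.

Lemma augD_ge x g h : (x <= aug_fun g -> x <= aug_fun h -> x <= aug_fun (g + h)%R)%E.
Proof. by move=> xg xh; apply: le_trans (augD g h); rewrite le_min xg xh. Qed.

(** Two digits are handled by [minf_carry], then a digit times a polynomial, then two polynomials,
    each time by induction on the expansion. *)
Lemma augM_ge g h : (aug_fun g + aug_fun h <= aug_fun (g * h)%R)%E.
Proof.
have low a b : (size a < size phi)%N -> (size b < size phi)%N ->
    (minf a + minf b <= aug_fun (a * b)%R)%E.
  move=> sa sb; rewrite -psvM augE le_min lexx /=.
  rewrite [aug_fun _]aug_small ?minf_carry //.
  rewrite size_divp //; have := size_polyMleq a b.
  move: sa sb phi_size; set x := size phi; set y := size a; set z := size b.
  by set t := size (a * b); lia.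
have mid a h' : (size a < size phi)%N -> (minf a + aug_fun h' <= aug_fun (a * h')%R)%E.
  move=> sa; elim/aug_ind: h' => [|h' IH]; first by rewrite mulr0 aug0 leey.
  rewrite {2}(divp_eq h' phi) mulrDr mulrA.
  apply: augD_ge; last first.
    apply: le_trans (low _ _ sa (ltn_modpN0 h' phi0)); apply: leeD2l.
    by rewrite -minf_mod aug_le.
  rewrite aug_mulphi; apply: le_trans (leeD2r _ IH).
  by rewrite -addeA leeD2l // [X in (X <= _)%E]augE ge_min lexx orbT.
elim/aug_ind: g h => [|g IH] h; first by rewrite mul0r aug0 leey.
rewrite {2}(divp_eq g phi) mulrDl.
apply: augD_ge; last first.
  apply: le_trans (mid _ _ (ltn_modpN0 g phi0)); apply: leeD2r.
  by rewrite -minf_mod aug_le.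
rewrite mulrAC aug_mulphi; apply: le_trans (leeD2r _ (IH _)).
by rewrite addeAC leeD2r // [X in (X <= _)%E]augE ge_min lexx orbT.
Qed.

Lemma aug_mulXn s g : aug_fun (phi ^+ s * g) = (aug_fun g + (s%:R * c)%:E)%E.
Proof.
elim: s => [|s IH]; first by rewrite mul1r mul0r adde0.
rewrite exprSr mulrAC aug_mulphi IH -addeA -EFinD.
by rewrite -natr1 mulrDl mul1r.
Qed.

(* Up to terms of larger value, g is phi ^+ s times a polynomial whose value  *)
(* is attained by its constant coefficient.                                   *)
Lemma aug_leading g : g != 0 -> exists s g0 g1,
  [/\ g = phi ^+ s * g0 + g1, (aug_fun g < aug_fun g1)%E, aug_fun g0 = minf g0
    & aug_fun g = (aug_fun g0 + (s%:R * c)%:E)%E].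
Proof.
elim/aug_ind: g => [|g IH g0]; first by rewrite eqxx.
have [ltg|] := ltP (aug_fun g) (minf g); last first.
  move=> le_g; exists 0%N, g, 0.
  rewrite expr0 mul1r addr0 aug0 mul0r adde0 ltey; split=> //.
    by have /fin_numP[] := aug_fin g0.
  by apply/eqP; rewrite eq_le aug_le.
have Eg : aug_fun g = (aug_fun (g %/ phi) + c%:E)%E.
  by move: ltg; rewrite {1 2}augE minEle; case: ifP; rewrite ?ltxx.
have q0 : g %/ phi != 0.
  by apply/eqP => q0; move: ltg; rewrite Eg q0 aug0 /= ltNge leey.
have [s [h0 [h1 [Eq lt1 E0 Es]]]] := IH q0.
exists s.+1, h0, (h1 * phi + g %% phi); split=> //.
- rewrite [LHS](divp_eq g phi) {1}Eq mulrDl addrA; congr (_ + _ + _).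
  by rewrite exprSr -!mulrA [h0 * _]mulrC.
- rewrite aug_exp ?ltn_modpN0 // lt_min -minf_mod ltg Eg /=.
  by rewrite lteD2rE.
- by rewrite Eg Es -addeA -EFinD -natr1 mulrDl mul1r.
Qed.

(** For the reverse inequality only the leading parts of [aug_leading] matter: their product has
    value at most that given by minf of its cofactor, and minf is multiplicative. *)
Lemma augM g h : aug_fun (g * h) = (aug_fun g + aug_fun h)%E.
Proof.
have [->|g0] := eqVneq g 0; first by rewrite mul0r aug0 addye ?augNy.
have [->|h0] := eqVneq h 0; first by rewrite mulr0 aug0 addey ?augNy.
apply/eqP; rewrite eq_le augM_ge andbT.
have [s [a0 [a1 [Eg lt_g Ea Es]]]] := aug_leading g0.
have [t [b0 [b1 [Eh lt_h Eb Et]]]] := aug_leading h0.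
have Egh : g * h = phi ^+ (s + t) * (a0 * b0) + (a1 * h + phi ^+ s * a0 * b1).
  by rewrite {1}Eg mulrDl {1}Eh exprD; ring.
have gf := aug_fin g0; have hf := aug_fin h0.
have lt1 : (aug_fun g + aug_fun h < aug_fun (a1 * h)%R)%E.
  by apply: lt_le_trans (augM_ge _ _); rewrite lteD2rE.
have lt2 : (aug_fun g + aug_fun h < aug_fun (phi ^+ s * a0 * b1)%R)%E.
  by apply: lt_le_trans (augM_ge _ _); rewrite aug_mulXn -Es lteD2lE.
rewrite leNgt; apply/negP => lt_gh.
have augN x : aug_fun (- x) = aug_fun x.
  elim/aug_ind: x => [|x IH]; first by rewrite oppr0.
  by rewrite augE divpN IH psvN -augE.
have : (aug_fun g + aug_fun h < aug_fun (phi ^+ (s + t) * (a0 * b0))%R)%E.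
  have -> : phi ^+ (s + t) * (a0 * b0) = g * h + - (a1 * h + phi ^+ s * a0 * b1).
    by rewrite Egh addrK.
  apply: lt_le_trans (augD _ _); rewrite lt_min lt_gh /= augN.
  by apply: lt_le_trans (augD _ _); rewrite lt_min lt1 lt2.
apply/negP; rewrite -leNgt aug_mulXn Es Et addeACA -EFinD natrD mulrDl leeD2r //.
by rewrite Ea Eb -psvM aug_le.
Qed.

Lemma aug1 : aug_fun 1 = 0%E.
Proof. by rewrite aug_small ?psv1 // size_poly1. Qed.

Definition augval : pseudoval K := Pseudoval aug0 aug1 augM augD augNy.

Lemma augval_fin : psv_finite augval.
Proof. exact: aug_fin. Qed.

Lemma augval_small a : (size a < size phi)%N -> augval a = minf a.
Proof. exact: aug_small. Qed.

Lemma augval_exp q a : (size a < size phi)%N ->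
  augval (q * phi + a) = Order.min (minf a) (augval q + c%:E)%E.
Proof. exact: aug_exp. Qed.

Lemma augval_sum (n : nat) (a : nat -> {poly K}) :
  (forall s, (size (a s) < size phi)%N) ->
  augval (\sum_(s < n) a s * phi ^+ s)%R =
  \big[Order.min/+oo%E]_(s < n) (minf (a s) + (s%:R * c)%:E)%E.
Proof.
elim: n a => [|n IH] a sa; first by rewrite !big_ord0 psv0.
rewrite big_ord_recl /= mulr1.
under eq_bigr => i _ do rewrite /bump leq0n add1n exprSr mulrA.
rewrite -mulr_suml addrC aug_exp // [aug_fun _](IH (fun s => a s.+1)) //.
rewrite big_ord_recl /= mul0r adde0; congr Order.min.
elim/big_ind2: _ => // [x1 y1 x2 y2 <- <-|i _].
  rewrite !minEle; case: (leP y1 y2) => h; first by rewrite leeD2r.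
  by rewrite leNgt lteD2rE // h.
by rewrite -addeA -EFinD /bump leq0n add1n -natr1 mulrDl mul1r.
Qed.

End Augmentation.
Arguments augval : simpl never.

(** * Valuations on the field of fractions *)

Section FractionValuation.
Variable K : fieldType.
Local Notation "x %:F" := (@FracField.tofrac {poly K} x).
Implicit Types (f g : {fraction {poly K}}).

Lemma fraction_reprE f : f = (\n_(repr f))%:F / (\d_(repr f))%:F.
Proof.
set r := repr f; have d0 : \d_r != 0 := denom_ratioP r.
apply: (mulIf (x := (\d_r)%:F)); rewrite ?tofrac_eq0 // divfK ?tofrac_eq0 //.
rewrite -[f in LHS]reprK -/r; unlock FracField.tofrac.
rewrite -[LHS]FracField.pi_mul; apply/eqmodP.
rewrite /= FracField.equivfE /FracField.mulf !numden_Ratio ?oner_eq0 ?mulf_neq0 ?oner_eq0 //.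
by rewrite !mulr1 mulrC.
Qed.

Lemma fraction_ind (P : {fraction {poly K}} -> Prop) :
  (forall a b, b != 0 -> P (a%:F / b%:F)) -> forall f, P f.
Proof. by move=> Pab f; rewrite (fraction_reprE f); apply: Pab; exact: denom_ratioP. Qed.

Variables (m : pseudoval K) (mf : psv_finite m).

Definition fracval_fun f := (m \n_(repr f) - m \d_(repr f))%E.

(** Cross-multiplication shows that the fraction picked by [repr] is immaterial. *)
Lemma fracval_div a b : b != 0 -> fracval_fun (a%:F / b%:F) = (m a - m b)%E.
Proof.
move=> b0; rewrite /fracval_fun; set f := _ / _; set n := \n_ _; set d := \d_ _.
have d0 : d != 0 := denom_ratioP _.
have : m (a * d) = m (n * b).
  congr (m _); apply/eqP; rewrite -tofrac_eq !tofracM -eqr_div ?tofrac_eq0 //.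
  by rewrite -/f {1}(fraction_reprE f).
rewrite !psvM; have := mf b0; have := mf d0; move: (psvNy m a) (psvNy m n).
move: (m a) (m b) (m n) (m d); case=> [?||]; case=> [?||]; case=> [?||]; case=> [?||] //=.
rewrite -!EFinD => _ _ _ _ [h]; congr EFin; lra.
Qed.

Lemma fracval_tofrac a : fracval_fun a%:F = m a.
Proof.
by rewrite -[a%:F]divr1 -tofrac1 fracval_div ?oner_eq0 // psv1 sube0.
Qed.

Lemma fracval_subproof0 : fracval_fun 0 = +oo%E.
Proof. by rewrite -tofrac0 fracval_tofrac psv0. Qed.

Lemma fracval_subproof_fin f : f != 0 -> fracval_fun f \is a fin_num.
Proof.
elim/fraction_ind: f => a b b0 f0; rewrite fracval_div //.
have a0 : a != 0 by apply: contra_neq f0 => ->; rewrite tofrac0 mul0r.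
by rewrite fin_numB mf // mf.
Qed.

Lemma fracval_subproofM f g : fracval_fun (f * g) = (fracval_fun f + fracval_fun g)%E.
Proof.
elim/fraction_ind: f => a b b0; elim/fraction_ind: g => c d d0.
rewrite mulf_div -!tofracM !fracval_div ?mulf_neq0 // !psvM.
move: (psvNy m a) (psvNy m c) (mf b0) (mf d0).
move: (m a) (m b) (m c) (m d); case=> [?||]; case=> [?||]; case=> [?||]; case=> [?||] //=.
by move=> _ _ _ _; congr EFin; lra.
Qed.

Lemma fracval_subproofD f g :
  (Order.min (fracval_fun f) (fracval_fun g) <= fracval_fun (f + g)%R)%E.
Proof.
elim/fraction_ind: f => a b b0; elim/fraction_ind: g => c d d0.
rewrite addf_div ?tofrac_eq0 // -!tofracM -tofracD !fracval_div ?mulf_neq0 // ?psvM.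
have cancel (x y z : \bar rat) : x != -oo%E -> y \is a fin_num -> z \is a fin_num ->
    (x - y = (x + z) - (y + z))%E.
  case: x => [x||] //; case: y => [y||] //; case: z => [z||] // _ _ _.
  by congr EFin; lra.
have := psvD m (a * d) (c * b); rewrite !psvM !ge_min => /orP[] h; apply/orP; [left|right].
  by rewrite (cancel _ _ (m d)) ?psvNy ?mf // leeD2r.
by rewrite (cancel _ _ (m b)) ?psvNy ?mf // [(m d + m b)%E]addeC leeD2r.
Qed.

Definition fracval : valuation {fraction {poly K}} :=
  Valuation fracval_subproof0 fracval_subproof_fin fracval_subproofM fracval_subproofD.

Lemma pval_fracval a : pval fracval a = m a.
Proof. exact: fracval_tofrac. Qed.

End FractionValuation.

Section PolynomialValuation.
Variables (K : fieldType) (mu : valuation {fraction {poly K}}).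

Lemma pval_subproof0 : pval mu (0 : {poly K}) = +oo%E.
Proof. by rewrite tofrac0 Defs.val0. Qed.

Lemma pval_subproof1 : pval mu (1 : {poly K}) = 0%E.
Proof. by rewrite tofrac1 Defs.val1. Qed.

Lemma pval_subproofM (a b : {poly K}) : pval mu (a * b) = (pval mu a + pval mu b)%E.
Proof. by rewrite tofracM Defs.valM. Qed.

Lemma pval_subproofD (a b : {poly K}) :
  (Order.min (pval mu a) (pval mu b) <= pval mu (a + b)%R)%E.
Proof. by rewrite tofracD Defs.valD. Qed.

Lemma pval_subproof_fin (a : {poly K}) : a != 0 -> pval mu a \is a fin_num.
Proof. by move=> a0; apply: val_fin; rewrite tofrac_eq0. Qed.

Lemma pval_subproofNy (a : {poly K}) : pval mu a != -oo%E.
Proof.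
have [->|/pval_subproof_fin/fin_numP[]//] := eqVneq a 0.
by rewrite pval_subproof0.
Qed.

Definition polval : pseudoval K := Pseudoval pval_subproof0 pval_subproof1
  pval_subproofM pval_subproofD pval_subproofNy.

Lemma polvalE a : polval a = pval mu a. Proof. by []. Qed.

Lemma polval_fin : psv_finite polval.
Proof. exact: pval_subproof_fin. Qed.

Lemma val_div (a b : {poly K}) : b != 0 ->
  mu (FracField.tofrac a / FracField.tofrac b) = (polval a - polval b)%E.
Proof.
move=> b0; rewrite Defs.valM polvalE; congr (_ + _)%E.
have fb : FracField.tofrac b != 0 by rewrite tofrac_eq0.
have := Defs.valM mu (FracField.tofrac b) (FracField.tofrac b)^-1.
rewrite divff // Defs.val1 polvalE.
move: (val_fin mu fb) (val_fin mu (invr_neq0 fb)).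
case: (mu _) => // r; case: (mu _) => // s _ _ [h].
by rewrite -EFinN; congr EFin; lra.
Qed.

End PolynomialValuation.
Arguments polval : simpl never.

Lemma valuation_eq (L : fieldType) (v1 v2 : valuation L) :
  (forall a, v1 a = v2 a) -> v1 = v2.
Proof.
case: v1 => f1 a1 b1 c1 d1; case: v2 => f2 a2 b2 c2 d2 /= /funext e.
by case: f2 / e a2 b2 c2 d2 => *; congr Valuation; exact: Prop_irrelevance.
Qed.

Lemma polval_inj (K : fieldType) (mu mu' : valuation {fraction {poly K}}) :
  (forall g, polval mu g = polval mu' g) -> mu = mu'.
Proof.
move=> e; apply: valuation_eq => f; elim/fraction_ind: f => a b b0.
by rewrite !val_div // !e.
Qed.

(* A polynomial of least degree on which mu < m is a key polynomial for mu,   *)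
(* because phi divides g in Gr(mu) exactly when mu g < m g.                   *)
Section MinimalWitness.
Variables (K : fieldType) (mu m : pseudoval K) (phi : {poly K}).
Hypothesis mu_fin : psv_finite mu.
Hypothesis mu_le : forall g, (mu g <= m g)%E.
Hypothesis mu_small : forall g : {poly K}, (size g < size phi)%N -> m g = mu g.
Hypotheses (phi_monic : phi \is monic) (phi_size : (1 < size phi)%N).
Hypothesis mu_phi : (mu phi < m phi)%E.

Lemma mulphi_lt q : q != 0 -> (mu (phi * q)%R < m (phi * q)%R)%E.
Proof.
move=> q0; rewrite !psvM; apply: lt_le_trans (_ : (m phi + mu q <= _)%E); last exact: leeD2l.
by rewrite lteD2rE // mu_fin.
Qed.

Lemma mdiv_lt g : g != 0 -> mdiv mu phi g <-> (mu g < m g)%E.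
Proof.
move=> g0; split=> [[q gq]|lt_g].
  have e := psv_sub_eq gq.
  have q0 : q != 0 by apply: contraTneq gq => ->; rewrite mulr0 subr0 ltxx.
  rewrite -[g in X in (_ < X)%E](subrK (phi * q)); apply: psvD_gt.
    exact: lt_le_trans gq (mu_le _).
  by rewrite -e; apply: mulphi_lt.
exists (g %/ phi).
have -> : g - phi * (g %/ phi) = g %% phi.
  by rewrite {1}(divp_eq g phi) mulrC addrAC subrr add0r.
have phi0 : phi != 0 by apply: monic_neq0.
rewrite -(mu_small (ltn_modpN0 g phi0)) ltNge; apply/negP => le_a.
have e : g %% phi = g - phi * (g %/ phi).
  by rewrite {2}(divp_eq g phi) mulrC addrAC subrr add0r.
have q0 : g %/ phi != 0.
  apply/eqP => q0; move: le_a; rewrite e q0 mulr0 subr0 leNgt lt_g //.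
(* If the remainder had value at most mu g, both g and [phi * (g %/ phi)] would have m-value above
   it; so would the remainder, where m and mu agree. *)
have le_a' : (mu (g %% phi)%R <= mu g)%E by apply: le_trans (mu_le _) le_a.
have : (mu (g %% phi)%R < m (g %% phi)%R)%E.
  rewrite {2}e; apply: psvB_gt; first exact: le_lt_trans lt_g.
  apply: le_lt_trans (mulphi_lt q0).
  have -> : phi * (g %/ phi) = g - g %% phi by rewrite e subKr.
  by apply: psvB_ge.
by rewrite (mu_small (ltn_modpN0 g phi0)) ltxx.
Qed.

(** Both mu and m are additive and mu <= m, so a strict inequality at [a * b] forces one at a or at
    b. *)
Lemma minimal_witness_key : iskey mu phi.
Proof.
split=> // [a b a0 b0|g g0 sg].
  rewrite (mdiv_lt (mulf_neq0 a0 b0)) (mdiv_lt a0) (mdiv_lt b0) !psvM => lt_ab.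
  have [|le_a] := ltP (mu a) (m a); first by left.
  have [|le_b] := ltP (mu b) (m b); first by right.
  by move: lt_ab; rewrite ltNge leeD.
by rewrite (mdiv_lt g0) mu_small // ltxx.
Qed.

End MinimalWitness.

(** * The graded algebra *)

Section GradedAlgebra.
Variables (K : fieldType) (mu : valuation {fraction {poly K}}).
Local Notation m := (polval mu).
Implicit Types (f h : rees_type mu) (g phi q : {poly K}) (a b c d : rat).

Lemma mcoeff_mulU (R : comNzRingType) (x : R) c (F : ratalg R) a :
  ((<< x *g c >> : ratalg R) * F)@_a = x * F@_(a - c).
Proof.
rewrite [_ * F](ramulUg x c F) raddf_sum /=.
under eq_bigr => b _ do rewrite mcoeffU.
have [aF|aF] := boolP (a - c \in msupp F).
  rewrite (bigD1_seq (a - c) aF (fset_uniq _)) [c + _]addrC subrK eqxx mulr1n big1.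
    by exact: addr0.
  move=> b ba; case: eqP => // e; move: ba.
  by rewrite -e [c + b]addrC addrK eqxx.
have -> : F@_(a - c) = 0 by exact: mcoeff_outdom aF.
rewrite mulr0 big_seq big1 // => b bF.
by case: eqP => // e; move: aF; rewrite -e [c + b]addrC addrK bF.
Qed.

Lemma rees_coef f a : (a%:E <= m (val f)@_a)%E.
Proof. by have /reesP := valP f; apply. Qed.

Lemma gr_eqP f h : \pi_(gr mu) f = \pi_(gr mu) h <->
  forall a, (a%:E < m ((val f)@_a - (val h)@_a)%R)%E.
Proof.
have e : (f - h \in @rees_plus K mu) = (f == h %[mod gr mu]).
  exact: (Quotient.idealrBE (@rees_plus K mu)).
split=> [/eqP|H]; last apply/eqP; rewrite -e.
  by move/rees_plusP => H a; have := H a; rewrite rmorphB mcoeffB.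
by apply/rees_plusP => a; have := H a; rewrite rmorphB mcoeffB.
Qed.

Lemma gr_surj (x : gr mu) : exists f, x = \pi_(gr mu) f.
Proof. by exists (repr x); rewrite reprK. Qed.

Lemma pi_grM f h : \pi_(gr mu) (f * h) = \pi_(gr mu) f * \pi_(gr mu) h.
Proof. exact: rmorphM. Qed.

Definition monomial a g (ag : (a%:E <= pval mu g)%E) : rees_type mu :=
  Rees (rees_monomial ag).

Lemma gr_class_monomial a g (ag : (a%:E <= pval mu g)%E) :
  gr_class mu a g = \pi_(gr mu) (monomial ag).
Proof.
rewrite /gr_class; congr (\pi_(gr mu) _); apply: val_inj.
by rewrite insubdK //=; exact: rees_monomial.
Qed.

Lemma mcoeff_monomial a g (ag : (a%:E <= pval mu g)%E) b :
  (val (monomial ag))@_b = if b == a then g else 0.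
Proof. by rewrite /= mcoeffU eq_sym; case: eqP. Qed.

(** Divisibility is tested degree by degree: a quotient is assembled from witnesses in each degree,
    shifted by the value c of phi. *)
Lemma principalP phi f : phi != 0 -> principal mu phi (\pi_(gr mu) f) <->
  forall a, exists q, (a%:E < m ((val f)@_a - phi * q)%R)%E.
Proof.
move=> phi0; have := polval_fin mu phi0; rewrite polvalE.
case def_c : (pval mu phi) => [c||] // _.
have phi_c : (c%:E <= pval mu phi)%E by rewrite def_c.
have initE : initial_form mu phi = \pi_(gr mu) (monomial phi_c).
  by rewrite /initial_form def_c /= gr_class_monomial.
have mulE h a : (val (monomial phi_c * h))@_a = phi * (val h)@_(a - c).
  by rewrite -mcoeff_mulU.
split=> [[x]|H].
  rewrite initE; have [h ->] := gr_surj x; rewrite -pi_grM => /gr_eqP H a.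
  by exists (val h)@_(a - c); rewrite -mulE.
have /choice[q qP] := H.
pose F : ratalg {poly K} := \sum_(a <- msupp (val f)) << q a *g a - c >>.
have coefF a : F@_(a - c) = if a \in msupp (val f) then q a else 0.
  rewrite /F raddf_sum /=.
  under eq_bigr => b _ do rewrite mcoeffU (inj_eq (addIr _)).
  have [aF|aF] := boolP (a \in msupp (val f)).
    by rewrite (bigD1_seq a aF (fset_uniq _)) /= eqxx mulr1n big1 ?addr0 // => b /negPf ->.
  by rewrite big_seq big1 // => b bF; case: eqP => // e; move: aF; rewrite -e bF.
have F_rees : F \in rees mu.
  apply/reesP => b; rewrite -[b](addrK c) coefF; case: ifP => _; last first.
    by rewrite -polvalE psv0 leey.
  have : ((b + c)%R%:E <= m (phi * q (b + c))%R)%E.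
    have -> : phi * q (b + c) = (val f)@_(b + c) - ((val f)@_(b + c) - phi * q (b + c)).
      by rewrite subKr.
    by apply: psvB_ge (rees_coef _ _) (ltW (qP _)).
  rewrite psvM polvalE def_c -polvalE addrK addeC EFinD leeD2rE //.
exists (\pi_(gr mu) (Rees F_rees)); rewrite initE -pi_grM; apply/gr_eqP => a.
rewrite mulE (coefF a : (val (Rees F_rees))@_(a - c) = _); case: ifPn => aF; first exact: qP.
by rewrite (mcoeff_outdom aF) mulr0 subr0 psv0 ltry.
Qed.

Lemma gr_class_pi c g : (c%:E <= m g)%E -> exists f,
  gr_class mu c g = \pi_(gr mu) f /\
  forall b, (val f)@_b = if b == c then g else 0.
Proof.
move=> cg; exists (monomial (cg : (c%:E <= pval mu g)%E)).
by rewrite gr_class_monomial; split=> // b; exact: mcoeff_monomial.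
Qed.

Lemma initial_form_pi g : exists f, initial_form mu g = \pi_(gr mu) f /\
  forall b, (val f)@_b = if b%:E == m g then g else 0.
Proof.
have [->|g0] := eqVneq g 0.
  have [|f [ef cf]] := @gr_class_pi (fine (m 0)) 0; first by rewrite psv0 leey.
  by exists f; split=> // b; rewrite cf !if_same.
have [|f [ef cf]] := @gr_class_pi (fine (m g)) g.
  by rewrite fineK // polval_fin.
exists f; split=> // b; rewrite cf -(fineK (polval_fin mu g0)).
by rewrite /= eqe.
Qed.

Lemma principal_class phi c g : phi != 0 -> (c%:E <= m g)%E ->
  principal mu phi (gr_class mu c g) <-> exists q, (c%:E < m (g - phi * q)%R)%E.
Proof.
move=> phi0 cg; have [f [-> cf]] := gr_class_pi cg; rewrite principalP //.
split=> [/(_ c)|H a]; rewrite cf; first by rewrite eqxx.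
by case: eqP => [->//|_]; exists 0; rewrite mulr0 subr0 psv0 ltry.
Qed.

Lemma principal_initial phi g : phi != 0 -> g != 0 ->
  principal mu phi (initial_form mu g) <-> mdiv m phi g.
Proof.
move=> phi0 g0; have fg := fineK (polval_fin mu g0).
by rewrite principal_class //= -?polvalE fg.
Qed.

Lemma gr_classM c d g (h : {poly K}) : (c%:E <= m g)%E -> (d%:E <= m h)%E ->
  gr_class mu c g * gr_class mu d h = gr_class mu (c + d) (g * h).
Proof.
move=> cg dh; have cdgh : ((c + d)%:E <= m (g * h)%R)%E.
  by rewrite psvM EFinD leeD.
rewrite !gr_class_monomial -pi_grM; congr (\pi_(gr mu) _); apply: val_inj.
by rewrite rmorphM /=; exact: ramulUU.
Qed.

Lemma gr_classD c g (h : {poly K}) : (c%:E <= m g)%E -> (c%:E <= m h)%E ->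
  gr_class mu c g + gr_class mu c h = gr_class mu c (g + h).
Proof.
move=> cg ch; have cgh : (c%:E <= m (g + h)%R)%E by exact: psvD_ge.
rewrite !gr_class_monomial; rewrite -[LHS]rmorphD.
congr (\pi_(gr mu) _); apply: val_inj.
by rewrite rmorphD /= monalgUD.
Qed.

Lemma gr_class0 c : gr_class mu c 0 = 0.
Proof.
have [|f [-> cf]] := @gr_class_pi c 0; first by rewrite psv0 leey.
rewrite -[RHS](rmorph0 (\pi_(gr mu))); apply/gr_eqP => a.
by rewrite cf if_same rmorph0 mcoeff0 subr0 psv0 ltry.
Qed.

Lemma gr_class1 : gr_class mu 0 1 = 1.
Proof.
have H : (0%:E <= m 1%R)%E by rewrite psv1.
by rewrite gr_class_monomial -[RHS](rmorph1 (\pi_(gr mu))); congr (\pi_(gr mu) _); apply: val_inj.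
Qed.

Lemma gr_class_eq c g (h : {poly K}) : (c%:E <= m g)%E -> (c%:E <= m h)%E ->
  gr_class mu c g = gr_class mu c h <-> (c%:E < m (g - h)%R)%E.
Proof.
move=> /gr_class_pi[f [-> cf]] /gr_class_pi[f' [-> cf']].
rewrite gr_eqP; split=> [/(_ c)|H b]; rewrite cf cf'; first by rewrite eqxx.
by case: eqP => [->//|_]; rewrite subr0 psv0 ltry.
Qed.

Lemma initial_formM g (h : {poly K}) : g != 0 -> h != 0 ->
  initial_form mu (g * h) = initial_form mu g * initial_form mu h.
Proof.
move=> g0 h0; rewrite /initial_form -!polvalE gr_classM ?fineK ?polval_fin //.
by rewrite psvM fineD ?polval_fin.
Qed.

Lemma key_polynomial_iskey phi : key_polynomial mu phi -> iskey m phi.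
Proof.
case=> [[phiM phi_size] _ _ phi_prime phi_min].
have phi0 : phi != 0 by exact: monic_neq0.
split=> // [a b a0 b0|g g0 sg].
  rewrite -!principal_initial ?mulf_neq0 // initial_formM // => H.
  have := phi_prime (initial_form mu a) (initial_form mu b).
  by move=> /(_ (mem_set H))/orP[] /set_mem; [left|right].
by rewrite -principal_initial //; exact: phi_min.
Qed.

Lemma seq_min (s : seq rat) (P : rat -> Prop) : (exists2 a, a \in s & P a) ->
  exists a, [/\ a \in s, P a & forall b, b \in s -> P b -> a <= b].
Proof.
elim: s => [[]//|x s IH [a]]; rewrite inE => as_ Pa.
have [[b bs Pb]|noP] := pselect (exists2 b, b \in s & P b); last first.
  have ax : a = x by case/orP: as_ => [/eqP//|as_]; case: noP; exists a.
  exists a; rewrite ax inE eqxx; split=> // [|b]; first by rewrite -ax.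
  by rewrite inE => /orP[/eqP->//|bs Pb]; case: noP; exists b.
have [c [cs Pc cmin]] := IH (ex_intro2 _ _ b bs Pb).
have [[Px xc]|nx] := pselect (P x /\ x <= c).
  exists x; rewrite inE eqxx; split=> // d; rewrite inE => /orP[/eqP->//|ds] Pd.
  exact: le_trans xc (cmin _ ds Pd).
exists c; rewrite inE cs orbT; split=> // d; rewrite inE => /orP[/eqP-> Px|]; last exact: cmin.
by rewrite leNgt; apply/negP => /ltW xc; apply: nx.
Qed.

(** A homogeneous ideal is prime once it is so on homogeneous elements: if f and h have components
    not divisible by phi, take those of lowest degree; modulo phi, the component of [f * h] in the
    sum of these degrees is their product. *)
Lemma iskey_key_polynomial phi : iskey m phi -> key_polynomial mu phi.
Proof.
move=> kphi; have phiM := key_monic kphi; have phi_size := key_size kphi.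
have phi0 : phi != 0 by exact: monic_neq0.
(* [D c p]: phi divides the component of degree c represented by p. *)
pose D c p := exists q, (c%:E < m (p - phi * q)%R)%E.
have D0 c : D c 0 by exists 0; rewrite mulr0 subr0 psv0 ltry.
have DD c p p' : D c p -> D c p' -> D c (p + p').
  move=> [q hq] [q' hq']; exists (q + q').
  have -> : p + p' - phi * (q + q') = (p - phi * q) + (p' - phi * q') by ring.
  exact: psvD_gt.
have DN c p : D c p -> D c (- p).
  by move=> [q hq]; exists (- q); rewrite mulrN -opprD psvN.
have DM c d p p' : D c p -> (d%:E <= m p')%E -> D (c + d) (p * p').
  move=> [q hq] dp'; exists (q * p'); rewrite mulrA -mulrBl psvM EFinD.
  exact: lte_leD.
split.
- by [].
- move=> H; have : principal mu phi (initial_form mu phi).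
    by exists 1; rewrite mulr1.
  rewrite H /= => /eqP; have [f [-> cf]] := initial_form_pi phi.
  rewrite -(rmorph0 (\pi_(gr mu))) => /eqP/gr_eqP/(_ (fine (m phi))).
  by rewrite cf rmorph0 mcoeff0 subr0 fineK ?polval_fin // eqxx ltxx.
- split.
  + by apply/mem_set; exists 0; rewrite mulr0.
  + apply/negP => /set_mem; rewrite -gr_class1.
    have H1 : (0%:E <= m 1%R)%E by rewrite psv1.
    rewrite principal_class // => -[q hq].
    apply: (key_min kphi (oner_neq0 _)); first by rewrite size_poly1.
    by exists q; rewrite psv1.
  + move=> x u v /set_mem[q ->] /set_mem[q' ->]; apply/mem_set.
    by exists (x * q + q'); rewrite mulrDr mulrCA.
- move=> u v /set_mem; have [f ->] := gr_surj u; have [h ->] := gr_surj v.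
  rewrite -pi_grM principalP // => Dfh; rewrite -[_ || _]negbK negb_or.
  apply/negP => /andP[].
  have bad (F : rees_type mu) : \pi_(gr mu) F \notin principal mu phi ->
      exists a, [/\ a \in msupp (val F), ~ D a (val F)@_a &
        forall b, b < a -> D b (val F)@_b].
    move=> /negP; rewrite in_setE principalP // -existsNE => -[a0 na0].
    have suppP a : ~ D a (val F)@_a -> a \in msupp (val F).
      by apply: contra_notT => /mcoeff_outdom ->.
    have [a [aF na amin]] := @seq_min (msupp (val F)) (fun a => ~ D a (val F)@_a)
      (ex_intro2 _ _ a0 (suppP _ na0) na0).
    exists a; split=> // b ba; apply: contrapT => nb.
    by have := amin b (suppP _ nb) nb; rewrite leNgt ba.
  move=> /bad[a0 [a0f na0 fgood]] /bad[b0 [b0h nb0 hgood]].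
  (* A component whose value exceeds its degree is zero in the graded algebra, hence divisible; the
     chosen ones are therefore true initial forms. *)
  have bad_val (F : rees_type mu) a : ~ D a (val F)@_a -> m (val F)@_a = a%:E.
    move=> na; apply/eqP; rewrite eq_le rees_coef andbT leNgt; apply/negP => lt_a.
    by apply: na; exists 0; rewrite mulr0 subr0.
  have bad_neq0 (F : rees_type mu) a : ~ D a (val F)@_a -> (val F)@_a != 0.
    by apply: contra_notN => /eqP ->.
  have : D (a0 + b0) ((val f)@_a0 * (val h)@_b0).
    pose T a b := ((val f)@_a * (val h)@_b) *+ (a + b == a0 + b0).
    (* Apart from (a0, b0), the equation a + b = a0 + b0 forces a < a0 or b < b0, and that factor is
       divisible by minimality. *)
    have good a b : (a != a0) || (b != b0) -> D (a0 + b0) (T a b).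
      rewrite /T; case: (a + b =P a0 + b0) => [ab|_ _]; last by rewrite mulr0n.
      rewrite mulr1n -ab => ne.
      have [/fgood aa0|a0a] := ltP a a0; first exact: DM aa0 (rees_coef _ _).
      rewrite addrC mulrC; apply: DM (rees_coef _ _); apply: hgood.
      rewrite ltNge; apply/negP => b0b; move: ne.
      have [-> ->] : a = a0 /\ b = b0 by split; lra.
      by rewrite !eqxx.
    have Dsum (I : eqType) (s : seq I) (P : pred I) (G : I -> {poly K}) :
        (forall i, P i -> D (a0 + b0) (G i)) ->
        D (a0 + b0) (\sum_(i <- s | P i) G i).
      by move=> DG; elim/big_ind: _ => //; exact: DD.
    have {Dfh} := Dfh (a0 + b0).
    have -> : (val (f * h))@_(a0 + b0) =
        \sum_(a <- msupp (val f)) \sum_(b <- msupp (val h)) T a b.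
      by rewrite rmorphM; exact: mcoeff_ramul.
    rewrite (bigD1_seq a0 a0f (fset_uniq _)) /= (bigD1_seq b0 b0h (fset_uniq _)) /= -addrA.
    set rest := (X in T a0 b0 + X) => Dfh.
    have Drest : D (a0 + b0) rest.
      apply: (DD); first by apply: Dsum => b bb0; apply: good; rewrite bb0 orbT.
      by apply: (Dsum) => a aa0; apply: Dsum => b _; apply: good; rewrite aa0.
    have := DD _ _ _ Dfh (DN _ _ Drest); rewrite addrK /T eqxx mulr1n.
    exact.
  move=> [q hq].
  have [|da|db] := key_prime kphi (bad_neq0 _ _ na0) (bad_neq0 _ _ nb0).
  + by exists q; rewrite psvM !bad_val.
  + by case: da => r hr; apply: (na0); exists r; rewrite -(bad_val _ _ na0).
  + by case: db => r hr; apply: (nb0); exists r; rewrite -(bad_val _ _ nb0).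
- move=> g g0 sg /(principal_initial phi0 g0); exact: (key_min kphi).
Qed.

Lemma residual_idealP g x : g != 0 -> residual_ideal mu g x <->
  exists h : {poly K}, [/\ (0%:E <= m h)%E, x = gr_class mu 0 h &
    exists q, (0%:E < m (h - g * q)%R)%E].
Proof.
move=> g0; split=> [[[h /= h0 <-]]|[h [h0 -> hq]]].
  by rewrite principal_class // => hq; exists h.
by split; [exists h | rewrite principal_class].
Qed.

(** A class of Delta outside the ideal comes from some g whose remainder modulo phi has value 0. The
    inverse of that remainder modulo phi also has value 0, so the class is invertible modulo the
    ideal. *)
Lemma residual_ideal_maximal phi : iskey m phi ->
  maximal_ideal_Delta mu (residual_ideal mu phi).
Proof.
move=> kphi; have phi0 : phi != 0 by exact: monic_neq0 (key_monic kphi).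
have mf := polval_fin mu.
have H1 : (0%:E <= m 1%R)%E by rewrite psv1.
have not1 : ~ residual_ideal mu phi 1.
  rewrite -gr_class1 => -[_]; rewrite principal_class // => -[q hq].
  apply: (key_min kphi (oner_neq0 _)); first by rewrite size_poly1 (key_size kphi).
  by exists q; rewrite psv1.
have Delta1 : Delta mu 1 by exists 1; rewrite ?gr_class1.
split.
- split.
  + by move=> x [].
  + apply/residual_idealP => //; exists 0; rewrite psv0 gr_class0; split=> //.
    by exists 0; rewrite mulr0 subr0 psv0.
  + move=> a x y [ga /= ga0 <-] [[gx /= gx0 <-] [qx ex]] [[gy /= gy0 <-] [qy ey]].
    have gax0 : (0%:E <= m (ga * gx)%R)%E by rewrite psvM adde_ge0.
    split; last by exists (gr_class mu 0 ga * qx + qy); rewrite ex ey mulrDr mulrCA.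
    rewrite gr_classM // addr0 gr_classD //; exists (ga * gx + gy) => //.
    exact: (psvD_ge (m := m) gax0 gy0).
- by move=> e; apply: not1; rewrite e.
- move=> J [JD J0 JI] RJ JnD; apply/seteqP; split=> // x Jx.
  have [g /= g0 gx] := JD _ Jx.
  apply: contrapT => nR; apply: JnD; apply/seteqP; split=> // y Dy.
  suff J1 : J 1 by have := JI y 1 0 Dy J1 J0; rewrite mulr1 addr0.
  have gR : ~ exists q, (0%:E < m (g - phi * q)%R)%E.
    by move=> gq; apply: nR; apply/residual_idealP => //; exists g.
  pose a := g %% phi; have sa : (size a < size phi)%N by exact: ltn_modpN0.
  have ga : g - a = phi * (g %/ phi) by rewrite {1}(divp_eq g phi) addrK mulrC.
  have a0 : m a = 0%:E.
    apply/eqP; rewrite eq_le andbC (le_trans g0 (key_mod_ge kphi _)) leNgt.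
    apply/negP => lt0; apply: gR; exists (g %/ phi).
    by rewrite -ga subKr.
  have an0 : a != 0 by apply: (psv_neq0 (m := m)); rewrite a0.
  have [b [sb ab1]] := key_inverse mf kphi an0 sa; rewrite a0 add0e => b0.
  have H0 : (0%:E <= m b)%E by rewrite b0.
  (* 1 = g b - (g - a) b - (a b - 1), the last two terms being multiples of phi *)
  have gb1 : residual_ideal mu phi (gr_class mu 0 (g * b - 1)).
    apply/residual_idealP => //; exists (g * b - 1); split=> //.
      by apply: psvB_ge; rewrite ?psvM ?adde_ge0.
    exists (g %/ phi * b + (a * b) %/ phi).
    rewrite mulrDr mulrA -ga [phi * (_ %/ _)]mulrC.
    have -> : a * b %/ phi * phi = a * b - 1.
      by rewrite {2}(divp_eq (a * b) phi) ab1 addrK.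
    have -> : g * b - 1 - ((g - a) * b + (a * b - 1)) = 0 by ring.
    by rewrite psv0.
  have -> : 1 = gr_class mu 0 b * x + - gr_class mu 0 (g * b - 1).
    rewrite -gx gr_classM // addr0 [b * g]mulrC.
    have e : gr_class mu 0 (g * b) = gr_class mu 0 (g * b - 1) + gr_class mu 0 1.
      by rewrite gr_classD ?subrK //; apply: psvB_ge; rewrite ?psvM ?adde_ge0.
    by rewrite e gr_class1 addrAC subrr add0r.
  apply: (JI) => //; first by exists b.
  have -> : - gr_class mu 0 (g * b - 1) = gr_class mu 0 (-1) * gr_class mu 0 (g * b - 1) + 0.
    have DN1 : (0%:E <= m (-1)%R)%E by rewrite psvN.
    rewrite addr0; have e : gr_class mu 0 (-1) + 1 = 0.
      by rewrite -gr_class1 gr_classD // addNr gr_class0.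
    by have -> : gr_class mu 0 (-1) = -1 by [apply/eqP; rewrite -subr_eq0 opprK e]; rewrite mulN1r.
  apply: (JI) => //; last exact: RJ.
  by exists (-1) => //=; rewrite -polvalE psvN psv1.
Qed.

End GradedAlgebra.

(** * The Gauss valuation and augmentations *)

Section Gauss.
Variables (K : fieldType) (v : valuation K).
Implicit Types (g : {poly K}).

Definition extends (m : pseudoval K) :=
  (forall c, m c%:P = v c) /\ (0%:E <= m 'X)%E.

(** In other words, m lies above the Gauss valuation. *)
Lemma extends_ge m (x : \bar rat) g : extends m ->
  (forall i, (i < size g)%N -> (x <= v g`_i)%E) -> (x <= m g)%E.
Proof.
move=> [mC mX] xg; rewrite -[g]coefK poly_def; apply: psv_sum_ge => i _.
rewrite -mul_polyC psvM mC -[x]adde0; apply: leeD; first exact: xg.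
elim: (i : nat) => [|n IH]; first by rewrite psv1.
by rewrite exprS psvM adde_ge0.
Qed.

(** The value of g(0). It plays the part of the residue valuation of the polynomial x: the
    construction above, giving x the value 0, yields the Gauss valuation. *)
Definition const_val g := v g`_0.

Lemma const_val0 : const_val 0 = +oo%E.
Proof. by rewrite /const_val coef0 Defs.val0. Qed.

Lemma const_val1 : const_val 1 = 0%E.
Proof. by rewrite /const_val coef1 Defs.val1. Qed.

Lemma const_valM g (h : {poly K}) : const_val (g * h) = (const_val g + const_val h)%E.
Proof. by rewrite /const_val coef0M Defs.valM. Qed.

Lemma const_valD g (h : {poly K}) :
  (Order.min (const_val g) (const_val h) <= const_val (g + h)%R)%E.
Proof. by rewrite /const_val coefD Defs.valD. Qed.

Lemma const_valNy g : const_val g != -oo%E.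
Proof.
rewrite /const_val; have [->|/(val_fin v)/fin_numP[]//] := eqVneq g`_0 0.
by rewrite Defs.val0.
Qed.

Definition const_psv : pseudoval K :=
  Pseudoval const_val0 const_val1 const_valM const_valD const_valNy.

Lemma gauss_exists : exists mu, gauss_valuation v mu.
Proof.
have X2 : (1 < size ('X : {poly K}))%N by rewrite size_polyX.
have modX g : const_psv g = const_psv (g %% 'X).
  rewrite /= /const_val {1}(divp_eq g 'X) coefD coefMX add0r //.
have constE (a : {poly K}) : (size a < size ('X : {poly K}))%N -> a = (a`_0)%:P.
  by rewrite size_polyX ltnS => /size1_polyC.
have finX (a : {poly K}) : a != 0 -> (size a < size ('X : {poly K}))%N ->
    const_psv a \is a fin_num.
  move=> a0 /constE e; apply: val_fin; apply: contra_neq a0 => c0.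
  by rewrite e c0.
have carry (a b : {poly K}) : (size a < size ('X : {poly K}))%N ->
    (size b < size ('X : {poly K}))%N ->
    (const_psv (a * b)%R <= const_psv ((a * b) %/ 'X)%R + 0%:E)%E.
  move=> /constE -> /constE ->; rewrite -polyCM divp_small ?psv0 ?leey //.
  by rewrite size_polyX ltnS size_polyC leq_b1.
exists (fracval (augval_fin X2 modX finX carry)) => g.
rewrite pval_fracval -[in LHS](coefK g) poly_def.
under eq_bigr => i _ do rewrite -mul_polyC.
rewrite (augval_sum X2 modX finX carry _ (a := fun s => (g`_s)%:P)).
  by apply: eq_bigr => i _; rewrite mulr0 adde0 /= /const_val coefC eqxx.
by move=> s; rewrite size_polyX ltnS size_polyC leq_b1.
Qed.

Variables (mu : valuation {fraction {poly K}}) (mu_gauss : gauss_valuation v mu).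
Local Notation m := (polval mu).

Lemma gauss_ge (x : \bar rat) g : (x <= m g)%E <-> forall i, (i < size g)%N -> (x <= v g`_i)%E.
Proof.
rewrite polvalE mu_gauss; split=> [/bigmin_geP[_ H] i ig|H].
  by have := H (Ordinal ig) isT.
by apply/bigmin_geP; split=> [|i _]; rewrite ?leey // H.
Qed.

Lemma gauss_le g i : (m g <= v g`_i)%E.
Proof.
have [ig|ig] := ltnP i (size g); last by rewrite nth_default // Defs.val0 leey.
by have /gauss_ge := lexx (m g); apply.
Qed.

Lemma gauss_const c : m c%:P = v c.
Proof.
apply/eqP; rewrite eq_le; apply/andP; split.
  by have := gauss_le c%:P 0; rewrite coefC eqxx.
apply/gauss_ge => i; rewrite size_polyC; case: eqP => //= _.
by case: i => // _; rewrite coefC.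
Qed.

Lemma gauss_X : m 'X = 0%E.
Proof.
apply/eqP; rewrite eq_le; apply/andP; split.
  by have := gauss_le 'X 1; rewrite coefX eqxx Defs.val1.
apply/gauss_ge => i _; rewrite coefX; case: (i == 1%N); first by rewrite Defs.val1.
by rewrite Defs.val0 leey.
Qed.

Lemma gauss_extends : extends m.
Proof. by split; [exact: gauss_const | rewrite gauss_X]. Qed.

Lemma gauss_monic g : g \is monic -> (m g <= 0%:E)%E.
Proof.
by move=> /monicP gM; have := gauss_le g (size g).-1; rewrite -lead_coefE gM Defs.val1.
Qed.

End Gauss.

Lemma poly_expansion (K : fieldType) (phi g : {poly K}) : (1 < size phi)%N ->
  exists n (a : nat -> {poly K}), (forall s, (size (a s) < size phi)%N) /\
    g = \sum_(s < n) a s * phi ^+ s.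
Proof.
move=> s1; elim/(aug_ind s1): g => [|g [n [a [sa Eg]]]].
  by exists 0%N, (fun _ => 0); rewrite big_ord0 size_poly0 (ltn_trans _ s1).
have phi0 : phi != 0 by rewrite -size_poly_gt0 (ltn_trans _ s1).
exists n.+1, (fun s => if s is s'.+1 then a s' else g %% phi); split.
  by case=> // ; rewrite ltn_modpN0.
rewrite big_ord_recl expr0 mulr1 [LHS](divp_eq g phi) addrC {1}Eg mulr_suml.
by congr (_ + _); apply: eq_bigr => i _; rewrite /= /bump leq0n add1n exprSr mulrA.
Qed.

Section AugmentedValuation.
Variables (K : fieldType) (mu : valuation {fraction {poly K}}).
Variables (phi : {poly K}) (lambda : rat).
Hypothesis kphi : iskey (polval mu) phi.
Local Notation m := (polval mu).
Implicit Types (a b g q : {poly K}).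
Local Notation mf := (polval_fin mu).

(** The value of phi itself under the augmented valuation, as opposed to the increment lambda. *)
Definition aug_slope := fine (m phi) + lambda.

Let phi0 := key_neq0 kphi.
Let phi_size := key_size kphi.

Lemma aug_mod g : resval kphi g = resval kphi (g %% phi).
Proof. by rewrite !resvalE modp_id. Qed.

Lemma aug_fin_small a : a != 0 -> (size a < size phi)%N ->
  resval kphi a \is a fin_num.
Proof. by move=> a0 sa; rewrite resval_small // mf. Qed.

Lemma phi_fineK : (fine (m phi))%:E = m phi.
Proof. by rewrite fineK // mf. Qed.

Hypothesis lambda_ge0 : 0 <= lambda.

(** Splitting off the multiple of phi does not lower the value ([key_div_ge]), and lambda >= 0 only
    raises the value of phi. *)
Lemma aug_carry a b : (size a < size phi)%N -> (size b < size phi)%N ->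
  (resval kphi (a * b)%R <= resval kphi ((a * b) %/ phi)%R + aug_slope%:E)%E.
Proof.
move=> sa sb; rewrite resvalE key_mod_mul // resval_small; last first.
  rewrite size_divp //; have := size_polyMleq a b; move: sa sb phi_size.
  by set x := size a; set y := size b; set z := size phi; set t := size (a * b); lia.
apply: le_trans (key_div_ge kphi _) _; rewrite psvM leeD2l //.
by rewrite /aug_slope EFinD phi_fineK leeDl // lee_fin.
Qed.

Definition aug_psv := augval phi_size aug_mod aug_fin_small aug_carry.

Lemma augmentation_exists : exists mu', augmentation mu phi lambda mu'.
Proof.
exists (fracval (augval_fin phi_size aug_mod aug_fin_small aug_carry)) => n a sa.
rewrite pval_fracval augval_sum //; apply: eq_bigr => s _.
rewrite resval_small // -polvalE psvM -addeA; congr (_ + _)%E.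
rewrite (psvX s (esym phi_fineK)) -EFinD; congr EFin.
by rewrite /aug_slope mulrDr !mulr_natl.
Qed.

Variable mu' : valuation {fraction {poly K}}.
Hypothesis mu'_aug : augmentation mu phi lambda mu'.
Local Notation m' := (polval mu').

Lemma augmentationE g : m' g = aug_psv g.
Proof.
have [n [a [sa ->]]] := poly_expansion g phi_size.
rewrite polvalE mu'_aug // /aug_psv augval_sum //.
apply: eq_bigr => s _; rewrite resval_small // -polvalE psvM -addeA; congr (_ + _)%E.
rewrite (psvX s (esym phi_fineK)) -EFinD; congr EFin.
by rewrite /aug_slope mulrDr !mulr_natl.
Qed.

Lemma augmentation_small a : (size a < size phi)%N -> m' a = m a.
Proof.
by move=> sa; rewrite augmentationE /aug_psv augval_small // resval_small.
Qed.

Lemma augmentation_phi : m' phi = (m phi + lambda%:E)%E.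
Proof.
have -> : m' phi = m' (1 * phi + 0) by rewrite mul1r addr0.
rewrite augmentationE /aug_psv.
rewrite augval_exp ?size_poly0 ?(ltn_trans _ phi_size) //.
by rewrite !psv0 psv1 add0e minye /aug_slope EFinD phi_fineK.
Qed.

Lemma augmentation_exp q a : (size a < size phi)%N ->
  m' (q * phi + a) = Order.min (m a) (m' (q * phi)).
Proof.
move=> sa; rewrite augmentationE /aug_psv augval_exp //.
by rewrite resval_small // -augmentationE psvM augmentation_phi /aug_slope EFinD phi_fineK.
Qed.

Lemma augmentation_ge g : (m g <= m' g)%E.
Proof.
elim/(aug_ind phi_size): g => [|g IH]; first by rewrite !psv0.
rewrite [g in X in (_ <= X)%E](divp_eq g phi) augmentation_exp ?ltn_modpN0 //.
rewrite le_min; apply/andP; split; first exact: key_mod_ge.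
apply: le_trans (key_div_ge kphi _) _.
rewrite !psvM; apply: leeD => //; rewrite augmentation_phi leeDl // lee_fin.
Qed.

Lemma augmentation_extends (v : valuation K) : extends v m -> extends v m'.
Proof.
move=> [mC mX]; split; last exact: le_trans mX (augmentation_ge _).
move=> c; rewrite augmentation_small ?mC // size_polyC.
by case: (c == 0) => /=; [apply: ltn_trans (_ : 1 < _)%N|]; rewrite ?phi_size.
Qed.

End AugmentedValuation.

(** * MacLane chains *)

Lemma bigmin_attained n (F : 'I_n -> \bar rat) :
  \big[Order.min/+oo%E]_(i < n) F i = +oo%E \/
  exists i, \big[Order.min/+oo%E]_(i < n) F i = F i.
Proof.
elim/big_ind: _ => [|x y hx hy|i _]; [by left| |by right; exists i].
by rewrite minEle; case: ifP.
Qed.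

Section Chains.
Variables (K : fieldType) (v : valuation K).
Implicit Types (mu : valuation {fraction {poly K}}) (phi g q : {poly K}).
Implicit Types (phis : seq {poly K}).

Lemma chain_extends mu phis : maclane_chain v mu phis -> extends v (polval mu).
Proof.
elim=> [mu0 /gauss_extends//|mu0 mu' ps phi l _ IH /key_polynomial_iskey kphi l0 haug].
exact: augmentation_extends kphi (ltW l0) _ haug _ IH.
Qed.

Lemma inductive_extends mu : inductive_val v mu -> extends v (polval mu).
Proof. by case=> phis /chain_extends. Qed.

Definition common_denominator (N : nat) (x : rat) := exists z : int, N%:R * x = z%:~R.

Hypothesis hv : discrete_valuation v.

Lemma discrete_int c : c != 0 -> exists z : int, v c = (z%:~R)%:E.
Proof.
move=> c0; have : [set v a | a in [set a : K | a != 0]] (v c) by exists c.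
by rewrite hv => -[z _ <-]; exists z.
Qed.

Lemma discrete_surj (z : int) : exists2 c, c != 0 & v c = (z%:~R)%:E.
Proof.
have : range (fun n : int => (n%:~R : rat)%:E) (z%:~R)%:E by exists z.
by rewrite -hv => -[c c0 <-]; exists c.
Qed.

(** Each augmentation enlarges the denominator by that of its lambda only, so the value group stays
    discrete. *)
Lemma chain_denominator mu phis : maclane_chain v mu phis ->
  exists2 N, (0 < N)%N & forall g, g != 0 ->
    common_denominator N (fine (polval mu g)).
Proof.
elim=> [mu0 gmu0|mu0 mu' ps phi l _ [N N0 HN] /key_polynomial_iskey kphi l0 haug].
  exists 1%N => // g g0; have /fin_numP[_ /eqP goo] := polval_fin mu0 g0.
  have := goo; rewrite polvalE gmu0.
  case: (@bigmin_attained (size g) (fun i => v g`_i)) => [->//|[i ->] vi].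
  have [] := @discrete_int g`_i.
    by apply: contra_notN vi => /eqP ->; rewrite Defs.val0.
  by move=> z ->; exists z; rewrite mul1r.
exists (N * `|denq l|)%N; first by rewrite muln_gt0 N0 absz_gt0 denq_neq0.
move=> g g0; have /fin_numP[_ /eqP goo] := polval_fin mu' g0.
have [n [a [sa Eg]]] := poly_expansion g (key_size kphi).
have := goo; rewrite polvalE Eg haug //.
case: (@bigmin_attained n (fun s =>
  (pval mu0 (a s * phi ^+ s)%R + (s%:R * l)%:E)%E)) => [->//|[i ->]].
have [->|a0] := eqVneq (a i * phi ^+ i) 0; first by rewrite tofrac0 Defs.val0.
have [z Hz] := HN _ a0; have := polval_fin mu0 a0; rewrite polvalE in Hz *.
case: (pval mu0 _) Hz => // r /= Hz _ _.
exists (z * denq l + (N * i)%:Z * numq l).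
have -> : (N * `|denq l|)%:R = N%:R * (denq l)%:~R :> rat.
  by rewrite natrM natr_absz gtr0_norm // denq_gt0.
have e2 : ((N * i)%N%:Z)%:~R = N%:R * i%:R :> rat by rewrite -natrM pmulrn.
by rewrite intrD !intrM -Hz e2 numqE; ring.
Qed.

Lemma extends_scale (m : pseudoval K) c g : extends v m -> m (c *: g) = (v c + m g)%E.
Proof. by move=> [mC _]; rewrite -mul_polyC psvM mC. Qed.

Lemma monic_decomposition k g (phi : {poly K}) : g \is monic -> phi \is monic ->
  size g = k -> size phi = k -> (size (g - phi)%R < k)%N.
Proof.
move=> gM phiM sg sphi; have k0 : (0 < k)%N by rewrite -sg size_poly_gt0 monic_neq0.
rewrite -(ltn_predK k0) ltnS; apply/leq_sizeP => i; rewrite leq_eqVlt coefB.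
case/orP => [/eqP <-|ki].
  by move/monicP: gM; move/monicP: phiM; rewrite !lead_coefE sg sphi => -> ->; rewrite subrr.
by rewrite !nth_default ?subrr // ?sg ?sphi -(ltn_predK k0).
Qed.

(** * Climbing towards a given pseudo-valuation *)

Section MaximalWitness.
Variables (mu : valuation {fraction {poly K}}) (phis : seq {poly K}).
Hypothesis chain_mu : maclane_chain v mu phis.
Variables (m : pseudoval K) (k : nat) (B : rat).
Hypothesis mu_small : forall g, (size g < k)%N -> m g = polval mu g.
Hypothesis m_bounded : forall g, g \is monic -> size g = k -> (m g <= B%:E)%E.

(** If g of the same degree beats phi, then m phi = m (g - phi) = mu (g - phi) lies in (1/N) Z by
    [chain_denominator]. Values bounded by B cannot climb forever through this group. *)
Lemma maximal_witness phi : phi \is monic -> size phi = k -> (polval mu phi < m phi)%E ->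
  exists psi, [/\ psi \is monic, size psi = k, (polval mu psi < m psi)%E &
    forall g, g \is monic -> size g = k -> (m g <= m psi)%E].
Proof.
have [N N0 HN] := chain_denominator chain_mu.
pose isw phi := [/\ phi \is monic, size phi = k & (polval mu phi < m phi)%E].
have fin g : g \is monic -> size g = k -> m g = (fine (m g))%:E.
  move=> gM sg; have := m_bounded gM sg; have := psvNy m g.
  by case: (m g) => //= _; rewrite leye_eq.
have incr phi' g : isw phi' -> g \is monic -> size g = k -> (m phi' < m g)%E ->
    isw g /\ common_denominator N (fine (m phi')).
  move=> [phiM sphi lt_phi] gM sg lt_g.
  have sa := monic_decomposition gM phiM sg sphi.
  have ma : m (g - phi') = m phi' by rewrite psvBC psvB_eq.
  have mua : polval mu (g - phi') = m phi' by rewrite -mu_small.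
  split; last first.
    rewrite -mua; apply: HN; apply: (psv_neq0 (m := m)); rewrite ma.
    by rewrite fin.
  split=> //; apply: lt_trans lt_g; rewrite -[g](subrK phi') addrC.
  by rewrite psvD_eq ?mua.
(* n bounds the number of improvements still possible. *)
suff H : forall n phi', isw phi' -> N%:R * (B - fine (m phi')) <= n%:R ->
    exists psi, isw psi /\ forall g, g \is monic -> size g = k -> (m g <= m psi)%E.
  move=> phiM sphi lt_phi; have wphi : isw phi by [].
  have B0 : 0 <= N%:R * (B - fine (m phi)).
    rewrite mulr_ge0 // subr_ge0 -lee_fin -fin //; exact: m_bounded.
  have := archi_boundP B0; set n := Num.bound _ => /ltW hn.
  by have [psi [[? ? ?] ?]] := H n phi wphi hn; exists psi.
elim=> [|n IH] phi' wphi hn.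
  exists phi'; split=> // g gM sg; have [phiM sphi _] := wphi.
  rewrite (fin phi') //; apply: le_trans (m_bounded gM sg) _; rewrite lee_fin.
  by move: hn; rewrite pmulr_rle0 ?ltr0n // subr_le0.
have [maxp|] := pselect (forall g, g \is monic -> size g = k -> (m g <= m phi')%E).
  by exists phi'.
move=> /existsNP[g1 /not_implyP[g1M /not_implyP[sg1 /negP]]]; rewrite -ltNge => lt1.
have [wg1 [z1 Hz1]] := incr _ _ wphi g1M sg1 lt1.
(* Only the value of a non-maximal witness is known to lie in (1/N) Z; to gain a full 1/N from phi'
   to g1, g1 must be non-maximal too. *)
have [maxp|] := pselect (forall g, g \is monic -> size g = k -> (m g <= m g1)%E).
  by exists g1.
move=> /existsNP[g2 /not_implyP[g2M /not_implyP[sg2 /negP]]]; rewrite -ltNge => lt2.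
have [wg2 [z2 Hz2]] := incr _ _ wg1 g2M sg2 lt2.
apply: IH wg1 _.
have [phiM sphi _] := wphi; move: lt1; rewrite fin // (fin g1) // lte_fin => lt1.
have : N%:R * fine (m phi') < N%:R * fine (m g1) by rewrite ltr_pM2l // ltr0n.
rewrite Hz1 Hz2 ltr_int -lezD1 => lez; move: hn; rewrite !mulrBr Hz1 Hz2 -natr1.
by have : (z1 + 1)%:~R <= z2%:~R :> rat by [rewrite ler_int]; rewrite intrD; lra.
Qed.

End MaximalWitness.

Section Approximation.
Variables (m : pseudoval K) (n : nat).
Hypothesis m_extends : extends v m.
Hypothesis m_bounded : forall k, (1 < k < n)%N -> exists B : rat,
  forall g, g \is monic -> size g = k -> (m g <= B%:E)%E.

(** In degree k either mu already agrees with m, or one augments by a monic phi of degree k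
    maximizing m, with slope m phi - mu phi. Maximality of phi then gives agreement on all
    polynomials of that degree. *)
Lemma chain_approximation k : (1 < k <= n)%N -> exists mu phis,
  [/\ optimal_chain v mu phis, forall g, (polval mu g <= m g)%E,
      forall g, (size g < k)%N -> m g = polval mu g &
      forall phi, phi \in phis -> (size phi < k)%N].
Proof.
elim: k => // k IH /andP[k1 kn].
move: k1; rewrite ltnS leq_eqVlt => /orP[/eqP <-|k1].
  have [mu gmu] := gauss_exists v; exists mu, [::]; split=> //.
  - by split=> //; exact: MacLane_nil.
  - by move=> g; apply: extends_ge m_extends _ => i _; exact: gauss_le.
  - move=> g; rewrite ltnS => /size1_polyC ->; rewrite (gauss_const gmu).
    by have [->] := m_extends.
have [|mu [phis [[cmu smu] mu_le mu_small sphis]]] := IH.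
  by rewrite k1 ltnW.
have kmax : (1 < k < n)%N by rewrite k1 kn.
have [B mB] := m_bounded kmax.
have scale g : size g = k -> exists c g1, [/\ g = c *: g1, g1 \is monic & size g1 = k].
  move=> sg; have g0 : g != 0 by rewrite -size_poly_gt0 sg ltnW.
  have c0 : lead_coef g != 0 by rewrite lead_coef_eq0.
  exists (lead_coef g), ((lead_coef g)^-1 *: g); rewrite size_scale ?invr_neq0 //.
  by rewrite scalerA divff // scale1r; split=> //; rewrite monicE lead_coefZ mulVf.
have [[phi [phiM sphi lt_phi]]|noW] := pselect (exists phi,
  [/\ phi \is monic, size phi = k & (polval mu phi < m phi)%E]); last first.
  exists mu, phis; split=> // [g|phi /sphis]; last by move/ltnW.
  rewrite ltnS leq_eqVlt => /orP[/eqP/scale[c [g1 [-> g1M sg1]]]|]; last exact: mu_small.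
  rewrite !extends_scale //; last exact: chain_extends cmu.
  congr (_ + _)%E; apply/eqP; rewrite eq_le mu_le andbT leNgt; apply/negP => lt1.
  by apply: noW; exists g1.
have {phi phiM sphi lt_phi}[phi [phiM sphi lt_phi phi_max]] :=
  maximal_witness cmu mu_small mB phiM sphi lt_phi.
have phi_size : (1 < size phi)%N by rewrite sphi.
have kphi : iskey (polval mu) phi.
  apply: minimal_witness_key (polval_fin mu) mu_le _ phiM phi_size lt_phi.
  by move=> g; rewrite sphi; exact: mu_small.
have mphi : m phi = (fine (m phi))%:E.
  have := mB _ phiM sphi; have := psvNy m phi.
  by case: (m phi) => //= _; rewrite leye_eq.
have muphi := phi_fineK kphi.
pose l := fine (m phi) - fine (polval mu phi).
have l0 : 0 < l by rewrite subr_gt0 -lte_fin -mphi muphi.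
have [mu' haug] := augmentation_exists kphi (ltW l0).
have small' g : (size g < k)%N -> m g = polval mu' g.
  by move=> sg; rewrite (augmentation_small kphi (ltW l0) haug) ?sphi // mu_small.
have mu'phi : polval mu' phi = m phi.
  rewrite (augmentation_phi kphi (ltW l0) haug) -muphi mphi -EFinD /l.
  by rewrite addrC subrK.
have mu'_le g : (polval mu' g <= m g)%E.
  elim/(aug_ind phi_size): g => [|g IHg]; first by rewrite !psv0.
  have phi0 : phi != 0 by exact: monic_neq0.
  rewrite (divp_eq g phi) (augmentation_exp kphi (ltW l0) haug) ?ltn_modpN0 //.
  rewrite addrC; apply: le_trans (psvD _ _ _).
  rewrite le_min !ge_min -mu_small ?lexx -?sphi ?ltn_modpN0 //.
  by rewrite !psvM mu'phi leeD2r ?orbT.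
exists mu', (rcons phis phi); split=> //.
- split; first exact: MacLane_rcons cmu (iskey_key_polynomial kphi) l0 haug.
  move: smu; rewrite map_rcons; case: phis sphis {cmu} => //= p ps sphis.
  rewrite rcons_path => ->; rewrite (last_map (fun psi : {poly K} => size (polyseq psi)) ps p).
  by rewrite sphi; apply: sphis; exact: mem_last.
- move=> g; rewrite ltnS leq_eqVlt => /orP[/eqP/scale[c [g1 [-> g1M sg1]]]|]; last exact: small'.
  rewrite !extends_scale //; last first.
    exact: augmentation_extends kphi (ltW l0) _ haug _ (chain_extends cmu).
  congr (_ + _)%E; apply/eqP; rewrite eq_le mu'_le andbT.
  have sa := monic_decomposition g1M phiM sg1 sphi.
  have -> : g1 = 1 * phi + (g1 - phi) by rewrite mul1r addrC subrK.
  rewrite (augmentation_exp kphi (ltW l0) haug) ?sphi // mul1r -mu_small // mu'phi.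
  have -> : phi + (g1 - phi) = g1 by rewrite addrC subrK.
  (* If [g1 - phi] had m-value below that of g1, phi would have this smaller value too, against its
     maximality. *)
  rewrite le_min phi_max // andbT leNgt; apply/negP => lt1.
  have : m phi = m (g1 - phi).
    by rewrite -psvN -(psvB_eq lt1); congr (m _); ring.
  by move=> e; move: lt1; rewrite -e ltNge phi_max.
- move=> psi; rewrite mem_rcons inE => /orP[/eqP ->|/sphis/ltnW//].
  by rewrite sphi.
Qed.

End Approximation.

End Chains.

(** Were m T larger than m G, the remainder R would have the initial form of G and be divisible by
    it, although its degree is smaller. *)
Lemma key_lead_le (K : fieldType) (m : pseudoval K) (G T R : {poly K}) :
  iskey m G -> G = T + R -> (size R < size G)%N -> (m T <= m G)%E.
Proof.
move=> kG EG sR; rewrite leNgt; apply/negP => lt_T.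
have TGR : T = G - R by rewrite EG addrK.
have mR : m R = m G by apply: psv_sub_eq; rewrite -TGR.
have R0 : R != 0.
  by apply: contraTneq lt_T => R0; rewrite EG R0 addr0 ltxx.
apply: (key_min kG R0 sR); exists 1.
by rewrite mulr1 mR psvBC -TGR.
Qed.

(** * Values of strong key polynomials of an augmentation *)

Section Slope.
Variables (K : fieldType) (mu mu' : valuation {fraction {poly K}}).
Variables (phi : {poly K}) (lambda : rat).
Hypotheses (kphi : iskey (polval mu) phi) (lambda_gt0 : 0 < lambda).
Hypothesis mu'_aug : augmentation mu phi lambda mu'.
Local Notation m := (polval mu).
Local Notation m' := (polval mu').
Implicit Types (a b g q R G : {poly K}).

Let lambda_ge0 := ltW lambda_gt0.
Let phiM := key_monic kphi.
Let phi_size := key_size kphi.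
Let phi0 : phi != 0 := monic_neq0 phiM.
Local Notation augE := (augmentation_exp kphi lambda_ge0 mu'_aug).
Local Notation aug_smallE := (augmentation_small kphi lambda_ge0 mu'_aug).
Local Notation aug_phiE := (augmentation_phi kphi lambda_ge0 mu'_aug).

Lemma size_phiX l : size (phi ^+ l) = ((size phi).-1 * l).+1.
Proof. by rewrite -size_exp prednK // size_poly_gt0 expf_neq0. Qed.

(** The augmented value is a minimum over phi-digits, and the digits of [a * phi ^+ l] are among
    those of the sum. *)
Lemma augmentation_split l a R : (size R < size (phi ^+ l)%R)%N ->
  (m' (a * phi ^+ l + R)%R <= m' (a * phi ^+ l)%R)%E.
Proof.
elim: l R => [|l IH] R sR.
  have -> : R = 0 by apply/eqP; rewrite -size_poly_leq0 -ltnS; move: sR; rewrite expr0 size_poly1.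
  by rewrite addr0.
have -> : a * phi ^+ l.+1 + R = (a * phi ^+ l + R %/ phi) * phi + R %% phi.
  by rewrite mulrDl -addrA -divp_eq exprSr mulrA.
rewrite augE ?ltn_modpN0 // ge_min; apply/orP; right.
rewrite exprSr mulrA !psvM leeD2r // -psvM; apply: IH.
rewrite size_divp // size_phiX; move: sR; rewrite size_phiX mulnS.
move: phi_size; set x := size R; set y := size phi; set z := (y.-1 * l)%N.
by lia.
Qed.

(** Strict form of the carry inequality: after augmentation a carry gains at least lambda, so for
    lambda > 0 it is negligible. *)
Lemma mulphi_carry a b : (size a < size phi)%N -> (size b < size phi)%N ->
  (m a + m b + lambda%:E <= m' ((a * b) %/ phi * phi)%R)%E.
Proof.
move=> sa sb; rewrite psvM aug_smallE; last first.
  rewrite size_divp //; have := size_polyMleq a b; move: sa sb phi_size.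
  by set x := size a; set y := size b; set z := size phi; set t := size (a * b); lia.
by rewrite aug_phiE addeA -!psvM leeD2r // key_div_ge.
Qed.

(* If the leading phi-digit a of G were not 1, multiplying G by an inverse b  *)
(* of a modulo phi and discarding the carries, which have larger mu'-value,   *)
(* would give a multiple of G in Gr(mu') of degree smaller than deg G.        *)
Lemma strong_key_lead G : iskey m' G -> (size phi < size G)%N ->
  exists2 l, size G = ((size phi).-1 * l).+1 &
    m' G = (l%:R * fine (m' phi))%:E.
Proof.
move=> kG sG; have GM := key_monic kG.
pose d := (size phi).-1; pose l := ((size G).-1 %/ d)%N.
have d0 : (0 < d)%N by rewrite /d; move: phi_size; case: (size phi) => [|[]].
have l1 : (0 < l)%N.
  rewrite /l divn_gt0 // /d; move: sG phi_size.
  by set x := size G; set y := size phi; lia.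
pose a := G %/ phi ^+ l; pose R := G %% phi ^+ l.
have X0 : phi ^+ l != 0 by rewrite expf_neq0.
have EG : G = a * phi ^+ l + R by exact: divp_eq.
have sR : (size R < size (phi ^+ l)%R)%N by exact: ltn_modpN0.
have sdl : size (phi ^+ l) = (d * l).+1 by exact: size_phiX.
have dl : (d * l <= (size G).-1)%N by rewrite mulnC leq_divM.
have sG1 : (size G).-1.+1 = size G by rewrite prednK // (leq_ltn_trans _ sG).
have sRG : (size R < size G)%N.
  by apply: leq_trans sR _; rewrite sdl -sG1 ltnS.
have aM : a \is monic.
  have : lead_coef (a * phi ^+ l + R) = 1 by rewrite -EG (monicP GM).
  have a0 : a != 0.
    by rewrite divpN0 // sdl -sG1 ltnS.
  rewrite lead_coefDl; first by rewrite lead_coef_Mmonic ?monic_exp // => /eqP.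
  apply: leq_trans sR _; rewrite size_Mmonic ?monic_exp // sdl addnS /=.
  by have := size_poly_gt0 a; rewrite a0; case: (size a) => // n _; rewrite addSn ltnS leq_addl.
have sa : (size a < size phi)%N.
  rewrite size_divp // sdl /= [(d * l)%N]mulnC; have := ltn_ceil (size G).-1 d0.
  rewrite -/l mulSn; set z := (l * d)%N; move: sG1 phi_size; rewrite /d.
  by set x := size G; set y := size phi; lia.
have mG : m' G = m' (a * phi ^+ l).
  apply/eqP; rewrite eq_le {1}EG augmentation_split //=.
  exact: key_lead_le kG EG sRG.
have m'phi : m' phi = (fine (m' phi))%:E by rewrite fineK // polval_fin.
have mX k : m' (phi ^+ k) = (k%:R * fine (m' phi))%:E.
  by rewrite (psvX k m'phi) mulr_natl.
have [a1|a1] := leqP (size a) 1.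
  have a_eq1 : a = 1.
    have /size1_polyC ea := a1; move: aM; rewrite ea monicE lead_coefC => /eqP ->.
    by [].
  exists l; last by rewrite mG a_eq1 mul1r mX.
  apply/eqP; rewrite eqn_leq; apply/andP; split; last by rewrite -sG1 ltnS.
  rewrite EG a_eq1 mul1r; apply: leq_trans (size_polyD _ _) _.
  by rewrite geq_max sdl leqnn ltnW // -sdl.
have a0 : a != 0 by exact: monic_neq0.
exfalso.
have [b [sb ab1 mab]] := key_inverse (polval_fin mu) kphi a0 sa.
have b0 : b != 0 by apply: contra_eq_neq ab1 => ->; rewrite mulr0 mod0p eq_sym oner_neq0.
pose c := (a * b) %/ phi; have Eab : a * b = c * phi + 1 by rewrite {1}(divp_eq (a * b) phi) ab1.
have mc : (lambda%:E <= m' (c * phi)%R)%E.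
  by have := mulphi_carry sa sb; rewrite mab add0e.
(* The next digit a' is split off because the carry c' of [a' * b] lands on [phi ^+ l]; the product
   [R' * b] stays below that degree. *)
pose a' := R %/ phi ^+ l.-1; pose R' := R %% phi ^+ l.-1.
have ER : R = a' * phi ^+ l.-1 + R' by exact: divp_eq.
have X'0 : phi ^+ l.-1 != 0 by rewrite expf_neq0.
have sR' : (size R' < size (phi ^+ l.-1)%R)%N by exact: ltn_modpN0.
have sdl' : size (phi ^+ l.-1) = (d * l.-1).+1 by exact: size_phiX.
have dll : (d * l = d + d * l.-1)%N by rewrite -mulnS prednK.
have sa' : (size a' < size phi)%N.
  rewrite size_divp // sdl' /=; move: sR; rewrite sdl dll ltnS /d.
  by move: phi_size; set x := size R; set y := size phi; set z := (_ * _)%N; lia.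
pose c' := (a' * b) %/ phi; pose r' := (a' * b) %% phi.
have Eab' : a' * b = c' * phi + r' by exact: divp_eq.
(* Without the carries, [G * b] becomes [phi ^+ l + S], of degree smaller than deg G. *)
pose S := r' * phi ^+ l.-1 + R' * b.
have El : phi ^+ l = phi * phi ^+ l.-1 by rewrite -exprS prednK.
have Ebg : G * b = (phi ^+ l + S) + (c * phi * phi ^+ l + c' * phi ^+ l).
  have -> : G * b = (a * b) * phi ^+ l + ((a' * b) * phi ^+ l.-1 + R' * b).
    by rewrite {1}EG ER; ring.
  by rewrite Eab Eab' /S El; ring.
have sS : (size S < size (phi ^+ l)%R)%N.
  rewrite sdl ltnS; apply: leq_trans (size_polyD _ _) _; rewrite geq_max.
  have sr' : (size r' < size phi)%N by exact: ltn_modpN0.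
  apply/andP; split.
    apply: leq_trans (size_polyMleq _ _) _; rewrite sdl' addnS /= dll leq_add2r.
    by move: sr'; rewrite /d; case: (size phi).
  apply: leq_trans (size_polyMleq _ _) _; move: sR' sb; rewrite sdl' dll /d.
  by set x := size R'; set y := size b; set z := size phi; set t := (_ * _)%N; lia.
have sG2 : (size (phi ^+ l + S)%R < size G)%N.
  rewrite size_polyDl // EG size_polyDl; last first.
    apply: leq_trans sR _; rewrite size_Mmonic ?monic_exp // sdl addnS /=.
    by move: a1; case: (size a) => // n _; rewrite addSn ltnS leq_addl.
  rewrite size_Mmonic ?monic_exp // addnC; move: a1 sdl; set x := size a; set y := size (phi ^+ l).
  by lia.
have G20 : phi ^+ l + S != 0 by rewrite -size_poly_gt0 size_polyDl // sdl.
have mbG : m' (G * b) = m' (phi ^+ l).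
  rewrite psvM mG psvM (aug_smallE sa) (aug_smallE sb) addeAC mab add0e //.
have mR : (m' G <= m' R)%E.
  have -> : R = G - a * phi ^+ l by rewrite EG addrAC subrr add0r.
  by apply: psvB_ge; rewrite ?mG.
(* Each carry exceeds the value of [G * b], which is that of [phi ^+ l], by at least lambda. *)
have lt_err : (m' (phi ^+ l)%R < m' (c * phi * phi ^+ l + c' * phi ^+ l)%R)%E.
  apply: psvD_gt.
    rewrite psvM -[X in (X < _)%E]add0e; rewrite lteD2rE ?mX //.
    by apply: lt_le_trans mc; rewrite lte_fin.
  have -> : c' * phi ^+ l = (c' * phi) * phi ^+ l.-1 by rewrite El mulrA.
  rewrite [X in (_ < X)%E]psvM.
  apply: lt_le_trans (leeD2r (m' (phi ^+ l.-1)) (mulphi_carry sa' sb)).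
  rewrite -mbG psvM.
  have : (m' G <= m' (a' * phi ^+ l.-1)%R)%E.
    by apply: le_trans mR _; rewrite {1}ER augmentation_split.
  rewrite psvM (aug_smallE sa') -(aug_smallE sb).
  rewrite (mX l.-1).
  move: (polval_fin mu' (monic_neq0 GM)) (polval_fin mu' b0) (psvNy m a').
  case: (m' G) => [gG||] //; case: (m' b) => [gb||] //; case: (m a') => [ga||] // _ _ _.
    by rewrite -!EFinD lee_fin lte_fin; move: lambda_gt0; lra.
  by rewrite !addye // -EFinD ltry.
apply: (key_min kG G20 sG2); exists b.
have e : G * b - (phi ^+ l + S) = c * phi * phi ^+ l + c' * phi ^+ l.
  by rewrite Ebg addrAC subrr add0r.
have mG2 : m' (phi ^+ l + S) = m' (phi ^+ l).
  by rewrite -mbG; apply: psv_sub_eq; rewrite e mbG.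
by rewrite mG2 psvBC e.
Qed.

End Slope.

(** * Slopes along an optimal chain *)

Section OptimalChains.
Variables (K : fieldType) (v : valuation K).
Implicit Types (mu : valuation {fraction {poly K}}) (phi g q G : {poly K}).
Implicit Types (phis : seq {poly K}).

Definition strong_over phis phi := phis = [::] \/ (size (last 0%R phis) < size phi)%N.

Lemma chain_rcons_inv mu' phis phi : maclane_chain v mu' (rcons phis phi) ->
  exists mu lambda, [/\ maclane_chain v mu phis, iskey (polval mu) phi, 0 < lambda
    & augmentation mu phi lambda mu'].
Proof.
move: {-2}(rcons phis phi) (erefl (rcons phis phi)) => l el cl.
case: cl el => [mu _|mu mu'' ps p lambda cmu /key_polynomial_iskey kp l0 haug].
  by move/(congr1 size); rewrite size_rcons.
by move/rcons_inj => -[e1 e2]; exists mu, lambda; rewrite -e1 -e2.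
Qed.

Lemma sorted_size_rcons phis phi :
  sorted ltn [seq size (polyseq psi) | psi <- rcons phis phi] <->
  sorted ltn [seq size (polyseq psi) | psi <- phis] /\ strong_over phis phi.
Proof.
rewrite map_rcons /strong_over; case: phis => [|p ps] /=; first by split=> // _; split=> //; left.
rewrite rcons_path (last_map (fun psi : {poly K} => size (polyseq psi)) ps p).
by split=> [/andP[-> ?]|[-> [//|sz]]]; [split=> //; right | exact: sz].
Qed.

Lemma optimal_rcons_inv mu' phis phi : optimal_chain v mu' (rcons phis phi) ->
  exists mu lambda, [/\ optimal_chain v mu phis, iskey (polval mu) phi, 0 < lambda,
    augmentation mu phi lambda mu' & strong_over phis phi].
Proof.
case=> /chain_rcons_inv[mu [l [cmu kphi l0 haug]]] /sorted_size_rcons[sphis str].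
by exists mu, l.
Qed.

(* the Okutsu constants C_i, see okutsu_C_chain *)
Definition chain_C mu phis (i : nat) : rat :=
  if i is j.+1 then
    fine (polval mu (nth 0 phis j)) / (size (nth 0 phis j)).-1%:R
  else 0.

Local Notation deg g := ((size (g : {poly K})).-1%:R : rat).

Lemma deg_gt0 g : (1 < size g)%N -> 0 < deg g.
Proof. by rewrite ltr0n; case: (size g) => [|[]]. Qed.

(** The constant C_r is the largest slope mu(g)/deg g of a monic g, and strong key polynomials
    attain it. The bound follows by division by the last key polynomial, whose slope exceeds the
    earlier ones; equality is [strong_key_lead], or comparison with x^n in the Gauss case. *)
Lemma chain_slope phis mu : optimal_chain v mu phis ->
  (forall g, g \is monic -> (polval mu g <= (chain_C mu phis (size phis) * deg g)%:E)%E) /\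
  (forall G, iskey (polval mu) G -> strong_over phis G ->
    polval mu G = (chain_C mu phis (size phis) * deg G)%:E).
Proof.
elim/last_ind: phis mu => [|phis phi IH] mu'.
  case=> cmu _; have gmu : gauss_valuation v mu'.
    move: {-1}[::] (erefl ([::] : seq {poly K})) cmu => l el cl.
    by case: cl el => // mu mu'' ps p lambda _ _ _ _ /(congr1 size); rewrite size_rcons.
  rewrite /chain_C; split=> [g gM|G kG _]; first by rewrite mul0r (gauss_monic gmu).
  rewrite mul0r; have GM := key_monic kG; have sG := key_size kG.
  apply/eqP; rewrite eq_le (gauss_monic gmu) //=.
  have nG : (size G).-1.+1 = size G by rewrite prednK // ltnW.
  have EG : G = 'X^((size G).-1) + (G - 'X^((size G).-1)) by rewrite addrC subrK.
  have X0 : polval mu' 'X^((size G).-1) = 0%:E.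
    by rewrite (psvX _ (gauss_X gmu)) mul0rn.
  rewrite -X0; apply: key_lead_le kG EG _; apply: monic_decomposition => //.
    by rewrite monicXn.
  by rewrite size_polyXn.
move=> /optimal_rcons_inv[mu [l [cmu kphi l0 haug str]]].
have [IHa IHb] := IH _ cmu; have := IHb _ kphi str.
rewrite size_rcons [chain_C mu' _ _]/= nth_rcons ltnn eqxx.
set C := chain_C mu phis (size phis) => mphi; set C' := (_ / _).
have phi_size := key_size kphi; have d0 := deg_gt0 phi_size.
have l0' := ltW l0.
have m'phi : polval mu' phi = (C' * deg phi)%:E.
  rewrite /C' divfK ?gt_eqF // fineK // polval_fin // monic_neq0 //.
  exact: key_monic kphi.
have C'C : C <= C'.
  have := augmentation_phi kphi l0' haug; rewrite mphi m'phi -EFinD => -[e].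
  by rewrite -(ler_pM2r d0) e; lra.
split.
  move=> g; have [n] := ubnP (size g); elim: n g => // n IHn g sg gM.
  have [sphi|sphi] := ltnP (size g) (size phi).
    rewrite (augmentation_small kphi l0' haug) //; apply: le_trans (IHa _ gM) _.
    by rewrite lee_fin ler_wpM2r.
  have phi0 : phi != 0 by exact: key_neq0 kphi.
  have q0 : g %/ phi != 0 by rewrite divpN0.
  have sr := ltn_modpN0 g phi0.
  have Eg := divp_eq g phi.
  have sqphi : (size (g %% phi)%R < size (g %/ phi * phi)%R)%N.
    apply: leq_trans sr _; rewrite size_Mmonic ?(key_monic kphi) //.
    move: q0; rewrite -size_poly_gt0; case: (size (g %/ phi)) => // k _.
    by rewrite addSn /= leq_addl.
  have qM : g %/ phi \is monic.
    move: gM; rewrite {1}Eg monicE lead_coefDl // lead_coef_Mmonic //.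
    exact: key_monic kphi.
  have sge : (size g).-1 = ((size (g %/ phi)%R).-1 + (size phi).-1)%N.
    rewrite [in LHS]Eg size_polyDl // size_Mmonic ?(key_monic kphi) //.
    move: q0 phi_size; rewrite -size_poly_gt0; case: (size (g %/ phi)) => // k _.
    by case: (size phi) => // k' _; rewrite addSn addnS.
  rewrite {1}Eg (augmentation_exp kphi l0' haug) // ge_min; apply/orP; right.
  rewrite psvM m'phi sge natrD mulrDr EFinD leeD2r // IHn //.
  rewrite -ltnS; apply: leq_trans sg; rewrite ltnS.
  by apply: size_divp_lt => //; apply: monic_neq0.
move=> G kG [/(congr1 size)|]; rewrite ?size_rcons // last_rcons => sG.
have [k sGk ->] := strong_key_lead kphi l0 haug kG sG.
by rewrite m'phi sGk /= natrM; congr EFin; ring.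
Qed.

Lemma optimal_keys phis mu : maclane_chain v mu phis ->
  forall phi, phi \in phis -> phi \is monic /\ (1 < size phi)%N.
Proof.
elim=> // mu0 mu' ps phi l _ IH /key_polynomial_iskey kphi _ _ psi.
rewrite mem_rcons inE => /orP[/eqP ->|/IH//].
by split; [exact: key_monic kphi | exact: key_size kphi].
Qed.

(** [mui] is the intermediate valuation of the chain just before augmenting by [nth 0 phis i]. This
    and the later augmentations use polynomials of at least that degree, so values below it do not
    change. *)
Lemma chain_take phis mu : optimal_chain v mu phis -> forall i, (i < size phis)%N ->
  exists mui, [/\ optimal_chain v mui (take i phis),
    iskey (polval mui) (nth 0 phis i), strong_over (take i phis) (nth 0 phis i),
    forall g, (size g < size (nth 0%R phis i))%N -> polval mui g = polval mu g &
    (polval mui (nth 0%R phis i) < polval mu (nth 0%R phis i))%E].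
Proof.
elim/last_ind: phis mu => // phis phi IH mu' /[dup] opt.
move=> /optimal_rcons_inv[mu [l [cmu kphi l0 haug str]]] i.
rewrite size_rcons ltnS leq_eqVlt => /orP[/eqP ->|iphis].
  rewrite nth_rcons ltnn eqxx -cats1 take_size_cat //; exists mu; split=> //.
    by move=> g sg; rewrite (augmentation_small kphi (ltW l0) haug).
  rewrite (augmentation_phi kphi (ltW l0) haug) lteDl ?lte_fin //.
  by rewrite polval_fin // (key_neq0 kphi).
have [mui [copt kphii stri small lt_i]] := IH _ cmu _ iphis.
rewrite nth_rcons iphis -cats1 takel_cat ?(ltnW iphis) //; exists mui; split=> //.
  move=> g sg; rewrite small // (augmentation_small kphi (ltW l0) haug) //.
  apply: ltn_trans sg _; move: opt.2; rewrite map_rcons.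
  set s := [seq _ | _ <- phis] => srt.
  have := sorted_ltn_nth ltn_trans 0%N srt; move=> /(_ i (size phis)).
  rewrite !inE size_rcons size_map leqnn ltnS (ltnW iphis) => /(_ isT isT iphis).
  by rewrite !nth_rcons size_map iphis ltnn eqxx (nth_map 0).
by apply: lt_le_trans lt_i _; apply: augmentation_ge haug _ => //; exact: ltW.
Qed.

(** The inequalities of an Okutsu frame, read in mu: [chain_slope] is applied to each truncated
    chain, and C_i increases because augmentation raises the value of its key polynomial. *)
Lemma chain_frame phis mu : optimal_chain v mu phis ->
  [/\ forall i, (i < size phis)%N -> chain_C mu phis i < chain_C mu phis i.+1,
      forall i g, (i < size phis)%N -> g \is monic ->
        (size g < size (nth 0%R phis i))%N ->
        (polval mu g <= (chain_C mu phis i * deg g)%:E)%E,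
      forall g, g \is monic -> (polval mu g <= (chain_C mu phis (size phis) * deg g)%:E)%E &
      forall G, iskey (polval mu) G -> strong_over phis G ->
        polval mu G = (chain_C mu phis (size phis) * deg G)%:E].
Proof.
move=> opt; have [slope_a slope_b] := chain_slope opt.
have CE i mui : (i < size phis)%N -> strong_over (take i phis) (nth 0 phis i) ->
    (forall g, (size g < size (nth 0%R phis i))%N -> polval mui g = polval mu g) ->
    chain_C mui (take i phis) (size (take i phis)) = chain_C mu phis i.
  move=> iphis str small; rewrite size_takel ?(ltnW iphis) //.
  case: i iphis str small => // i iphis str small; rewrite /chain_C nth_take //.
  rewrite small //; case: str.
    by move/(congr1 size); rewrite size_takel ?(ltnW iphis).
  by rewrite -nth_last size_takel ?(ltnW iphis) // nth_take.
split=> // [i iphis|i g iphis gM sg].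
  have [mui [copt kphii str small lt_i]] := chain_take opt iphis.
  have [_ /(_ _ kphii str)] := chain_slope copt.
  rewrite (CE i) // => e; have sphi := key_size kphii; have d0 := deg_gt0 sphi.
  rewrite [X in _ < X]/= ltr_pdivlMr // -lte_fin -e fineK // polval_fin //.
  exact: key_neq0 kphii.
have [mui [copt kphii str small lt_i]] := chain_take opt iphis.
have [/(_ _ gM) + _] := chain_slope copt.
by rewrite (CE i) // small.
Qed.

End OptimalChains.

Lemma lte_EFinB (r s : rat) (x : \bar rat) : ((r - s)%:E < x -> r%:E < s%:E + x)%E.
Proof.
case: x => [x||] //; last by move=> _; rewrite addey // ltry.
by rewrite -EFinD !lte_fin; lra.
Qed.

(** * Passage to the completion *)

Section Congruence.
Variables (K : fieldType) (m : pseudoval K) (mf : psv_finite m).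
Implicit Types (g h phi q : {poly K}).

(** The hypothesis says that g and g' have the same initial form. *)
Lemma mdiv_congr h g g' : (m g < m (g - g')%R)%E -> mdiv m h g -> mdiv m h g'.
Proof.
move=> gg' [q gq]; exists q; rewrite (psv_sub_eq gg').
have -> : g' - h * q = (g - h * q) - (g - g') by ring.
exact: psvB_gt.
Qed.

Lemma mdiv_congr_l phi phi' g : g != 0 -> (m phi < m (phi - phi')%R)%E ->
  mdiv m phi g -> mdiv m phi' g.
Proof.
move=> g0 phi_phi' [q gq]; exists q.
have -> : g - phi' * q = (g - phi * q) + (phi - phi') * q by ring.
apply: psvD_gt => //; rewrite -(psv_sub_eq gq) !psvM.
have q0 : q != 0 by apply: contraTneq gq => ->; rewrite mulr0 subr0 ltxx.
by rewrite lteD2rE // mf.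
Qed.

Lemma iskey_congr phi phi' : iskey m phi -> phi' \is monic ->
  size phi' = size phi -> (m phi < m (phi - phi')%R)%E -> iskey m phi'.
Proof.
move=> kphi phi'M sphi' lt_phi.
have lt_phi' : (m phi' < m (phi' - phi)%R)%E by rewrite (psv_sub_eq lt_phi) psvBC.
split=> //; first by rewrite sphi' (key_size kphi).
  move=> a b a0 b0 /(mdiv_congr_l (mulf_neq0 a0 b0) lt_phi').
  by case/(key_prime kphi a0 b0) => H; [left|right]; exact: mdiv_congr_l H.
move=> g g0; rewrite sphi' => sg /(mdiv_congr_l g0 lt_phi').
exact: (key_min kphi).
Qed.

(** Minimality forces equal degrees. Then [phi - psi] is the psi-digit of degree zero of
    [phi - psi * q], so [key_exp_le] bounds its value from below. *)
Lemma key_mdiv_congr phi psi : iskey m phi -> iskey m psi ->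
  mdiv m phi psi -> mdiv m psi phi ->
  size phi = size psi /\ (m phi < m (phi - psi)%R)%E.
Proof.
move=> kphi kpsi d1 d2.
have phi0 := key_neq0 kphi; have psi0 := key_neq0 kpsi.
have s1 : (size phi <= size psi)%N.
  by rewrite leqNgt; apply/negP => s; exact: (key_min kphi psi0 s).
have s2 : (size psi <= size phi)%N.
  by rewrite leqNgt; apply/negP => s; exact: (key_min kpsi phi0 s).
have s : size phi = size psi by apply/eqP; rewrite eqn_leq s1 s2.
split=> //; case: d2 => q hq.
have sa : (size (phi - psi)%R < size psi)%N.
  exact: monic_decomposition (key_monic kphi) (key_monic kpsi) s _.
have := (key_exp_le kpsi (1 - q) sa).1.
have -> : (1 - q) * psi + (phi - psi) = phi - psi * q by ring.
exact: lt_le_trans.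
Qed.

End Congruence.

(** * Comparison of K and K_v by approximation *)

Section Completion.
Variables (K Kv : fieldType) (v : valuation K) (vh : valuation Kv).
Variable iota : {rmorphism K -> Kv}.
Hypotheses (hv : discrete_valuation v) (hvh : completion v vh iota).
Local Notation "g ^io" := (map_poly iota g) (at level 2, format "g ^io").
Implicit Types (mu : valuation {fraction {poly K}}).
Implicit Types (muh : valuation {fraction {poly Kv}}).

Lemma vh_iota a : vh (iota a) = v a.
Proof. by have [-> _ _] := hvh. Qed.

(** An element of K close enough to b has the value of b. *)
Lemma completion_discrete : discrete_valuation vh.
Proof.
apply/seteqP; split=> y /=.
  move=> [b b0 <-]; have := val_fin vh b0; case vb : (vh b) => [r||] // _.
  have [_ /(_ b (r + 1))[a ha] _] := hvh.
  have lt1 : (r%:E < vh (b - iota a)%R)%E.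
    by apply: lt_le_trans ha; rewrite lte_fin; lra.
  have va : v a = r%:E.
    rewrite -vh_iota; apply/eqP; rewrite eq_le; apply/andP; split.
      rewrite leNgt; apply/negP => lta.
      have := valD_gt lt1 lta; rewrite subrK vb ltxx //.
    have -> : iota a = b - (b - iota a) by rewrite subKr.
    by apply: valD_ge; rewrite ?vb // Defs.valN ltW.
  have a0 : a != 0 by apply: contra_eq_neq va => ->; rewrite Defs.val0.
  by have [z] := discrete_int hv a0; rewrite va => ->; exists z.
move=> [z _ <-]; have [c c0 vc] := discrete_surj hv z.
by exists (iota c); rewrite ?fmorph_eq0 // vh_iota.
Qed.

Lemma approx_poly (g : {poly Kv}) (N : rat) : exists g' : {poly K},
  (size g' <= size g)%N /\ forall i, (N%:E <= vh (g - g'^io)%R`_i)%E.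
Proof.
have [_ dense _] := hvh; have [f fP] := choice (fun y => dense y N).
exists (\poly_(i < size g) f g`_i); split=> [|i]; first exact: size_poly.
rewrite coefB coef_map /= coef_poly; case: ltnP => ig; first exact: fP.
by rewrite rmorph0 subr0 nth_default // Defs.val0 leey.
Qed.

Section Approx.
Variable m : pseudoval Kv.
Hypothesis m_ext : extends vh m.

Lemma approx_psv (g : {poly Kv}) (N : rat) : exists g' : {poly K},
  (size g' <= size g)%N /\ (N%:E < m (g - g'^io)%R)%E.
Proof.
have [g' [sg' H]] := approx_poly g (N + 1); exists g'; split=> //.
apply: lt_le_trans (_ : ((N + 1)%:E <= _)%E); first by rewrite lte_fin; lra.
by apply: extends_ge m_ext _ => i _; exact: H.
Qed.

Lemma approx_finite (g : {poly Kv}) : m g \is a fin_num -> exists g' : {poly K},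
  (size g' <= size g)%N /\ (m g < m (g - g'^io)%R)%E.
Proof.
by case: (m g) (approx_psv g) => // r H _; exact: H.
Qed.

(** Only the part below the leading monomial is approximated, which preserves degree and
    monicity. *)
Lemma approx_monic (g : {poly Kv}) (N : rat) : g \is monic -> exists g' : {poly K},
  [/\ g' \is monic, size g' = size g & (N%:E < m (g - g'^io)%R)%E].
Proof.
move=> gM; have s0 : (size g).-1.+1 = size g by rewrite prednK // size_poly_gt0 monic_neq0.
have sa : (size (g - 'X^((size g).-1))%R < size g)%N.
  by apply: monic_decomposition => //; rewrite ?monicXn ?size_polyXn.
have [a' [sa' Ha]] := approx_psv (g - 'X^((size g).-1)) N.
have lt_a' : (size a' < size ('X^((size g).-1) : {poly K})%R)%N.
  by rewrite size_polyXn s0; exact: leq_ltn_trans sa' sa.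
exists ('X^((size g).-1) + a'); split.
- by rewrite monicE lead_coefDl // lead_coefXn.
- by rewrite size_polyDl // size_polyXn.
- by rewrite rmorphD /= map_polyXn opprD addrA.
Qed.

End Approx.

Section Restriction.
Variables (muh : valuation {fraction {poly Kv}}) (mu : valuation {fraction {poly K}}).

Lemma restrictsP : restricts iota muh mu <->
  forall g, polval muh g^io = polval mu g.
Proof.
split=> [H g|H f]; first by rewrite polvalE -fraction_map_tofrac H.
rewrite /fraction_map {3}(fraction_reprE f).
have d0 : \d_(repr f) != 0 := denom_ratioP _.
by rewrite !val_div ?map_poly_eq0 // !H.
Qed.

Hypothesis hmu : restricts iota muh mu.
Hypothesis muh_ext : extends vh (polval muh).

Lemma restr_pol g : polval muh g^io = polval mu g.
Proof. by move/restrictsP: hmu => ->. Qed.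

Lemma mdiv_map phi (g : {poly K}) : phi != 0 -> g != 0 ->
  mdiv (polval muh) phi^io g^io <-> mdiv (polval mu) phi g.
Proof.
move=> phi0 g0; split=> [[q hq]|[q hq]]; last first.
  by exists q^io; rewrite -rmorphM -rmorphB !restr_pol.
have := polval_fin mu g0; case mg : (polval mu g) => [r||] // _.
have := polval_fin mu phi0; case mphi : (polval mu phi) => [s||] // _.
(* At precision r - s the error [phi^io * (q - q'^io)] has value above r. *)
have [q' [_ Hq']] := approx_psv muh_ext q (r - s).
exists q'; rewrite mg -restr_pol rmorphB rmorphM.
have -> : g^io - phi^io * q'^io = (g^io - phi^io * q) + phi^io * (q - q'^io) by ring.
apply: psvD_gt; first by rewrite -mg -restr_pol.
by rewrite psvM restr_pol mphi; exact: lte_EFinB.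
Qed.

(** Divisibility sees initial forms only, and each non-zero polynomial over K_v shares its initial
    form with one over K of no larger degree. *)
Lemma key_lift phi : iskey (polval mu) phi <-> iskey (polval muh) phi^io.
Proof.
have mhf := polval_fin muh.
have ap (g : {poly Kv}) : g != 0 -> exists g' : {poly K}, [/\ (size g' <= size g)%N,
    g' != 0 & (polval muh g < polval muh (g - g'^io)%R)%E].
  move=> g0; have [g' [sg' lt_g]] := approx_finite muh_ext (mhf _ g0).
  exists g'; split=> //; apply: contraTneq lt_g => ->.
  by rewrite rmorph0 subr0 ltxx.
have sym (g g' : {poly Kv}) : (polval muh g < polval muh (g - g')%R)%E ->
    (polval muh g' < polval muh (g' - g)%R)%E.
  by move=> lt_g; rewrite (psv_sub_eq lt_g) psvBC.
split=> kphi.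
  have phi0 := key_neq0 kphi.
  split; [by rewrite map_monic (key_monic kphi)|by rewrite size_map_poly (key_size kphi)| |].
    move=> a b a0 b0 dab.
    have [a' [_ a'0 ha]] := ap _ a0; have [b' [_ b'0 hb]] := ap _ b0.
    have : mdiv (polval muh) phi^io (a' * b')^io.
      apply: mdiv_congr dab; rewrite rmorphM.
      have -> : a * b - a'^io * b'^io = (a - a'^io) * b + a'^io * (b - b'^io) by ring.
      rewrite psvM; apply: psvD_gt; rewrite psvM; first by rewrite lteD2rE // mhf.
      by rewrite (psv_sub_eq ha) lteD2lE // mhf.
    rewrite mdiv_map ?mulf_neq0 // => /(key_prime kphi a'0 b'0).
    rewrite -!mdiv_map //; case=> H; [left | right].
      exact: mdiv_congr (sym _ _ ha) H.
    exact: mdiv_congr (sym _ _ hb) H.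
  move=> g g0; rewrite size_map_poly => sg dg.
  have [g' [sg' g'0 hg]] := ap _ g0.
  apply: (key_min kphi g'0); first exact: leq_ltn_trans sg' sg.
  by rewrite -mdiv_map //; exact: mdiv_congr dg.
have phi0 : phi != 0 by have := key_neq0 kphi; rewrite map_poly_eq0.
split; [by rewrite -(map_monic iota) (key_monic kphi)
  | by rewrite -(size_map_poly iota) (key_size kphi) | |].
  move=> a b a0 b0; rewrite -!mdiv_map ?mulf_neq0 // rmorphM.
  by apply: (key_prime kphi); rewrite map_poly_eq0.
move=> g g0 sg; rewrite -mdiv_map //.
by apply: (key_min kphi); rewrite ?map_poly_eq0 // !size_map_poly.
Qed.

End Restriction.

(** A polynomial over K close enough to g has the value of g under both extensions. *)
Lemma restricts_unique mu muh muh' : restricts iota muh mu -> restricts iota muh' mu ->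
  extends vh (polval muh) -> extends vh (polval muh') -> muh = muh'.
Proof.
move=> h h' e e'; apply: polval_inj => g.
have [->|g0] := eqVneq g 0; first by rewrite !psv0.
have := polval_fin muh g0; case mg : (polval muh g) => [r||] // _.
have := polval_fin muh' g0; case mg' : (polval muh' g) => [r'||] // _.
have [g' [_ H]] := approx_poly g (Num.max r r' + 1).
have lt m : extends vh m -> ((Num.max r r')%:E < m (g - g'^io)%R)%E.
  move=> em; apply: lt_le_trans (_ : ((Num.max r r' + 1)%:E <= _)%E).
    by rewrite lte_fin ltrDl.
  by apply: extends_ge em _ => i _; exact: H.
have lt1 : (polval muh g < polval muh (g - g'^io)%R)%E.
  by apply: le_lt_trans (lt _ e); rewrite mg lee_fin le_max lexx.
have lt2 : (polval muh' g < polval muh' (g - g'^io)%R)%E.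
  by apply: le_lt_trans (lt _ e'); rewrite mg' lee_fin le_max lexx orbT.
by rewrite -mg -mg' -(psv_sub_eq lt1) -(psv_sub_eq lt2) !(restr_pol h, restr_pol h').
Qed.

Lemma chain_lift mu phis : maclane_chain v mu phis -> exists muh,
  maclane_chain vh muh [seq map_poly iota phi | phi <- phis] /\ restricts iota muh mu.
Proof.
elim=> [mu0 gmu|mu0 mu' ps phi l _ [muh [cmuh hmu]] /key_polynomial_iskey kphi l0 haug].
  have [muh gmuh] := gauss_exists vh; exists muh; split; first exact: MacLane_nil.
  apply/restrictsP => g; rewrite !polvalE gmu gmuh size_map_poly.
  by apply: eq_bigr => i _; rewrite coef_map /= vh_iota.
have ext := chain_extends cmuh.
have kphih : iskey (polval muh) phi^io by apply/(key_lift hmu ext).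
have [muh' haug'] := augmentation_exists kphih (ltW l0).
exists muh'; rewrite map_rcons; split.
  exact: MacLane_rcons cmuh (iskey_key_polynomial kphih) l0 haug'.
apply/restrictsP => g; have [n [a [sa ->]]] := poly_expansion g (key_size kphi).
rewrite rmorph_sum /=.
under eq_bigr => i _ do rewrite rmorphM rmorphXn /=.
rewrite (haug' n (fun s => (a s)^io)); last by move=> s; rewrite !size_map_poly.
rewrite haug //; apply: eq_bigr => i _; congr (_ + _)%E.
by have := restr_pol hmu (a i * phi ^+ i); rewrite rmorphM rmorphXn.
Qed.

Lemma inductive_lift mu : inductive_val v mu ->
  exists muh, inductive_val vh muh /\ restricts iota muh mu.
Proof.
case=> phis /chain_lift[muh [cmuh hmu]]; exists muh; split=> //.
by exists [seq map_poly iota phi | phi <- phis].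
Qed.

End Completion.

(** * Uniqueness of extensions to a finite extension *)

Definition complete (L : fieldType) (vh : valuation L) := forall u : nat -> L,
  (forall N : rat, exists M : nat, forall p q : nat,
     (M <= p)%N -> (M <= q)%N -> (N%:E <= vh (u p - u q)%R)%E) ->
  exists l : L, forall N : rat, exists M : nat, forall p : nat,
     (M <= p)%N -> (N%:E <= vh (u p - l)%R)%E.

Lemma rat_bound (x : rat) : exists n : nat, x <= n%:R.
Proof.
exists (Num.bound `|x|); apply: le_trans (ler_norm _) _; apply: ltW.
exact: archi_boundP.
Qed.

Section FiniteDimensional.
Variables (L : fieldType) (vh : valuation L).
Implicit Types (m : pseudoval L) (g h F : {poly L}).

(** The easy half of the equivalence of m with the coefficient norm; B is a lower bound for the
    values of the monomials. *)
Lemma psv_coef_ge m n : (forall c, m c%:P = vh c) -> exists B : rat,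
  forall g (x : rat), (size g <= n)%N -> (forall i, (i < n)%N -> (x%:E <= vh g`_i)%E) ->
    ((x + B)%:E <= m g)%E.
Proof.
move=> mC.
have [B HB] : exists B : rat, forall i, (i < n)%N -> (B%:E <= m 'X^i)%E.
  elim: n => [|n [B HB]]; first by exists 0.
  have [r Hr] : exists r : rat, (r%:E <= m 'X^n)%E.
    have := psvNy m 'X^n; case: (m 'X^n) => [r||] // _; first by exists r.
    by exists 0; rewrite leey.
  exists (Num.min B r) => i; rewrite ltnS leq_eqVlt => /orP[/eqP ->|/HB].
    by apply: le_trans Hr; rewrite lee_fin ge_min lexx orbT.
  by apply: le_trans; rewrite lee_fin ge_min lexx.
exists B => g x sg xg; rewrite -[g]coefK poly_def; apply: psv_sum_ge => i _.
have i_n : (i < n)%N := leq_trans (ltn_ord i) sg.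
by rewrite -mul_polyC psvM mC EFinD leeD ?xg ?HB.
Qed.

Hypothesis vh_complete : complete vh.

(** Otherwise some h_k have m('X^n + h_k) tending to infinity. By the bound in lower degree their
    coefficients are Cauchy, and the limit h would give 'X^n + h an infinite value. *)
Lemma psv_monic_bound m n (C0 : rat) : (forall c, m c%:P = vh c) ->
  (forall g, g != 0 -> (size g <= n.+1)%N -> m g != +oo%E) ->
  (forall g, (size g <= n)%N -> forall i, (m g <= vh g`_i + C0%:E)%E) ->
  exists C1 : rat, forall h, (size h <= n)%N -> (m ('X^n + h)%R <= C1%:E)%E.
Proof.
move=> mC mfin HC0; apply: contrapT => nC1.
have H (k : nat) : exists h, (size h <= n)%N /\ ((k%:R)%:E < m ('X^n + h)%R)%E.
  apply: contrapT => nh; apply: nC1; exists k%:R => h sh.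
  by rewrite leNgt; apply/negP => lt_h; apply: nh; exists h.
have {H}[u uP] := choice H.
have su p : (size (u p) <= n)%N by have [] := uP p.
have u_diff p q : ((minn p q)%:R%:E < m (u p - u q)%R)%E.
  have -> : u p - u q = ('X^n + u p) - ('X^n + u q) by ring.
  have [_ Hp] := uP p; have [_ Hq] := uP q.
  apply: psvB_gt; [apply: le_lt_trans Hp|apply: le_lt_trans Hq];
    by rewrite lee_fin ler_nat ?geq_minl ?geq_minr.
have lim i : exists l, forall N : rat, exists M : nat, forall p : nat,
    (M <= p)%N -> (N%:E <= vh ((u p)`_i - l)%R)%E.
  apply: vh_complete => N; have [M HM] := rat_bound (N + C0).
  exists M => p q Mp Mq.
  rewrite -coefB; have sd : (size (u p - u q)%R <= n)%N.
    by apply: leq_trans (size_polyD _ _) _; rewrite size_polyN geq_max !su.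
  have := lt_le_trans (u_diff p q) (HC0 _ sd i).
  have NC : N + C0 <= (minn p q)%:R.
    by apply: le_trans HM _; rewrite ler_nat leq_min Mp.
  case: (vh _) => [r||] //; last by rewrite leey.
  by rewrite -EFinD lte_fin lee_fin; lra.
have {lim}[l lP] := choice lim; pose h := \poly_(i < n) l i.
have sh : (size h <= n)%N by exact: size_poly.
have [B HB] := psv_coef_ge n mC.
have conv (N : rat) : exists M : nat, forall p, (M <= p)%N -> (N%:E <= m (u p - h)%R)%E.
  have [M HM] := choice (fun i => lP i (N - B)).
  exists (\max_(i < n) M i)%N => p Mp.
  rewrite -[N](subrK B); apply: HB.
    by apply: leq_trans (size_polyD _ _) _; rewrite size_polyN geq_max su.
  move=> i i_n; rewrite coefB coef_poly i_n; apply: HM.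
  exact: leq_trans (leq_bigmax (Ordinal i_n)) Mp.
have Xh0 : 'X^n + h != 0.
  by rewrite -size_poly_gt0 size_polyDl size_polyXn.
have : m ('X^n + h) != +oo%E by apply: mfin; rewrite // size_polyDl size_polyXn.
have := psvNy m ('X^n + h); case mXh : (m _) => [r||] // _ _.
have [M HM] := conv (r + 1); have [M' HM'] := rat_bound (r + 1).
pose p := maxn M M'.
suff : ((r%:E : \bar rat) < r%:E)%E by rewrite ltxx.
rewrite -[X in (_ < X)%E]mXh.
have -> : 'X^n + h = ('X^n + u p) - (u p - h) by ring.
have r1 : ((r%:E : \bar rat) < (r + 1)%:E)%E by rewrite lte_fin ltrDl.
apply: psvB_gt.
  have [_] := uP p; apply: lt_trans; apply: lt_le_trans r1 _.
  by rewrite lee_fin; apply: le_trans HM' _; rewrite ler_nat leq_maxr.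
by apply: lt_le_trans r1 (HM _ _); rewrite leq_maxl.
Qed.

(* Equivalence of norms on the finite-dimensional space of polynomials of     *)
(* size at most n, over a complete field.                                     *)
Lemma psv_coef_bound m n : (forall c, m c%:P = vh c) ->
  (forall g, g != 0 -> (size g <= n)%N -> m g != +oo%E) ->
  exists C : rat, forall g, (size g <= n)%N -> forall i, (m g <= vh g`_i + C%:E)%E.
Proof.
move=> mC; elim: n => [|n IH] mfin.
  exists 0 => g; rewrite leqn0 size_poly_eq0 => /eqP -> i.
  by rewrite coef0 psv0 Defs.val0.
have [C0 HC0] : exists C : rat, forall g, (size g <= n)%N -> forall i, (m g <= vh g`_i + C%:E)%E.
  by apply: IH => g g0 sg; apply: mfin => //; exact: leqW.
have [C1 HC1] := psv_monic_bound mC mfin HC0.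
have [B HB] : exists B : rat, (B%:E <= m 'X^n)%E.
  have := psvNy m 'X^n; case: (m 'X^n) => [r||] // _; first by exists r.
  by exists 0; rewrite leey.
have lead g : (size g <= n.+1)%N -> (m g <= vh g`_n + C1%:E)%E.
  move=> sg; have [gn0|gn0] := eqVneq g`_n 0.
    by rewrite gn0 Defs.val0 addye // leey.
  pose h := (g`_n)^-1 *: g - 'X^n.
  have sh : (size h <= n)%N.
    apply/leq_sizeP => i; rewrite leq_eqVlt coefB coefZ coefXn => /orP[/eqP <-|ni].
      by rewrite eqxx mulVf ?subrr.
    have gi0 : g`_i = 0 by move/leq_sizeP: sg => ->.
    by rewrite gi0 mulr0 gtn_eqF ?subrr.
  have -> : g = (g`_n)%:P * ('X^n + h).
    by rewrite /h addrC subrK mul_polyC scalerA divff // scale1r.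
  have := HC1 _ sh; rewrite psvM mC => /(leeD2l (vh g`_n)).
  suff -> : ((g`_n)%:P * ('X^n + h))`_n = g`_n by [].
  by rewrite /h addrC subrK mul_polyC scalerA divff // scale1r.
(* C1 serves the leading coefficient. For the others, removing the leading term costs at most max(0,
   C1 - B), since m g <= v(g_n) + C1 while that term has value at least v(g_n) + B; then C0
   applies. *)
exists (Num.max C1 (C0 + Num.max 0 (C1 - B))) => g sg i.
have [->|ne_in] := eqVneq i n.
  by apply: le_trans (lead g sg) _; rewrite leeD2l // lee_fin le_max lexx.
pose h := g - (g`_n)%:P * 'X^n.
have hi : h`_i = g`_i by rewrite coefB coefCM coefXn (negPf ne_in) mulr0 subr0.
have sh : (size h <= n)%N.
  apply/leq_sizeP => k; rewrite leq_eqVlt coefB coefCM coefXn => /orP[/eqP <-|nk].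
    by rewrite eqxx mulr1 subrr.
  have gk0 : g`_k = 0 by move/leq_sizeP: sg => ->.
  by rewrite gk0 gtn_eqF ?mulr0 ?subrr.
set x := Num.max 0 _; set y := Num.max _ _.
have gh : (m g <= m h + x%:E)%E.
  have : (Order.min (m g) (vh g`_n + B%:E) <= m h)%E.
    apply: le_trans (psvD _ _ _); rewrite psvN psvM mC le_min !ge_min lexx /=.
    by rewrite leeD2l ?orbT.
  rewrite ge_min => /orP[mgh|vh_le].
    by rewrite -[m g]adde0; apply: leeD => //; rewrite lee_fin le_max lexx.
  apply: le_trans (lead g sg) _.
  have -> : (vh g`_n + C1%:E = vh g`_n + B%:E + (C1 - B)%:E)%E.
    by rewrite -addeA -EFinD (addrC B) subrK.
  by apply: leeD => //; rewrite lee_fin le_max lexx orbT.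
apply: le_trans gh _; apply: le_trans (leeD2r _ (HC0 h sh i)) _.
by rewrite hi -addeA leeD2l // -EFinD lee_fin le_max lexx orbT.
Qed.

Lemma psv_mod m F g : m F = +oo%E -> m g = m (g %% F).
Proof.
move=> mF; rewrite {1}(divp_eq g F).
have mq : m (g %/ F * F) = +oo%E by rewrite psvM mF addey // psvNy.
have [r0|r0] := eqVneq (m (g %% F)) +oo%E.
  by rewrite r0; apply/eqP; rewrite -leye_eq; apply: psvD_ge; rewrite ?mq ?r0.
by rewrite addrC psvD_eq // mq ltey.
Qed.

(* A valuation on L[x]/(F) extending a complete one is unique: compare the    *)
(* values of all powers of g.                                                 *)
Lemma psv_residue_le m1 m2 F : F != 0 ->
  (forall c, m1 c%:P = vh c) -> (forall c, m2 c%:P = vh c) ->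
  m1 F = +oo%E -> m2 F = +oo%E ->
  (forall g, g != 0 -> (size g < size F)%N -> m1 g != +oo%E) ->
  forall g, (m1 g <= m2 g)%E.
Proof.
move=> F0 m1C m2C m1F m2F fin1 g.
have s0 : (size F).-1.+1 = size F by rewrite prednK // size_poly_gt0.
have [|C HC] := @psv_coef_bound m1 (size F).-1 m1C.
  by move=> h h0 sh; apply: fin1; rewrite // -s0 ltnS.
have [B HB] := psv_coef_ge (size F).-1 m2C.
case m2g : (m2 g) (psvNy m2 g) => [b||] // _; last by rewrite leey.
case m1g : (m1 g) (psvNy m1 g) => [a||] // _; last first.
  have r0 : g %% F = 0.
    apply/eqP; apply: contraT => r0; have := fin1 _ r0 (ltn_modpN0 g F0).
    by rewrite -psv_mod // m1g eqxx.
  by move: m2g; rewrite (psv_mod g m2F) r0 psv0.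
rewrite lee_fin.
(* Reducing g^k modulo F, the comparison of both values through coefficients loses a constant
   independent of k, which large k makes negligible. *)
have step (k : nat) : a *+ k - C + B <= b *+ k.
  rewrite -lee_fin -(psvX k m2g) (psv_mod _ m2F).
  have sr : (size (g ^+ k %% F)%R <= (size F).-1)%N by rewrite -ltnS s0 ltn_modpN0.
  apply: HB => // i _; have := HC _ sr i.
  rewrite -(psv_mod _ m1F) (psvX k m1g).
  by case: (vh _) => [c||] //; rewrite ?leey // -EFinD !lee_fin; lra.
rewrite leNgt; apply/negP => ba.
have ab0 : 0 < a - b by rewrite subr_gt0.
have [k Hk] := rat_bound ((C - B + 1) / (a - b)).
move: Hk; rewrite ler_pdivrMr // mulr_natl mulrnBl.
by have := step k; lra.
Qed.

Lemma psv_residue_unique m1 m2 F : F != 0 ->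
  (forall c, m1 c%:P = vh c) -> (forall c, m2 c%:P = vh c) ->
  m1 F = +oo%E -> m2 F = +oo%E ->
  (forall g, g != 0 -> (size g < size F)%N -> m1 g != +oo%E) ->
  (forall g, g != 0 -> (size g < size F)%N -> m2 g != +oo%E) ->
  forall g, m1 g = m2 g.
Proof.
move=> F0 e1 e2 i1 i2 f1 f2 g; apply/eqP; rewrite eq_le.
by rewrite (@psv_residue_le m1 m2 F) // (@psv_residue_le m2 m1 F).
Qed.

End FiniteDimensional.

Section Integers.
Variables (L : fieldType) (u : valuation L).

Lemma integers_subring : subring_closed (integers u).
Proof.
split; first by rewrite unfold_in Defs.val1.
  by move=> a b; rewrite !unfold_in => a0 b0; apply: valD_ge; rewrite // Defs.valN.
by move=> a b; rewrite !unfold_in Defs.valM => a0 b0; exact: adde_ge0.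
Qed.

HB.instance Definition _ := GRing.isSubringClosed.Build L (integers u) integers_subring.

Lemma integersE a : (a \in integers u) = (0%:E <= u a)%E.
Proof. by []. Qed.

End Integers.

(** * Evaluation at a root *)

Section RootValuation.
Variables (L E : fieldType) (vh : valuation L) (w : valuation E).
Variable j : {rmorphism L -> E}.
Hypothesis hw : forall a, w (j a) = vh a.
Implicit Types (g h F : {poly L}) (theta : E).

Lemma root_val0 theta : root_val w j 0 theta = +oo%E.
Proof. by rewrite /root_val rmorph0 horner0 Defs.val0. Qed.

Lemma root_val1 theta : root_val w j 1 theta = 0%E.
Proof. by rewrite /root_val rmorph1 hornerC Defs.val1. Qed.

Lemma root_valM theta g h :
  root_val w j (g * h) theta = (root_val w j g theta + root_val w j h theta)%E.
Proof. by rewrite /root_val rmorphM hornerM Defs.valM. Qed.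

Lemma root_valD theta g h :
  (Order.min (root_val w j g theta) (root_val w j h theta) <= root_val w j (g + h)%R theta)%E.
Proof. by rewrite /root_val rmorphD hornerD Defs.valD. Qed.

Lemma val_Ny (F : fieldType) (u : valuation F) a : u a != -oo%E.
Proof.
have [->|/(val_fin u)/fin_numP[]//] := eqVneq a 0.
by rewrite Defs.val0.
Qed.

Definition rootpsv theta : pseudoval L := Pseudoval (root_val0 theta)
  (root_val1 theta) (root_valM theta) (root_valD theta)
  (fun g => val_Ny w (map_poly j g).[theta]).

Lemma rootpsvE theta g : rootpsv theta g = root_val w j g theta. Proof. by []. Qed.

Lemma rootpsvC theta c : rootpsv theta c%:P = vh c.
Proof. by rewrite rootpsvE /root_val map_polyC hornerC hw. Qed.

Lemma rootpsvX theta : rootpsv theta 'X = w theta.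
Proof. by rewrite rootpsvE /root_val map_polyX hornerX. Qed.

Lemma val_eqy (F : fieldType) (u : valuation F) a : (u a == +oo%E) = (a == 0).
Proof.
have [->|a0] := eqVneq a 0; first by rewrite Defs.val0.
by have /fin_numP[_ /negPf] := val_fin u a0.
Qed.

Lemma rootpsv_oo theta g : (rootpsv theta g == +oo%E) = root (map_poly j g) theta.
Proof. by rewrite rootpsvE /root_val val_eqy rootE. Qed.

Lemma rootpsv_irreducible theta F g : irreducible_poly F ->
  root (map_poly j F) theta -> (rootpsv theta g == +oo%E) = (F %| g).
Proof.
move=> Firr rF; rewrite rootpsv_oo; apply/idP/idP => [rg|/dvdpP[q ->]]; last first.
  by rewrite rmorphM rootM rF orbT.
apply: contraT => nFg.
have cop : coprimep F g.
  rewrite /coprimep; apply: contraT => s1.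
  have := Firr.2 _ s1 (dvdp_gcdl F g) => eqF.
  by case/negP: nFg; rewrite -(eqp_dvdl _ eqF) dvdp_gcdr.
have : coprimep (map_poly j F) (map_poly j g) by rewrite coprimep_map.
by move/coprimep_root => /(_ _ rF); rewrite -rootE rg.
Qed.

Hypothesis vh_complete : complete vh.

Lemma rootpsv_small theta F g : irreducible_poly F -> root (map_poly j F) theta ->
  g != 0 -> (size g < size F)%N -> rootpsv theta g != +oo%E.
Proof.
move=> Firr rF g0 sg; rewrite (rootpsv_irreducible _ Firr rF).
by apply/negP => /(dvdp_leq g0); rewrite leqNgt sg.
Qed.

Lemma rootpsv_residue (m : pseudoval L) F theta : irreducible_poly F -> root (map_poly j F) theta ->
  (forall c, m c%:P = vh c) -> (forall g, (m g == +oo%E) = (F %| g)) ->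
  forall g, m g = rootpsv theta g.
Proof.
move=> Firr rF mC mF; apply: (psv_residue_unique vh_complete (F := F)) => //.
- by rewrite -size_poly_gt0 ltnW // Firr.1.
- exact: rootpsvC.
- by apply/eqP; rewrite mF dvdpp.
- by apply/eqP; rewrite (rootpsv_irreducible _ Firr rF) dvdpp.
- move=> g g0 sg; rewrite mF.
  by apply/negP => /(dvdp_leq g0); rewrite leqNgt sg.
- by move=> g g0 sg; exact: rootpsv_small rF g0 sg.
Qed.

(** Both evaluations extend vh to the same field L[x]/(F). This makes delta_0 and mu_F independent
    of the root. *)
Lemma rootpsv_conjugate F theta theta' : irreducible_poly F ->
  root (map_poly j F) theta -> root (map_poly j F) theta' ->
  forall g, rootpsv theta g = rootpsv theta' g.
Proof.
move=> Firr r r'; apply: (rootpsv_residue Firr r'); first exact: rootpsvC.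
by move=> g; exact: rootpsv_irreducible.
Qed.

(** The residue valuation of F and evaluation at theta are both extensions of vh to L[x]/(F), hence
    equal by completeness. *)
Lemma key_root_val (muh : valuation {fraction {poly L}}) F theta :
  extends vh (polval muh) -> iskey (polval muh) F -> root (map_poly j F) theta ->
  forall g, polval muh (g %% F) = rootpsv theta g.
Proof.
move=> [muC _] kF rF g; rewrite -(resvalE kF).
have mf := polval_fin muh.
have Firr := key_irreducible mf kF.
apply: rootpsv_residue Firr rF _ _ g => [c|g]; last exact: resval_oo.
rewrite resval_small ?muC // size_polyC.
by apply: leq_ltn_trans (leq_b1 _) (key_size kF).
Qed.

Hypothesis hj : algebraic_closure j.

Lemma closed_root (p : {poly E}) : (1 < size p)%N -> exists x, root p x.
Proof.
move=> sp; have [closedE _] := hj.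
have p0 : p != 0 by rewrite -size_poly_gt0 ltnW.
have n0 : (0 < (size p).-1)%N by move: sp; case: (size p) => [|[]].
(* [closed_field_axiom] solves x^n = sum_i P_i x^i, whence the sign and the division by the leading
   coefficient. *)
have [x Hx] := closedE _ (fun i => - (p`_i / lead_coef p)) n0.
exists x; rewrite rootE horner_coef -(prednK (ltnW sp)) big_ord_recr /=.
rewrite Hx -lead_coefE mulr_sumr -big_split /= big1 // => i _.
by rewrite mulrA mulrN [lead_coef p * _]mulrC divfK ?lead_coef_eq0 // mulNr subrr.
Qed.

Lemma root_of F : (1 < size F)%N -> exists theta, root (map_poly j F) theta.
Proof. by move=> sF; apply: closed_root; rewrite size_map_poly. Qed.

Lemma monic_integral_roots (p : {poly E}) : p \is monic ->
  (forall x, root p x -> (0%:E <= w x)%E) -> p \is a polyOver (integers w).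
Proof.
have [n] := ubnP (size p); elim: n p => // n IH p sp pM rp.
have [s1|s1] := leqP (size p) 1.
  have /size1_polyC ep := s1; move: pM; rewrite ep monicE lead_coefC => /eqP ->.
  exact: rpred1.
have [x rx] := closed_root s1; have /factor_theorem[q pq] := rx.
have qM : q \is monic by move: pM; rewrite pq monicMr ?monicXsubC.
rewrite pq rpredM //; last by rewrite rpredB ?polyOverX // polyOverC unfold_in rp.
apply: IH => // [|y ry]; last by apply: rp; rewrite pq rootM ry.
by move: sp; rewrite pq size_Mmonic ?monicXsubC ?monic_neq0 // size_XsubC addn2.
Qed.

(** Each root of F has value mu(x mod F) >= mu(x) >= 0, and the coefficients are integral in the
    roots. *)
Lemma key_integral (muh : valuation {fraction {poly L}}) F :
  extends vh (polval muh) -> iskey (polval muh) F -> F \is a polyOver (integers vh).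
Proof.
move=> muE kF; have [muC muX] := muE; have FM := key_monic kF; have sF := key_size kF.
have : map_poly j F \is a polyOver (integers w).
  apply: monic_integral_roots; first by rewrite map_monic.
  move=> theta rF; rewrite -rootpsvX -(key_root_val muE kF rF).
  by apply: le_trans muX _; apply: key_mod_ge kF _.
move=> /polyOverP H; apply/polyOverP => i; have := H i.
by rewrite coef_map /= !integersE hw.
Qed.

End RootValuation.

(** * Prime polynomials and residual ideals *)

Section PrimePolynomials.
Variables (L : fieldType) (vh : valuation L).
Implicit Types (F G H : {poly L}).

(** Gauss's lemma: the Gauss value is additive and at most 0 on monic polynomials, so both factors
    of an integral product have value 0. *)
Lemma monic_factor_integral G H : G \is monic -> H \is monic ->
  G * H \is a polyOver (integers vh) -> G \is a polyOver (integers vh).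
Proof.
move=> GM HM /polyOverP GH; have [mu gmu] := gauss_exists vh.
have GH0 : (0%:E <= polval mu (G * H)%R)%E.
  by apply/(gauss_ge gmu) => i _; have := GH i; rewrite integersE.
have G0 : (0%:E <= polval mu G)%E.
  have := gauss_monic gmu GM; have := gauss_monic gmu HM; move: GH0; rewrite psvM.
  move: (psvNy (polval mu) G) (psvNy (polval mu) H).
  case: (polval mu G) => [g||] // _; case: (polval mu H) => [h||] // _.
  by rewrite -EFinD !lee_fin; lra.
by apply/polyOverP => i; rewrite integersE; apply: le_trans G0 (gauss_le gmu _ _).
Qed.

Lemma unit_over_integers_size F : unit_over_integers vh F -> size F = 1%N.
Proof.
case=> G _ FG; have F0 : F != 0 by apply: contra_eq_neq FG => ->; rewrite mul0r eq_sym oner_neq0.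
have G0 : G != 0 by apply: contra_eq_neq FG => ->; rewrite mulr0 eq_sym oner_neq0.
have := size_mul F0 G0; rewrite FG size_poly1.
move: F0 G0; rewrite -!size_poly_gt0.
by set x := size F; set y := size G; lia.
Qed.

(** A factorization over the field can be made monic, and is then integral by
    [monic_factor_integral]. *)
Lemma prime_irreducible F : prime_polynomial vh F -> irreducible_poly F.
Proof.
case=> FM FO nU Fprime; have F0 : F != 0 by exact: monic_neq0.
have sF : (1 < size F)%N.
  rewrite ltnNge; apply/negP => /size1_polyC eF; apply: nU.
  exists 1; first exact: rpred1.
  by move: FM; rewrite mulr1 eF monicE lead_coefC => /eqP ->.
split=> // q sq /dvdpP[r Frq].
have q0 : q != 0 by apply: contra_neq F0 => q0; rewrite Frq q0 mulr0.
have r0 : r != 0 by apply: contra_neq F0 => r0; rewrite Frq r0 mul0r.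
have lq0 : lead_coef q != 0 by rewrite lead_coef_eq0.
pose q1 := (lead_coef q)^-1 *: q; pose r1 := lead_coef q *: r.
have Fqr : F = q1 * r1.
  by rewrite Frq /q1 /r1 -scalerAl -scalerAr scalerA mulVf // scale1r mulrC.
have q1M : q1 \is monic by rewrite monicE lead_coefZ mulVf.
have r1M : r1 \is monic by move: FM; rewrite Fqr monicMl.
have [||U|U] := Fprime q1 r1 _ _ Fqr.
- by apply: monic_factor_integral q1M r1M _; rewrite -Fqr.
- by apply: monic_factor_integral r1M q1M _; rewrite mulrC -Fqr.
- have := unit_over_integers_size U; rewrite size_scale ?invr_neq0 // => s1.
  by rewrite s1 in sq.
have := unit_over_integers_size U => s1.
have r11 : r1 = 1.
  have /size1_polyC er : (size r1 <= 1)%N by rewrite s1.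
  by move: r1M; rewrite er monicE lead_coefC => /eqP ->.
by rewrite Fqr r11 mulr1 eqp_sym eqp_scale // invr_neq0.
Qed.

Lemma irreducible_prime F : F \is monic -> F \is a polyOver (integers vh) ->
  irreducible_poly F -> prime_polynomial vh F.
Proof.
move=> FM FO Firr; have F0 : F != 0 by exact: monic_neq0.
have unit1 G H : G \is a polyOver (integers vh) -> H \is a polyOver (integers vh) ->
    F = G * H -> size G = 1%N -> unit_over_integers vh G.
  move=> GO HO FGH sG; have /size1_polyC eG : (size G <= 1)%N by rewrite sG.
  exists (lead_coef H)%:P.
    by rewrite polyOverC lead_coefE; move/polyOverP: HO; apply.
  have : lead_coef F = 1 by exact/monicP.
  by rewrite FGH lead_coefM eG lead_coefC -polyCM => ->.
split=> // [/unit_over_integers_size sF|G H GO HO FGH].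
  by have := Firr.1; rewrite sF.
have [sG|sG] := eqVneq (size G) 1%N; first by left; exact: unit1 FGH sG.
right; apply: (unit1 H G HO GO); first by rewrite mulrC.
have GF : G %| F by rewrite FGH dvdp_mulr.
have /eqp_size := Firr.2 _ sG GF.
have G0 : G != 0 by apply: contra_neq F0 => G0; rewrite FGH G0 mul0r.
have H0 : H != 0 by apply: contra_neq F0 => H0; rewrite FGH H0 mulr0.
rewrite FGH size_mul //; move: G0 H0; rewrite -!size_poly_gt0.
by set x := size G; set y := size H; lia.
Qed.

End PrimePolynomials.

(** * Residual ideals of polynomials over K_v *)

Section ResidualExtension.
Variables (K Kv : fieldType) (v : valuation K) (vh : valuation Kv).
Variable iota : {rmorphism K -> Kv}.
Hypothesis (hvh : completion v vh iota).
Local Notation "g ^io" := (map_poly iota g) (at level 2, format "g ^io").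
Variables (muh : valuation {fraction {poly Kv}}) (mu : valuation {fraction {poly K}}).

(** [gr_map] acts on the representative chosen by [repr]; compatibility of the valuations allows any
    other. *)
Lemma gr_map_pi (hmu : restricts iota muh mu) (f : rees_type mu) :
  gr_map hmu (\pi_(gr mu) f) = \pi_(gr muh) (Rees (ratalg_map_rees hmu f)).
Proof.
rewrite /gr_map; apply/gr_eqP => a; rewrite !mcoeff_ratalg_map -rmorphB.
have /gr_eqP/(_ a) : \pi_(gr mu) (repr (\pi_(gr mu) f)) = \pi_(gr mu) f by rewrite reprK.
by rewrite -(restr_pol hmu).
Qed.

Hypotheses (muh_ind : inductive_val vh muh) (hmu : restricts iota muh mu).
Let muh_ext : extends vh (polval muh) := inductive_extends muh_ind.

Lemma residual_ideal_extP G x : G != 0 -> residual_ideal_ext iota vh mu G x <->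
  exists h, [/\ (0%:E <= polval mu h)%E, x = gr_class mu 0 h &
    exists q, (0%:E < polval muh (h^io - G * q)%R)%E].
Proof.
move=> G0; split.
  case=> muh' [hmu' [muh'_ind]].
  (* The extension hidden in [residual_ideal_ext] is muh itself. *)
  have e := restricts_unique hvh hmu hmu' muh_ext (inductive_extends muh'_ind).
  case: muh' / e hmu' {muh'_ind} => hmu'.
  have [f ->] := gr_surj x; rewrite gr_map_pi => /(residual_idealP _ G0)[h [h0 eh [q hq]]].
  have [h' [eh' ch']] := gr_class_pi h0.
  have Ef (a : rat) : (a%:E < polval muh (((val f)@_a)^io - (if a == 0 then h else 0))%R)%E.
    move: eh; rewrite eh' => /gr_eqP/(_ a); rewrite ch' /= mcoeff_ratalg_map.
    by [].
  (* The coefficients of f in other degrees vanish in the graded algebra because their images do. *)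
  pose f0 := (val f)@_0; have mf0 : (0%:E <= polval mu f0)%E by exact: rees_coef.
  exists f0; split=> //.
    have [f' [-> cf']] := gr_class_pi mf0; apply/gr_eqP => a; rewrite cf'.
    case: eqP => [->|/eqP a0]; first by rewrite subrr psv0 ltry.
    by rewrite subr0 -(restr_pol hmu'); have := Ef a; rewrite (negPf a0) subr0.
  exists q; have -> : f0^io - G * q = (f0^io - h) + (h - G * q) by ring.
  by apply: psvD_gt => //; have := Ef 0; rewrite eqxx.
case=> h [h0 -> [q hq]]; exists muh, hmu; split=> //.
apply/(residual_idealP _ G0); exists h^io; rewrite (restr_pol hmu); split=> //; last by exists q.
have h0' : (0%:E <= polval muh h^io)%E by rewrite (restr_pol hmu).
have [f [-> cf]] := gr_class_pi h0; have [f' [-> cf']] := gr_class_pi h0'.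
rewrite gr_map_pi; apply/gr_eqP => a; rewrite mcoeff_ratalg_map cf cf'.
by case: eqP; rewrite ?rmorph0 subrr psv0 ltry.
Qed.

(** Here [G * q] has value at least 0, so replacing G by G' alters it by a term of positive
    value. *)
Lemma residual_ideal_ext_congr G G' : G != 0 -> G' != 0 ->
  (polval muh G < polval muh (G - G')%R)%E ->
  residual_ideal_ext iota vh mu G `<=` residual_ideal_ext iota vh mu G'.
Proof.
move=> G0 G'0 lt_G x /(residual_ideal_extP _ G0)[h [h0 -> [q hq]]].
apply/(residual_ideal_extP _ G'0); exists h; split=> //; exists q.
have -> : h^io - G' * q = (h^io - G * q) + (G - G') * q by ring.
apply: psvD_gt => //.
have [->|q0] := eqVneq q 0; first by rewrite mulr0 psv0 ltry.
apply: le_lt_trans (_ : (0%:E <= polval muh (G * q)%R)%E) _.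
  have -> : G * q = h^io - (h^io - G * q) by rewrite subKr.
  by apply: psvB_ge; [rewrite (restr_pol hmu)|exact: ltW].
by rewrite !psvM lteD2rE // polval_fin.
Qed.

Lemma residual_ideal_ext_map phi : phi != 0 ->
  residual_ideal_ext iota vh mu phi^io = residual_ideal mu phi.
Proof.
move=> phi0; have phi0' : phi^io != 0 by rewrite map_poly_eq0.
apply/seteqP; split=> x.
  move=> /(residual_ideal_extP _ phi0')[h [h0 -> [q hq]]].
  apply/(residual_idealP _ phi0); exists h; split=> //.
  have := polval_fin mu phi0; case mphi : (polval mu phi) => [s||] // _.
  have [q' [_ Hq']] := approx_psv hvh muh_ext q (- s).
  exists q'; rewrite -(restr_pol hmu) rmorphB rmorphM.
  have -> : h^io - phi^io * q'^io = (h^io - phi^io * q) + phi^io * (q - q'^io) by ring.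
  apply: psvD_gt => //; rewrite psvM (restr_pol hmu) mphi.
  by apply: lte_EFinB; rewrite sub0r.
move=> /(residual_idealP _ phi0)[h [h0 -> [q hq]]].
apply/(residual_ideal_extP _ phi0'); exists h; split=> //; exists q^io.
by rewrite -rmorphM -rmorphB (restr_pol hmu).
Qed.

Hypothesis hv : discrete_valuation v.

(* A power of F times a constant has value 0, so lies in the residual ideal.  *)
Lemma residual_ideal_ext_mdiv F G : iskey (polval muh) F -> iskey (polval muh) G ->
  residual_ideal_ext iota vh mu F `<=` residual_ideal_ext iota vh mu G ->
  mdiv (polval muh) G F.
Proof.
move=> kF kG FG; have F0 := key_neq0 kF; have G0 := key_neq0 kG.
have mf := polval_fin muh.
have := mf _ F0; case mF : (polval muh F) => [r||] // _.
have d0 : (0 < `|denq r|)%N by rewrite absz_gt0 denq_neq0.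
(* With n the denominator of r = mu(F), a constant c of value - n r gives c F^n the value 0. *)
have [c c0 vc] := discrete_surj (completion_discrete hv hvh) (- numq r).
have [muC _] := muh_ext.
pose n := `|denq r|%N.
have muu : polval muh (c%:P * F ^+ n) = 0%E.
  rewrite psvM muC vc (psvX _ mF) -EFinD; congr EFin.
  rewrite /n -mulr_natr natr_absz (gtr0_norm (denq_gt0 r)) -numqE.
  by rewrite intrN addNr.
have [h [_ Hh]] := approx_psv hvh muh_ext (c%:P * F ^+ n) 0.
have mh : polval mu h = 0%:E by rewrite -(restr_pol hmu) (psv_sub_eq (a := c%:P * F ^+ n)) ?muu.
have h0 : (0%:E <= polval mu h)%E by rewrite mh.
have : residual_ideal_ext iota vh mu F (gr_class mu 0 h).
  apply/(residual_ideal_extP _ F0); exists h; split=> //.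
  exists (c%:P * F ^+ n.-1); rewrite psvBC.
  have -> : F * (c%:P * F ^+ n.-1) = c%:P * F ^+ n.
    by rewrite mulrCA -exprS prednK.
  exact: Hh.
move=> /FG/(residual_ideal_extP _ G0)[h' [h'0 /(gr_class_eq h0 h'0) hh' [q hq]]].
have cn0 : c%:P != 0 :> {poly Kv} by rewrite polyC_eq0.
have dG : mdiv (polval muh) G (c%:P * F ^+ n).
  exists q; rewrite muu.
  have -> : c%:P * F ^+ n - G * q =
      (c%:P * F ^+ n - h^io) + ((h^io - h'^io) + (h'^io - G * q)) by ring.
  apply: psvD_gt => //; apply: psvD_gt => //.
  by rewrite -rmorphB (restr_pol hmu).
(* G cannot divide the constant c, so it divides a power of F, hence F by primality. *)
have [|//] := key_prime kG cn0 (expf_neq0 n F0) dG.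
  move/(key_min kG cn0); case; rewrite size_polyC c0; exact: key_size kG.
have : (0 < n)%N by [].
elim: {dG muu Hh} n => // n IH _.
rewrite exprS => /(key_prime kG F0 (expf_neq0 n F0))[//|].
case: n IH => [_|n IH]; last exact: IH.
rewrite expr0 => /(key_min kG (oner_neq0 _)); case.
by rewrite size_poly1 (key_size kG).
Qed.

End ResidualExtension.

Lemma path_ltn_bounds (a x : nat) (s : seq nat) : path ltn a (rcons s x) ->
  (a < x)%N /\ forall y, y \in s -> (a < y < x)%N.
Proof.
elim: s a => [|b s IH] a /=; first by rewrite andbT.
move=> /andP[ab /IH[bx H]]; split; first exact: ltn_trans ab bx.
move=> y; rewrite inE => /orP[/eqP ->|/H/andP[by_ ->]]; first by rewrite ab.
by rewrite (ltn_trans ab by_).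
Qed.

(** Supplies the last clause of [okutsu_valuation]: by [key_exp_le], digits in a key polynomial
    never cancel. *)
Lemma key_expansion (K : fieldType) (m : pseudoval K) (phi : {poly K}) n
    (a : nat -> {poly K}) : iskey m phi -> (forall s, (size (a s) < size phi)%N) ->
  m (\sum_(s < n) a s * phi ^+ s)%R = \big[Order.min/+oo%E]_(s < n) m (a s * phi ^+ s)%R.
Proof.
move=> kphi; elim: n a => [|n IH] a sa; first by rewrite !big_ord0 psv0.
apply/eqP; rewrite eq_le; apply/andP; split; last first.
  by apply: psv_sum_ge => i _; exact: bigmin_le.
have e : \sum_(s < n.+1) a s * phi ^+ s = (\sum_(s < n) a s.+1 * phi ^+ s) * phi + a 0%N.
  rewrite big_ord_recl expr0 mulr1 addrC mulr_suml; congr (_ + _).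
  by apply: eq_bigr => i _; rewrite /= /bump leq0n add1n exprSr mulrA.
have [le1 le2] := key_exp_le kphi (\sum_(s < n) a s.+1 * phi ^+ s) (sa 0%N).
rewrite e; apply/bigmin_geP; split=> [|[[|i] lt_i] _ /=]; first by rewrite leey.
  by rewrite expr0 mulr1.
apply: le_trans le2 _; rewrite psvM (IH (fun s => a s.+1)) // exprSr mulrA psvM leeD2r //.
have lt_in : (i < n)%N by [].
by apply: (bigmin_inf (Ordinal lt_in)).
Qed.

(** * Okutsu frames *)

Section OkutsuFrames.
Variables (K Kv Kbar : fieldType) (v : valuation K) (vh : valuation Kv).
Variables (w : valuation Kbar).
Variables (iota : {rmorphism K -> Kv}) (j : {rmorphism Kv -> Kbar}).
Hypotheses (hv : discrete_valuation v) (hvh : completion v vh iota).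
Hypotheses (hj : algebraic_closure j) (hw : forall a : Kv, w (j a) = vh a).
Local Notation "g ^io" := (map_poly iota g) (at level 2, format "g ^io").
Implicit Types (F G : {poly Kv}) (phis : seq {poly K}) (theta : Kbar).

Lemma completion_complete : complete vh.
Proof. by have [_ _ H] := hvh. Qed.
Let vhc := completion_complete.

Lemma chain_integral mu phis : optimal_chain v mu phis ->
  forall phi, phi \in phis -> phi \is monic /\ phi \is a polyOver (integers v).
Proof.
move=> opt phi /(nthP 0)[i iphis <-].
have [mui [copt kphii _ _ _]] := chain_take opt iphis.
have [muh [cmuh hmu]] := chain_lift hvh copt.1.
have muhE := chain_extends cmuh.
have kh := (key_lift hvh hmu muhE _).1 kphii.
split; first exact: key_monic kphii.
apply/polyOverP => k; have /polyOverP/(_ k) := key_integral hw vhc hj muhE kh.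
by rewrite coef_map !integersE /= (vh_iota hvh).
Qed.

Lemma sorted_size_frame mu phis F : optimal_chain v mu phis -> (1 < size F)%N ->
  (phis = [::] \/ (size (last 0%R phis) < size F)%N) ->
  sorted ltn (1%N :: rcons [seq size (polyseq phi) | phi <- phis] (size F)).
Proof.
move=> [cmu smu] sF; have := optimal_keys cmu; case: phis smu {cmu} => [|p ps] /=.
  by rewrite sF.
move=> smu keys [//|lt_last]; have [_ ->] := keys p (mem_head _ _).
by rewrite rcons_path smu (last_map (fun phi : {poly K} => size (polyseq phi)) ps p).
Qed.

Section StrongKey.
Variables (mu : valuation {fraction {poly K}}) (phis : seq {poly K}).
Variables (muh : valuation {fraction {poly Kv}}) (F : {poly Kv}) (theta : Kbar).
Hypotheses (opt : optimal_chain v mu phis) (hmu : restricts iota muh mu).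
Hypotheses (muh_ext : extends vh (polval muh)) (kF : iskey (polval muh) F).
Hypothesis strF : phis = [::] \/ (size (last 0%R phis) < size F)%N.
Hypothesis rF : root (map_poly j F) theta.

Let sF := key_size kF.

Lemma frame_root_val G : (size G < size F)%N -> root_val w j G theta = polval muh G.
Proof.
move=> sG; rewrite -rootpsvE -(key_root_val hw vhc muh_ext kF rF).
by rewrite modp_small.
Qed.

Lemma frame_size phi : phi \in phis -> (1 < size phi < size F)%N.
Proof.
move=> phi_in; have /path_ltn_bounds[_ H] := sorted_size_frame opt sF strF.
by apply: H; exact: map_f.
Qed.

Lemma frame_nth_lt i : (i < size phis)%N -> frame_nth iota F phis i = (nth 0 phis i)^io.
Proof. by move=> iphis; rewrite /frame_nth (nth_map 0). Qed.

Lemma frame_nth_last : frame_nth iota F phis (size phis) = F.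
Proof. by rewrite /frame_nth nth_default // size_map. Qed.

Lemma weight_mapE (g : {poly K}) : g != 0 -> (size g < size F)%N ->
  weight w j g^io theta = (fine (polval mu g) / (size g).-1%:R)%:E.
Proof.
move=> g0 sg; rewrite /weight frame_root_val ?size_map_poly // (restr_pol hmu).
by rewrite EFinM fineK // polval_fin.
Qed.

Lemma okutsu_C_chain i : (i <= size phis)%N ->
  okutsu_C w iota j F theta phis i = (chain_C mu phis i)%:E.
Proof.
case: i => [|i] iphis //=; have /andP[s1 sF'] := frame_size (mem_nth 0 iphis).
by rewrite frame_nth_lt // weight_mapE // -size_poly_gt0 ltnW.
Qed.

Lemma okutsu_C_last : okutsu_C w iota j F theta phis (size phis).+1 = +oo%E.
Proof.
rewrite /= frame_nth_last /weight.
have -> : root_val w j F theta = +oo%E.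
  by apply/eqP; rewrite -(rootpsvE w j) rootpsv_oo.
by rewrite gt0_mulye // lte_fin invr_gt0 deg_gt0.
Qed.

(** Below deg F, evaluation at theta is muh, so the conditions are those of [chain_frame]; the last
    constant is infinite since F(theta) = 0. *)
Lemma strong_key_frame : okutsu_frame v w iota j F theta phis.
Proof.
have [CC gC gCr _] := chain_frame opt.
split.
- exact: chain_integral opt.
- exact: sorted_size_frame opt sF strF.
- move=> i; rewrite leq_eqVlt => /orP[/eqP ->|iphis].
    by rewrite okutsu_C_last okutsu_C_chain // ltry.
  by rewrite !okutsu_C_chain ?(ltnW iphis) // lte_fin CC.
- move=> i iphis g gM gO sg; rewrite okutsu_C_chain //.
  move: iphis; rewrite leq_eqVlt => /orP[/eqP ->|iphis].
    rewrite frame_nth_last => sgF; rewrite weight_mapE ?monic_neq0 // lee_fin.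
    by rewrite ler_pdivrMr ?deg_gt0 // -lee_fin fineK ?polval_fin ?monic_neq0 // gCr.
  rewrite frame_nth_lt // size_map_poly => sgi.
  have /andP[_ siF] := frame_size (mem_nth 0 iphis).
  rewrite weight_mapE ?monic_neq0 ?(ltn_trans sgi) // lee_fin.
  by rewrite ler_pdivrMr ?deg_gt0 // -lee_fin fineK ?polval_fin ?monic_neq0 // gC.
Qed.

(* The value of F is read off a key polynomial over K approximating it. *)
Lemma strong_key_delta0 : okutsu_delta0 w iota j F theta phis = polval muh F.
Proof.
have [_ _ _ mG] := chain_frame opt.
have FM := key_monic kF; have F0 := key_neq0 kF.
have := polval_fin muh F0; case mF : (polval muh F) => [r||] // _.
have [F' [F'M sF' ltF]] := approx_monic hvh muh_ext r FM.
have ltF' : (polval muh F < polval muh (F - F'^io)%R)%E by rewrite mF.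
have kF' : iskey (polval mu) F'.
  apply/(key_lift hvh hmu muh_ext); apply: (iskey_congr (polval_fin muh) kF) => //.
    by rewrite map_monic.
  by rewrite size_map_poly.
have := mG F' kF'; rewrite /strong_over sF' => /(_ strF).
rewrite -(restr_pol hmu) (psv_sub_eq ltF') mF => ->.
by rewrite /okutsu_delta0 okutsu_C_chain // -EFinM mulrC.
Qed.

Lemma strong_key_okutsu_valuation : okutsu_valuation v w iota j F muh.
Proof.
exists theta, phis; split=> //.
- exact: strong_key_frame.
- by move=> a sa; rewrite frame_root_val.
- by rewrite strong_key_delta0.
by move=> n a sa; exact: (key_expansion n kF sa).
Qed.

End StrongKey.

Lemma okutsu_C_ge0 F theta phis : okutsu_frame v w iota j F theta phis ->
  forall i, (i <= size phis)%N -> (0%:E <= okutsu_C w iota j F theta phis i)%E.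
Proof.
move=> [_ _ incr _]; elim=> // i IH iphis.
by apply: le_trans (IH (ltnW iphis)) _; apply/ltW/incr/ltnW.
Qed.

(** The last member of one frame competes in the final bound of the other. An empty frame has
    constant 0, below all others. *)
Lemma okutsu_C_le F theta theta' phis phis' : irreducible_poly F ->
  root (map_poly j F) theta -> root (map_poly j F) theta' ->
  okutsu_frame v w iota j F theta phis -> okutsu_frame v w iota j F theta' phis' ->
  (okutsu_C w iota j F theta phis (size phis)
    <= okutsu_C w iota j F theta' phis' (size phis'))%E.
Proof.
move=> Firr r r' fr fr'; have C'0 := okutsu_C_ge0 fr' (leqnn _).
have [_ _ _ /(_ _ (leqnn _)) bound] := fr'; rewrite frame_nth_last in bound.
case: fr; case/lastP: phis => [//|phis phi] mono srt _ _.
have phi_in : phi \in rcons phis phi by rewrite mem_rcons mem_head.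
have [phiM phiO] := mono _ phi_in.
have /path_ltn_bounds[_ /(_ (size phi))] := srt.
move=> /(_ (map_f (fun phi : {poly K} => size (polyseq phi)) phi_in))/andP[s1 s2].
have := bound phi phiM phiO s1 s2.
rewrite size_rcons /= frame_nth_lt ?size_rcons // nth_rcons ltnn eqxx.
rewrite /weight; have := rootpsv_conjugate hw vhc Firr r' r.
by rewrite -!(rootpsvE w j) => ->.
Qed.

Lemma okutsu_delta0_unique F theta theta' phis phis' : irreducible_poly F ->
  root (map_poly j F) theta -> root (map_poly j F) theta' ->
  okutsu_frame v w iota j F theta phis -> okutsu_frame v w iota j F theta' phis' ->
  okutsu_delta0 w iota j F theta phis = okutsu_delta0 w iota j F theta' phis'.
Proof.
move=> Firr r r' fr fr'; congr (_ * _)%E; apply/eqP; rewrite eq_le.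
by rewrite (okutsu_C_le Firr r r') // (okutsu_C_le Firr r' r).
Qed.

Lemma okutsu_valuation_unique F muF muF' : irreducible_poly F ->
  okutsu_valuation v w iota j F muF -> okutsu_valuation v w iota j F muF' ->
  muF = muF'.
Proof.
move=> Firr [t [ps [r fr small atF expn]]] [t' [ps' [r' fr' small' atF' expn']]].
apply: polval_inj => g; have [n [a [sa ->]]] := poly_expansion g Firr.1.
rewrite !polvalE expn // expn' //; apply: eq_bigr => i _.
rewrite -!polvalE !psvM; congr (_ + _)%E.
  rewrite !polvalE small // small' //.
  exact: (rootpsv_conjugate hw vhc Firr r r').
elim: (i : nat) => [|k IH]; first by rewrite !expr0 !psv1.
rewrite !exprS !psvM IH !polvalE atF atF'; congr (_ + _)%E.
exact: okutsu_delta0_unique.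
Qed.

(** Were w theta negative, the leading term theta^n would have strictly the least value in F(theta)
    = 0. *)
Lemma integral_root_ge0 F theta : F \is monic -> F \is a polyOver (integers vh) ->
  root (map_poly j F) theta -> (0%:E <= w theta)%E.
Proof.
move=> FM /polyOverP FO rF; rewrite leNgt; apply/negP => wneg.
pose m := rootpsv w j theta.
have mX : m 'X = w theta by exact: rootpsvX.
case mr : (w theta) wneg (val_Ny w theta) => [r||] //; rewrite lte_fin => r0 _.
have s0 : (size F).-1.+1 = size F by rewrite prednK // size_poly_gt0 monic_neq0.
set n := (size F).-1 in s0.
have EF : F = \sum_(i < n) F`_i *: 'X^i + 'X^n.
  rewrite -[LHS]coefK poly_def -s0 big_ord_recr /=; congr (_ + _).
  by have /monicP := FM; rewrite lead_coefE -/n => ->; rewrite scale1r.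
have mXn k : m 'X^k = (r *+ k)%:E by apply: psvX; rewrite mX.
have mF : m F = +oo%E by apply/eqP; rewrite rootpsv_oo.
have : ((r *+ n)%:E < m (\sum_(i < n) F`_i *: 'X^i)%R)%E.
  case: (n) => [|k]; first by rewrite big_ord0 psv0 ltry.
  apply: lt_le_trans (_ : ((r *+ k)%:E <= _)%E).
    by rewrite lte_fin mulrS gtrDr.
  apply: psv_sum_ge => i _; rewrite -mul_polyC psvM (rootpsvC hw) mXn.
  have ci := FO i; rewrite integersE in ci; rewrite -[X in (X <= _)%E]add0e.
  apply: leeD => //; rewrite lee_fin -[_ *+ k]mulr_natl -[_ *+ i]mulr_natl.
  by rewrite ler_wnM2r ?(ltW r0) // ler_nat -ltnS.
have -> : \sum_(i < n) F`_i *: 'X^i = F - 'X^n by rewrite {2}EF addrK.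
rewrite psvBC psvB_eq; first by rewrite mXn ltxx.
by rewrite mXn mF ltry.
Qed.

Section Pullback.
Variable m : pseudoval Kv.

Definition pullback : pseudoval K.
Proof.
refine (@Pseudoval K (fun g => m g^io) _ _ _ _ _).
- by rewrite rmorph0 psv0.
- by rewrite rmorph1 psv1.
- by move=> a b; rewrite rmorphM psvM.
- by move=> a b; rewrite rmorphD psvD.
- by move=> a; exact: psvNy.
Defined.

Lemma pullbackE g : pullback g = m g^io. Proof. by []. Qed.

End Pullback.

(* mu_F exists: approximate the pseudo-valuation g |-> w(g(theta)) on K[x] up *)
(* to degree deg F.                                                           *)
Lemma prime_strong_key F : prime_polynomial vh F -> exists mu phis muh,
  [/\ optimal_chain v mu phis, inductive_val vh muh, restricts iota muh mu,
      iskey (polval muh) F &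
      phis = [::] \/ (size (last 0%R phis) < size F)%N].
Proof.
move=> Fprime; have Firr := prime_irreducible Fprime.
have [FM FO _ _] := Fprime; have F0 := monic_neq0 FM; have sF := Firr.1.
have [theta rF] := root_of hj sF.
pose mr := rootpsv w j theta; pose m := pullback mr.
have mrE : extends vh mr.
  split=> [c|]; first exact: rootpsvC.
  by rewrite /mr rootpsvX; exact: integral_root_ge0 rF.
have mE : extends v m.
  split=> [c|]; first by rewrite pullbackE map_polyC mrE.1 (vh_iota hvh).
  by rewrite pullbackE map_polyX mrE.2.
have mr_small (g : {poly Kv}) : g != 0 -> (size g < size F)%N -> mr g != +oo%E.
  exact: rootpsv_small.
have m_bounded k : (1 < k < size F)%N -> exists B : rat,
    forall g : {poly K}, g \is monic -> size g = k -> (m g <= B%:E)%E.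
  move=> /andP[k1 kF].
  (* The coefficient bound, applied to the leading coefficient 1 of g, gives m g <= C. *)
  have [|C HC] := @psv_coef_bound _ _ vhc mr k mrE.1.
    by move=> g g0 sg; apply: mr_small => //; exact: leq_ltn_trans sg kF.
  exists C => g gM sg; rewrite pullbackE.
  have := HC g^io; rewrite size_map_poly sg => /(_ (leqnn _) k.-1).
  rewrite coef_map /=; have /monicP := gM; rewrite lead_coefE sg => ->.
  by rewrite rmorph1 Defs.val1 add0e.
have [|mu [phis [opt mu_le mu_small sphis]]] := chain_approximation hv mE m_bounded (k := size F).
  by rewrite sF leqnn.
have [muh [cmuh hmu]] := chain_lift hvh opt.1.
have muhE := chain_extends cmuh.
have approx (g : {poly Kv}) (N : rat) : exists g' : {poly K}, [/\ (size g' <= size g)%N,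
    (N%:E < polval muh (g - g'^io)%R)%E & (N%:E < mr (g - g'^io)%R)%E].
  have [g' [sg' H]] := approx_poly hvh g (N + 1); exists g'.
  have N1 : ((N%:E : \bar rat) < (N + 1)%:E)%E by rewrite lte_fin ltrDl.
  by split=> //; apply: lt_le_trans N1 _;
    [apply: extends_ge muhE _ | apply: extends_ge mrE _] => i _; exact: H.
exists mu, phis, muh; split=> //; first by exists [seq map_poly iota phi | phi <- phis].
(* Evaluation at theta agrees with muh below deg F and is infinite at F, so F is a minimal witness;
   the comparisons come from K by approximation. *)
- apply: (minimal_witness_key (m := mr)) => //.
  + exact: polval_fin.
  + move=> g; have [->|g0] := eqVneq g 0; first by rewrite !psv0.
    have := polval_fin muh g0; case mg : (polval muh g) => [r||] // _.
    have [g' [_ h1 h2]] := approx g r.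
    rewrite -[g](subrK g'^io); apply: psvD_ge; first exact: ltW.
    have e : polval muh g'^io = r%:E by rewrite -mg; apply: psv_sub_eq; rewrite mg.
    by rewrite -e (restr_pol hmu) -pullbackE mu_le.
  + move=> g sg; have [->|g0] := eqVneq g 0; first by rewrite !psv0.
    have := polval_fin muh g0; case mg : (polval muh g) => [r||] // _.
    have := mr_small _ g0 sg; have := psvNy mr g; case mrg : (mr g) => [s||] // _ _.
    have [g' [sg' h1 h2]] := approx g (Num.max r s).
    have e1 : polval muh g'^io = polval muh g.
      by apply: psv_sub_eq; apply: le_lt_trans h1; rewrite mg lee_fin le_max lexx.
    have e2 : mr g'^io = mr g.
      by apply: psv_sub_eq; apply: le_lt_trans h2; rewrite mrg lee_fin le_max lexx orbT.
    rewrite -mg -mrg -e1 -e2 (restr_pol hmu) -pullbackE; apply: mu_small.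
    exact: leq_ltn_trans sg' sg.
  + have -> : mr F = +oo%E by apply/eqP; rewrite rootpsv_oo.
    by rewrite ltey; have /fin_numP[_] := polval_fin muh F0.
- case: phis sphis {opt cmuh} => [|p ps] sphis; first by left.
  by right; apply: sphis; rewrite /= mem_last.
Qed.

End OkutsuFrames.

(** * The MacLane space *)

Section MacLaneSpace.
Variables (K Kv Kbar : fieldType) (v : valuation K) (vh : valuation Kv).
Variables (w : valuation Kbar).
Variables (iota : {rmorphism K -> Kv}) (j : {rmorphism Kv -> Kbar}).
Hypotheses (hv : discrete_valuation v) (hvh : completion v vh iota).
Hypotheses (hj : algebraic_closure j) (hw : forall a : Kv, w (j a) = vh a).
Local Notation "g ^io" := (map_poly iota g) (at level 2, format "g ^io").
Local Notation point mu F := (existT (fun m => set (gr m)) mu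
  (residual_ideal_ext iota vh mu F) : maclane_point K).
Let vhc := completion_complete hvh.

(** The common form of a point of the MacLane space ([maclane_point_data]) and of a prime polynomial
    ([prime_data]). *)
Record strong_key_data mu phis muh (F : {poly Kv}) : Prop := StrongKeyData {
  skd_chain : optimal_chain v mu phis;
  skd_ind : inductive_val vh muh;
  skd_restr : restricts iota muh mu;
  skd_key : iskey (polval muh) F;
  skd_strong : phis = [::] \/ (size (last 0%R phis) < size F)%N
}.

Section Point.
Variables (mu : valuation {fraction {poly K}}) (phis : seq {poly K}).
Variables (muh : valuation {fraction {poly Kv}}) (F : {poly Kv}).
Hypothesis data : strong_key_data mu phis muh F.

Let opt := skd_chain data.
Let muh_ind := skd_ind data.
Let hmu := skd_restr data.
Let kF := skd_key data.
Let strF := skd_strong data.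
Let muhE : extends vh (polval muh) := inductive_extends muh_ind.
Let mf := polval_fin muh.

Lemma skd_prime G : iskey (polval muh) G -> prime_polynomial vh G.
Proof.
move=> kG; apply: irreducible_prime (key_monic kG) _ (key_irreducible mf kG).
exact: (key_integral hw vhc hj muhE kG).
Qed.

Lemma skd_root : exists theta, root (map_poly j F) theta.
Proof. exact: (root_of hj (key_size kF)). Qed.

Lemma skd_okutsu_valuation : okutsu_valuation v w iota j F muh.
Proof.
have [theta rF] := skd_root.
exact: (strong_key_okutsu_valuation hvh hj hw opt hmu muhE kF strF rF).
Qed.

(** Since F(theta) = 0, G may be replaced by G - F, whose degree is below deg F. *)
Lemma skd_root_val (G : {poly Kv}) theta : size G = size F -> G \is monic ->
  root (map_poly j F) theta -> root_val w j G theta = polval muh (G - F).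
Proof.
move=> sG GM rF; rewrite -rootpsvE -(key_root_val hw vhc muhE kF rF).
have sa := monic_decomposition GM (key_monic kF) sG erefl.
by rewrite -[G in LHS](subrK F) modpD modpp addr0 modp_small.
Qed.

(** Equal residual ideals give mutual divisibility of F and G, hence equal degrees and mu(F) < mu(F
    - G), and conversely. By [strong_key_delta0] and [skd_root_val] this reads delta_0(F) <
    v(G(theta)). *)
Lemma skd_KP_at : KP_at iota vh (point mu F) = okutsu_class v vh w iota j F.
Proof.
have F0 := key_neq0 kF; apply/seteqP; split=> G /=.
  move=> [[muh' [muh'_ind hmu' kG'']] res].
  have kG : iskey (polval muh) G.
    rewrite (restricts_unique hvh hmu hmu' muhE (inductive_extends muh'_ind)).
    exact: key_polynomial_iskey.
  have d1 : mdiv (polval muh) F G.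
    by apply: (residual_ideal_ext_mdiv hvh muh_ind hmu hv kG kF); rewrite res.
  have d2 : mdiv (polval muh) G F.
    by apply: (residual_ideal_ext_mdiv hvh muh_ind hmu hv kF kG); rewrite res.
  have [sFG lt_F] := key_mdiv_congr kF kG d1 d2.
  split; first exact: skd_prime.
  have [theta rF] := skd_root; split=> //; exists theta, phis; split=> //.
    exact: (strong_key_frame hvh hj hw opt hmu muhE kF strF rF).
  rewrite (strong_key_delta0 hvh hw opt hmu muhE kF strF rF).
  by rewrite skd_root_val ?(key_monic kG) // psvBC.
move=> [Gprime [sFG [theta [Fs [rF fr lt_F]]]]].
have [GM _ _ _] := Gprime; have G0 := monic_neq0 GM.
have Firr := key_irreducible mf kF.
have fr0 := strong_key_frame hvh hj hw opt hmu muhE kF strF rF.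
move: lt_F; rewrite (okutsu_delta0_unique hvh hw Firr rF rF fr fr0).
rewrite (strong_key_delta0 hvh hw opt hmu muhE kF strF rF).
rewrite skd_root_val // psvBC => lt_F.
have kG : iskey (polval muh) G by exact: (iskey_congr mf kF GM (esym sFG) lt_F).
split; first by exists muh; split=> //; exact: iskey_key_polynomial.
have lt_G : (polval muh G < polval muh (G - F)%R)%E by rewrite (psv_sub_eq lt_F) psvBC.
apply/seteqP; split.
  exact: (residual_ideal_ext_congr hvh muh_ind hmu G0 F0 lt_G).
exact: (residual_ideal_ext_congr hvh muh_ind hmu F0 G0 lt_F).
Qed.

(** A strong key polynomial over K is required: an approximation F' of F has the same initial form,
    hence the same residual ideal. *)
Lemma skd_maclane_space : maclane_space v (point mu F).
Proof.
have FM := key_monic kF; have F0 := key_neq0 kF.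
have := mf F0; case mF : (polval muh F) => [r||] // _.
have [F' [F'M sF' ltF]] := approx_monic hvh muhE r FM.
have ltF1 : (polval muh F < polval muh (F - F'^io)%R)%E by rewrite mF.
have ltF2 : (polval muh F'^io < polval muh (F'^io - F)%R)%E.
  by rewrite (psv_sub_eq ltF1) psvBC.
have F'0 : F' != 0 by exact: monic_neq0.
have F'0' : F'^io != 0 by rewrite map_poly_eq0.
have kF' : iskey (polval mu) F'.
  apply/(key_lift hvh hmu muhE); apply: (iskey_congr mf kF) => //.
    by rewrite map_monic.
  by rewrite size_map_poly.
have resE : residual_ideal_ext iota vh mu F = residual_ideal mu F'.
  rewrite -(residual_ideal_ext_map hvh muh_ind hmu F'0); apply/seteqP; split.
    exact: (residual_ideal_ext_congr hvh muh_ind hmu F0 F'0' ltF1).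
  exact: (residual_ideal_ext_congr hvh muh_ind hmu F'0' F0 ltF2).
split; rewrite /= ?resE.
- by exists phis; case: opt.
- exact: residual_ideal_maximal.
exists F' => //; split; first exact: iskey_key_polynomial.
by exists phis; rewrite ?sF'.
Qed.

(** Equal residual ideals force equal degrees, so strength passes from F to G. *)
Lemma skd_residual_size G : iskey (polval muh) G ->
  residual_ideal_ext iota vh mu G = residual_ideal_ext iota vh mu F ->
  strong_key_data mu phis muh G.
Proof.
move=> kG res.
have d1 : mdiv (polval muh) F G.
  by apply: (residual_ideal_ext_mdiv hvh muh_ind hmu hv kG kF); rewrite res.
have d2 : mdiv (polval muh) G F.
  by apply: (residual_ideal_ext_mdiv hvh muh_ind hmu hv kF kG); rewrite res.
have [sFG _] := key_mdiv_congr kF kG d1 d2.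
by split=> //; rewrite -sFG.
Qed.

End Point.

Lemma maclane_point_data (x : maclane_point K) : maclane_space v x ->
  exists phis muh F, strong_key_data (projT1 x) phis muh F /\
    projT2 x = residual_ideal_ext iota vh (projT1 x) F.
Proof.
case: x => mu L [/= mu_ind _ [phi [/key_polynomial_iskey kphi [phis opt str]] ->]].
have [muh [muh_ind hmu]] := inductive_lift hvh mu_ind.
have muhE := inductive_extends muh_ind.
exists phis, muh, phi^io; split; last first.
  by rewrite (residual_ideal_ext_map hvh muh_ind hmu) // (key_neq0 kphi).
split=> //; first exact/(key_lift hvh hmu muhE).
by rewrite size_map_poly.
Qed.

Lemma restricts_inj mu mu' muh : restricts iota muh mu -> restricts iota muh mu' -> mu = mu'.
Proof. by move=> h h'; apply: polval_inj => g; rewrite -(restr_pol h) (restr_pol h'). Qed.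

Lemma prime_data F : prime_polynomial vh F ->
  exists mu phis muh, strong_key_data mu phis muh F.
Proof.
by move=> /(prime_strong_key hv hvh hj hw)[mu [phis [muh [? ? ? ? ?]]]]; exists mu, phis, muh.
Qed.

Lemma KP_at_bij : set_bij (maclane_space v) (prime_quotient v vh w iota j) (KP_at iota vh).
Proof.
split.
- move=> x /maclane_point_data[phis [muh [F [data ex]]]].
  have -> : x = point (projT1 x) F by rewrite -ex; case: (x).
  rewrite (skd_KP_at data); exists F => //; exact: (skd_prime data (skd_key data)).
- move=> x y /set_mem/maclane_point_data[phis [muh [F [data ex]]]].
  move=> /set_mem/maclane_point_data[phis' [muh' [G [data' ey]]]] exy.
  have px : x = point (projT1 x) F by rewrite -ex; case: (x).
  have Fx : KP_at iota vh x F.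
    split=> //; exists muh; split; [exact: skd_ind data|exact: skd_restr data|].
    exact: (iskey_key_polynomial (skd_key data)).
  move: Fx; rewrite exy => -[[muh1 [muh1_ind hmu1 kF1]] res].
  have kF : iskey (polval muh') F.
    rewrite (restricts_unique hvh (skd_restr data') hmu1
      (inductive_extends (skd_ind data')) (inductive_extends muh1_ind)).
    exact: key_polynomial_iskey.
  have dataF := skd_residual_size data' kF (etrans res ey).
  have Firr := key_irreducible (polval_fin muh') kF.
  (* F lies in the common image of x and y, so the extensions of both valuations are mu_F. *)
  have e := okutsu_valuation_unique hvh hw Firr (skd_okutsu_valuation data)
    (skd_okutsu_valuation dataF).
  have e1 : projT1 x = projT1 y.
    by apply: restricts_inj (skd_restr data) _; rewrite e; exact: (skd_restr data').
  have py : y = point (projT1 y) F by rewrite res; case: (y).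
  by rewrite px py e1.
- move=> C [F Fprime <-]; have [mu [phis [muh data]]] := prime_data Fprime.
  exists (point mu F); first exact: (skd_maclane_space data).
  exact: (skd_KP_at data).
Qed.

End MacLaneSpace.

Theorem theorem6p19 (K Kv Kbar : fieldType)
    (v : valuation K) (vh : valuation Kv) (w : valuation Kbar)
    (iota : {rmorphism K -> Kv}) (j : {rmorphism Kv -> Kbar})
    (hv : discrete_valuation v) (hvh : completion v vh iota)
    (hj : algebraic_closure j) (hw : forall a : Kv, w (j a) = vh a) :
  set_bij (maclane_space v) (prime_quotient v vh w iota j) (KP_at iota vh)
  /\ forall F : {poly Kv}, prime_polynomial vh F ->
       (exists mu, okutsu_restriction v w iota j F mu) /\
       forall mu, okutsu_restriction v w iota j F mu ->
         let x : maclane_point K :=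
           existT (fun m => set (gr m)) mu (residual_ideal_ext iota vh mu F) in
         maclane_space v x /\ KP_at iota vh x = okutsu_class v vh w iota j F.
Proof.
split=> [|F Fprime]; first exact: KP_at_bij.
have [mu [phis [muh data]]] := prime_data hv hvh hj hw Fprime.
have muhF := skd_okutsu_valuation hvh hj hw data.
split=> [|mu' [muF muF_ok hmu'] x].
  by exists mu, muh => //; exact: (skd_restr data).
(* As mu_F is unique, mu' and mu are restrictions of the same valuation. *)
have e := okutsu_valuation_unique hvh hw (prime_irreducible Fprime) muF_ok muhF.
have e' : mu' = mu.
  by apply: (restricts_inj (iota := iota) (muh := muh)); [rewrite -e | exact: skd_restr data].
rewrite /x e'; split; first exact: (skd_maclane_space hvh data).
exact: (skd_KP_at hv hvh hj hw data).
Qed.
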